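(* Let $T>0$, let $g\in C^{3k-1}(\mathbb R)$ with $g(0)=g'(0)=0$, $u_0\in H^{3k}(I)$, $\mu_0,\nu_0\in H^{k+1/3}(0,T)$, $\nu_1\in H^k(0,T)$, $f\in M^k(Q_T)$, and suppose $$\mu_0^{(m)}(0)=\Phi_m(0;u_0,f),\quad \nu_0^{(m)}(0)=\Phi_m(R;u_0,f),\quad \nu_1^{(m)}(0)=\Phi_m'(R;u_0,f),\qquad 0\le m\le k-1.$$ Suppose in addition that $$\partial_t^m f\in C([0,T];H^{3(k-m-1)}(I))\cap L_2(0,T;H^{3(k-m)-2}(I)),\quad 0\le m\le k-1.$$ Let $u\in X^k(Q_T)$ be the solution of the problem $$u_t+bu_x+u_{xxx}+(g(u))_x=f(t,x)\ \text{ in } Q_T,$$ $$u(0,x)=u_0(x),\quad u(t,0)=\mu_0(t),\quad u(t,R)=\nu_0(t),\quad u_x(t,R)=\nu_1(t).$$ Then $$\partial_t^m u\in C([0,T];H^{3(k-m)}(I))\cap L_2(0,T;H^{3(k-m)+1}(I)),\quad 0\le m\le k-1.$$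
   Context: Throughout, $R>0$, $I=(0,R)$, $Q_T=(0,T)\times I$, $b\in\mathbb R$ is a constant, $k\ge 1$ is a fixed integer; functions are real-valued. $X^k(Q_T)$ is the space of $u(t,x)$ with $\partial_t^m u\in C([0,T];L_2(I))\cap L_2(0,T;H^1(I))$ for $0\le m\le k$ and $\partial_t^m u|_{t=0}\in H^{3(k-m)}(I)$ for $0\le m\le k-1$. $M^k(Q_T)$ is the space of $f(t,x)$ with $\partial_t^m f\in L_2(Q_T)$ for $0\le m\le k$ and $\partial_t^m f|_{t=0}\in H^{3(k-m-1)}(I)$ for $0\le m\le k-1$ (the representative with $\partial_t^m f\in C([0,T];L_2(I))$, $0\le m\le k-1$, is used). $H^s(0,T)$ is the space of restrictions to $(0,T)$ of functions in $H^s(\mathbb R)=\{f:(1+\xi^2)^{s/2}\widehat f(\xi)\in L_2(\mathbb R)\}$. The functions $\Phi_m(x)=\Phi_m(x;u_0,f)$ are defined by $\Phi_0\equiv u_0$ and, for $m\ge1$, $$\Phi_m\equiv\partial_t^{m-1}f|_{t=0}-(b\Phi_{m-1}'+\Phi_{m-1}''')-\Big(\sum_{l=0}^{m-1}g^{(l)}(u_0)\sum_{n_1+\dots+n_l=m-1}c_{m-1,l,n_1,\dots,n_l}\Phi_{n_1}\cdots\Phi_{n_l}\Big)',$$ where the constants $c_{m,l,n_1,\dots,n_l}$ are those of the formal differentiation formula $\partial_t^m g(u)=\sum_{l=0}^m g^{(l)}(u)\sum_{n_1+\dots+n_l=m}c_{m,l,n_1,\dots,n_l}\partial_t^{n_1}u\cdots\partial_t^{n_l}u$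 (with $c_{0,0}=1$, $c_{m,0}=0$ for $m\ge1$, and $n_i\ge1$). Primes denote $d/dx$. A function $u\in X^k(Q_T)$ is a solution of $u_t+bu_x+u_{xxx}+(g(u))_x=f$, $u|_{t=0}=u_0$, $u|_{x=0}=\mu_0$, $u|_{x=R}=\nu_0$, $u_x|_{x=R}=\nu_1$ in the sense of the integral identity $$\iint_{Q_T}\big[u(\phi_t+b\phi_x+\phi_{xxx})+g(u)\phi_x+f\phi\big]dxdt+\int_I u_0\phi|_{t=0}dx+\int_0^T\big(\mu_0\phi_{xx}|_{x=0}-\nu_0\phi_{xx}|_{x=R}+\nu_1\phi_x|_{x=R}\big)dt=0$$ for all $\phi\in L_2(0,T;H^3(I))$ with $\phi_t\in L_2(Q_T)$, $\phi|_{t=T}=0$, $\phi|_{x=0}=\phi_x|_{x=0}=\phi|_{x=R}=0$. *)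

(* Defs.v *)
From HB Require Import structures.
From mathcomp Require Import all_boot all_order all_algebra.
From mathcomp Require Import all_classical all_reals all_analysis.

Set Implicit Arguments.
Unset Strict Implicit.
Unset Printing Implicit Defensive.
Import Order.TTheory GRing.Theory Num.Theory.
Import numFieldNormedType.Exports.
Local Open Scope classical_set_scope.
Local Open Scope ring_scope.

(** The spatial interval is I = (0, L), the time interval is (0, T).  An element
    of L_2(Q_T) is represented by a function [v : R * R -> R], applied to
    pairs [(t, x)], of which only the values on Q_T matter, up to a.e.
    equality.  All measures are Lebesgue measures on Borel sets. *)

Section Defs.
Context {R : realType}.
Local Notation mu1 := (@lebesgue_measure R).
Local Notation mu2 := (mu1 \x mu1)%E.
Implicit Types (L T : R) (f g h : R -> R) (v w : R * R -> R).

Definition QT T L : set (R * R) := `]0, T[ `*` `]0, L[.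

Definition ae_on L (P : R -> Prop) : Prop :=
  {ae mu1, forall x, x \in `]0, L[ -> P x}.

Definition L2I L f : Prop := f \_ `]0, L[ \in Lfun mu1 2%:E.

Definition normL2I L f : \bar R :=
  ('N[mu1]_2%:E[EFin \o (f \_ `]0%R, L[)])%E.

Definition L2Q T L v : Prop := v \_ (QT T L) \in Lfun mu2 2%:E.

(* Existence and continuity of all iterated directional derivatives is
   smoothness when [V] is finite dimensional; [V] is R or R * R below. *)
Definition smooth (V : normedModType R) (phi : V -> R) : Prop :=
  forall vs : seq V,
    let psi := foldr (fun (e : V) (h : V -> R) => 'D_e h) phi vs in
    continuous psi /\ forall x e, derivable psi x e.

Definition test_function (V : normedModType R) (D : set V) (phi : V -> R) :=
  smooth phi /\
  exists K : set V, [/\ compact K, K `<=` D & forall x, ~ K x -> phi x = 0].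

(* [h] is the weak derivative of order [j] of [f] on (0, L), both in L_2. *)
Definition weak_dx L (j : nat) f h : Prop :=
  [/\ L2I L f, L2I L h &
  forall phi : R -> R, test_function `]0, L[ phi ->
    (\int[mu1]_(x in `]0, L[) (f x * derive1n j phi x) =
     (-1) ^+ j * \int[mu1]_(x in `]0, L[) (h x * phi x))%R].

Definition d_t (phi : R * R -> R) : R * R -> R := 'D_((1, 0) : R * R) phi.

(* [w] is the distribution derivative [d_t^m v] on Q_T, both in L_2. *)
Definition weak_dt T L (m : nat) v w : Prop :=
  [/\ L2Q T L v, L2Q T L w &
  forall phi : R * R -> R, test_function (QT T L) phi ->
    (\int[mu2]_(p in QT T L)
        (v p * iter m d_t phi p) =
     (-1) ^+ m * \int[mu2]_(p in QT T L) (w p * phi p))%R].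

Definition Hspace L (s : nat) f : Prop :=
  forall j, (j <= s)%N -> exists h, weak_dx L j f h.

(* [c] is the value at [x0] (in [0, L]) of the representative continuous on
   [0, L] of the [j]-th weak derivative of [f]. *)
Definition point_value L (j : nat) f (x0 c : R) : Prop :=
  exists h, [/\ {within `[0, L], continuous h}, weak_dx L j f h & h x0 = c].

(* The curve [V] of functions on (0, L) is the class of [v]. *)
Definition curve_of T L v (V : R -> R -> R) : Prop :=
  ae_on T (fun t => ae_on L (fun x => v (t, x) = V t x)).

(* [V] is in C([0, T]; L_2(0, L)). *)
Definition L2_continuous T L (V : R -> R -> R) : Prop :=
  forall t, t \in `[0, T] -> L2I L (V t) /\
    normL2I L (V s \- V t) @[s --> within `[0, T] (nbhs t)] --> 0%E.

(* [v] is in C([0, T]; H^s(0, L)): convergence in H^s is L_2-convergence of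
   all weak derivatives [W j] of order at most [s]. *)
Definition C_H T L (s : nat) v : Prop :=
  exists W : nat -> R -> R -> R,
    [/\ curve_of T L v (W 0%N),
        forall j, (j <= s)%N -> L2_continuous T L (W j) &
        forall j t, (j <= s)%N -> t \in `[0, T] -> weak_dx L j (W 0%N t) (W j t)].

(* [w] is the weak derivative [d_x^j v], with both functions in L_2(Q_T). *)
Definition weak_dx_Q T L (j : nat) v w : Prop :=
  [/\ L2Q T L v, L2Q T L w &
      ae_on T (fun t => weak_dx L j (fun x => v (t, x)) (fun x => w (t, x)))].

(* [v] is in L_2(0, T; H^s(0, L)): joint measurability of the derivatives is
   Bochner measurability of [t |-> v(t, .)] in the separable space H^s, and
   the square of the norm is the sum of those of the derivatives in L_2(Q_T). *)
Definition L2_H T L (s : nat) v : Prop :=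
  forall j, (j <= s)%N -> exists w, weak_dx_Q T L j v w.

(* [h = v|_{t = t0}], through the representative of [v] in C([0, T]; L_2). *)
Definition time_trace T L v (t0 : R) h : Prop :=
  L2I L h /\ exists V, [/\ curve_of T L v V, L2_continuous T L V &
                           ae_on L (fun x => h x = V t0 x)].

(* [h = d_t^m v|_{t = 0}] *)
Definition dt_trace0 T L (m : nat) v h : Prop :=
  exists w, weak_dt T L m v w /\ time_trace T L w 0 h.

(* [h = d_x^j v|_{x = x0}] *)
Definition dx_trace T L (j : nat) v (x0 : R) h : Prop :=
  L2I T h /\ ae_on T (fun t => point_value L j (fun x => v (t, x)) x0 (h t)).

Definition Xspace T L (k : nat) v : Prop :=
  (forall m, (m <= k)%N ->
     exists w, [/\ weak_dt T L m v w, C_H T L 0 w & L2_H T L 1 w]) /\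
  (forall m, (m < k)%N ->
     exists h, dt_trace0 T L m v h /\ Hspace L (3 * (k - m)) h).

Definition Mspace T L (k : nat) v : Prop :=
  (forall m, (m <= k)%N -> exists w, weak_dt T L m v w) /\
  (forall m, (m < k)%N ->
     exists h, dt_trace0 T L m v h /\ Hspace L (3 * (k - m - 1)) h).

(* The Fourier transform of [f] in L_2 is [Fc - i Fs], the L_2 limit of the
   transforms of the truncations of [f] to [-n, n]. *)
Definition fourier f (Fc Fs : R -> R) : Prop :=
  [/\ Fc \in Lfun mu1 2%:E, Fs \in Lfun mu1 2%:E,
     ('N[mu1]_2%:E[EFin \o (fun xi => Fc xi -
        \int[mu1]_(x in `[- n%:R, n%:R]) (f x * cos (xi * x))%R)%R])%E
        @[n --> \oo] --> 0%E &
     ('N[mu1]_2%:E[EFin \o (fun xi => Fs xi -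
        \int[mu1]_(x in `[- n%:R, n%:R]) (f x * sin (xi * x))%R)%R])%E
        @[n --> \oo] --> 0%E].

Definition HR (s : R) f : Prop :=
  f \in Lfun mu1 2%:E /\ exists Fc Fs, [/\ fourier f Fc Fs,
    (fun xi => (1 + xi ^+ 2) `^ (s / 2) * Fc xi) \in Lfun mu1 2%:E &
    (fun xi => (1 + xi ^+ 2) `^ (s / 2) * Fs xi) \in Lfun mu1 2%:E].

Definition Hfrac T (s : R) f : Prop :=
  L2I T f /\ exists F, HR s F /\ ae_on T (fun t => f t = F t).

Definition C_n (n : nat) g : Prop :=
  (forall j x, (j < n)%N -> derivable (derive1n j g) x 1) /\ continuous (derive1n n g).

(* A list [:: n_1; ...; n_l] stands for the monomial
   g^(l)(u) u^(n_1) ... u^(n_l); [fd_terms m] lists, with repetitions, the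
   monomials of d_t^m g(u) obtained by the chain and product rules. *)
Fixpoint fd_terms (m : nat) : seq (seq nat) :=
  if m is m'.+1 then
    flatten [seq (1%N :: ns) :: [seq incr_nth ns i | i <- iota 0 (size ns)]
            | ns <- fd_terms m']
  else [:: [::]].

(* The constant c_{m, l, n_1, ..., n_l}, where [l = size ns]. *)
Definition fd_coef (m : nat) (ns : seq nat) : nat := count_mem ns (fd_terms m).

(* sum_l g^(l)(u0) sum_{n_1 + ... + n_l = m} c_{m, l, n} Phi_{n_1}...Phi_{n_l} *)
Definition fd_sum (m : nat) g (u0 : R -> R) (Phi : nat -> R -> R) (x : R) : R :=
  \sum_(l < m.+1) derive1n l g (u0 x) *
    \sum_(n : l.-tuple 'I_m.+1 | (\sum_(i < l) tnth n i == m)%N &&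
                                 [forall i, 0 < tnth n i]%N)
      (fd_coef m (map val n))%:R * \prod_(i < l) Phi (tnth n i) x.

(* [Phi] is the sequence Phi_m(x; u0, f) for [m < k]; each Phi_m is
   determined up to a.e. equality on (0, L). *)
Definition is_Phi T L (b : R) (k : nat) g (u0 : R -> R) (f : R * R -> R)
    (Phi : nat -> R -> R) : Prop :=
  ae_on L (fun x => Phi 0%N x = u0 x) /\
  forall m, (m.+1 < k)%N -> exists f0 d1 d3 d1sum : R -> R,
    [/\ dt_trace0 T L m f f0,
        weak_dx L 1 (Phi m) d1,
        weak_dx L 3 (Phi m) d3,
        weak_dx L 1 (fd_sum m g u0 Phi) d1sum &
        ae_on L (fun x =>
          Phi m.+1 x = f0 x - (b * d1 x + d3 x) - d1sum x)].

Definition compatibility T L (k : nat) (Phi : nat -> R -> R)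
    (mu0 nu0 nu1 : R -> R) : Prop :=
  forall m, (m < k)%N ->
    [/\ exists2 c, point_value T m mu0 0 c & point_value L 0 (Phi m) 0 c,
        exists2 c, point_value T m nu0 0 c & point_value L 0 (Phi m) L c &
        exists2 c, point_value T m nu1 0 c & point_value L 1 (Phi m) L c].

(* [phi] is an admissible test function, with [phit = phi_t] and
   [phix j = d_x^j phi] for [j <= 3]. *)
Definition admissible T L (phi phit : R * R -> R)
    (phix : nat -> R * R -> R) : Prop :=
  [/\ forall j, (j <= 3)%N -> weak_dx_Q T L j phi (phix j),
      weak_dt T L 1 phi phit,
      time_trace T L phi T (cst 0) &
      [/\ dx_trace T L 0 phi 0 (cst 0),
          dx_trace T L 1 phi 0 (cst 0) &
          dx_trace T L 0 phi L (cst 0)]].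

Definition weak_solution T L (b : R) g (f : R * R -> R)
    (u0 mu0 nu0 nu1 : R -> R) (u : R * R -> R) : Prop :=
  forall (phi phit : R * R -> R) (phix : nat -> R * R -> R)
      (phi0 phixx0 phixxL phixL : R -> R),
    admissible T L phi phit phix ->
    time_trace T L phi 0 phi0 ->
    dx_trace T L 2 phi 0 phixx0 ->
    dx_trace T L 2 phi L phixxL ->
    dx_trace T L 1 phi L phixL ->
    (\int[mu2]_(p in QT T L)
        (u p * (phit p + b * phix 1%N p + phix 3%N p)
         + g (u p) * phix 1%N p + f p * phi p)
     + \int[mu1]_(x in `]0, L[) (u0 x * phi0 x)
     + \int[mu1]_(t in `]0, T[)
        (mu0 t * phixx0 t - nu0 t * phixxL t + nu1 t * phixL t) = 0)%R.

End Defs.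

(* Main.v *)
Require Import Defs.
From HB Require Import structures.
From mathcomp Require Import all_boot all_order all_algebra.
From mathcomp Require Import all_classical all_reals all_analysis.
From mathcomp Require Import measurable_realfun.
From mathcomp Require Import ring lra zify.

Set Implicit Arguments.
Unset Strict Implicit.
Unset Printing Implicit Defensive.
Import Order.TTheory GRing.Theory Num.Theory.
Import numFieldNormedType.Exports.
Local Open Scope classical_set_scope.
Local Open Scope ring_scope.

(** The equation expresses u_xxx through u_t, f and terms with fewer
    x-derivatives, so that one time derivative of u is worth three space
    derivatives.  Membership in X^k gives k time derivatives in
    C([0, T]; L_2), and the exchange is made k times.

    Testing the integral identity with products a(t) p(x) reduces everything to
    one space variable.  Write W_m, F_m for the curves of d_t^m u, d_t^m f.  A time
    derivative of a product test function is again a product, which yields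
    d/dt <W_m, p> = <W_(m+1), p> for all test functions p (time_chainP), and then,
    at every time and for m < k,
      <W_m, p''' + b p'> + <G_m, p'> + <F_m - W_(m+1), p> = 0,
    where G_m = d_t^m g(u) (residual0, third_order_eq).

    For G_m to have a meaning, W_m with m < k is first shown to be continuous
    with values in H^1: its x-derivative is the one at a single good time plus
    the time integral of d_x d_t^(m+1) u (chain_CH1).  The continuous
    representatives U_m are then differentiable in t at each point, with
    derivative U_(m+1) (Ccurve_time_derive), and the chain rule gives G_m as the
    usual finite sum of terms g^(l)(U_0) U_(n_1) ... U_(n_l) (is_derive_Gsum).

    The displayed identity says that the second x-derivative of W_m is
    int_0^x (F_m - W_(m+1)) - b W_m - G_m + beta(t), with beta continuous.
    Hence W_m gains two derivatives over what is known of W_0, ..., W_m, as long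
    as W_(m+1) and F_m permit (elliptic_gain).  Two such steps raise H^(3j) to
    H^(3j+3), and induction on j puts W_m in C([0, T]; H^(3j)) for m <= k - j
    (bootstrap); H^s is stable under products and under composition with C^s
    functions for s >= 1 (CH_alg, CH_comp), and g of class C^(3k-1) suffices
    for all the G_m that occur.

    For the last derivative, in L_2(0, T; H^(3(k-m)+1)), the same identity is
    tested with the derivative of order 3(k-m)-2 of a test function.  This
    expresses the top derivative of W_m through the top derivative of
    W_(m+1), and the induction descends from W_k in L_2(0, T; H^1)
    (top_space_derivative). *)

(** * Square-integrable functions on a measurable set *)

Section L2.
Context d (X : measurableType d) {R : realType} (mu : {measure set X -> \bar R}).
Variables (D : set X) (mD : measurable D).
Implicit Types f g h : X -> R.

Definition itg f := mu.-integrable D (EFin \o f).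
(** Square integrability through the integrability of the square, so that
    comparison and a.e. arguments for integrals apply directly; LfunP2 is the
    link with the space Lfun. *)
Definition sqi f := measurable_fun D f /\ itg (fun x => f x ^+ 2).
Definition nsq f : R := \int[mu]_(x in D) (f x ^+ 2).

Lemma itg_meas f : itg f -> measurable_fun D f.
Proof. by case/integrableP => /measurable_EFinP. Qed.

Lemma itgD f g : itg f -> itg g -> itg (fun x => f x + g x).
Proof. move=> hf hg; exact: (integrableD mD hf hg). Qed.

Lemma itgZ a f : itg f -> itg (fun x => a * f x).
Proof. move=> hf; exact: (integrableZl mD a hf). Qed.

Lemma itgN f : itg f -> itg (fun x => - f x).
Proof. by move=> /(itgZ (-1)); congr itg; apply/funext => x; rewrite mulN1r. Qed.

Lemma itgB f g : itg f -> itg g -> itg (fun x => f x - g x).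
Proof. by move=> hf /itgN; exact: itgD. Qed.

Lemma itg_le f g : measurable_fun D f -> itg g ->
  (forall x, D x -> `|f x| <= g x) -> itg f.
Proof.
move=> mf ig fg; apply: (le_integrable mD _ _ ig) => [|x Dx].
  exact/measurable_EFinP.
by rewrite /= lee_fin (le_trans (fg _ Dx))// ler_norm.
Qed.

Lemma itg_norm f : itg f -> itg (fun x => `|f x|).
Proof.
move=> hf; have := itg_meas hf => mf.
have /integrable_abse := hf; by congr (_.-integrable _ _).
Qed.

Lemma itg_ae f g : measurable_fun D g -> f = g %[ae mu in D] -> itg f -> itg g.
Proof.
move=> mg fg hf; have mf := itg_meas hf.
move: hf => /integrableP[_ hf]; apply/integrableP; split; first exact/measurable_EFinP.
suff <- : (\int[mu]_(x in D) `|(EFin \o f) x| = \int[mu]_(x in D) `|(EFin \o g) x|)%E by [].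
apply: ae_eq_integral => //.
- by apply: measurableT_comp => //; exact/measurable_EFinP.
- by apply: measurableT_comp => //; exact/measurable_EFinP.
- exact: (ae_eq_comp (fun y : R => `|y%:E|%E) fg).
Qed.

Lemma ae_Rint f g : measurable_fun D f -> measurable_fun D g ->
  f = g %[ae mu in D] -> \int[mu]_(x in D) f x = \int[mu]_(x in D) g x.
Proof.
move=> mf mg fg; congr fine; apply: ae_eq_integral => //; try exact/measurable_EFinP.
exact: (ae_eq_comp EFin fg).
Qed.

Lemma itg_ext f g : (forall x, D x -> f x = g x) -> itg f -> itg g.
Proof.
move=> fg; apply: eq_integrable => //= x /set_mem Dx.
by rewrite fg.
Qed.

Lemma Rint_ext f g : (forall x, D x -> f x = g x) ->
  \int[mu]_(x in D) f x = \int[mu]_(x in D) g x.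
Proof. by move=> fg; apply: eq_Rintegral => x /set_mem /fg. Qed.

Lemma meas_ext f g : (forall x, D x -> f x = g x) ->
  measurable_fun D f -> measurable_fun D g.
Proof. by move=> fg; apply: eq_measurable_fun => x /set_mem /fg. Qed.

Lemma sqi_mul f g : sqi f -> sqi g -> itg (fun x => f x * g x).
Proof.
move=> [mf qf] [mg qg]; apply: (itg_le _ (itgD qf qg)).
  exact: measurable_funM.
move=> x _; have := sqr_ge0 (`|f x| - `|g x|).
rewrite normrM -(real_normK (num_real (f x))) -(real_normK (num_real (g x))).
have := normr_ge0 (f x); have := normr_ge0 (g x).
by nra.
Qed.

Lemma sqiD f g : sqi f -> sqi g -> sqi (fun x => f x + g x).
Proof.
move=> hf hg; have := sqi_mul hf hg; move: hf hg => [mf qf] [mg qg] hfg.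
split; first exact: measurable_funD.
apply: (itg_ext _ (itgD (itgD qf qg) (itgZ 2 hfg))) => x _.
ring.
Qed.

Lemma sqiZ a f : sqi f -> sqi (fun x => a * f x).
Proof.
move=> [mf qf]; split; first exact: measurable_funM.
by apply: (itg_ext _ (itgZ (a ^+ 2) qf)) => x _; ring.
Qed.

Lemma sqi_ext f g : (forall x, D x -> f x = g x) -> sqi f -> sqi g.
Proof.
move=> fg [mf qf]; split; first exact: meas_ext mf.
by apply: itg_ext qf => x Dx; rewrite fg.
Qed.

Lemma sqiN f : sqi f -> sqi (fun x => - f x).
Proof. by move=> /(sqiZ (-1)); apply: sqi_ext => x _; ring. Qed.

Lemma sqiB f g : sqi f -> sqi g -> sqi (fun x => f x - g x).
Proof. by move=> hf /sqiN; exact: sqiD. Qed.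

Lemma sqi_le f g : measurable_fun D f -> sqi g ->
  (forall x, D x -> `|f x| <= `|g x|) -> sqi f.
Proof.
move=> mf [mg qg] fg; split => //; apply: (itg_le _ qg); first exact: measurable_funX.
move=> x Dx; rewrite ger0_norm ?sqr_ge0//.
rewrite -(real_normK (num_real (f x))) -(real_normK (num_real (g x))).
by rewrite lerXn2r ?nnegrE// fg.
Qed.

Lemma sqi_ae f g : measurable_fun D g -> f = g %[ae mu in D] -> sqi f -> sqi g.
Proof.
move=> mg fg [mf qf]; split => //; apply: itg_ae qf; first exact: measurable_funX.
exact: (ae_eq_comp (fun y : R => y ^+ 2) fg).
Qed.

Lemma itg_le_ae f g : measurable_fun D f -> itg g ->
  {ae mu, forall x, D x -> `|f x| <= g x} -> itg f.
Proof.
move=> mf /[dup] ig /integrableP[mg ig'] fg; apply/integrableP; split.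
  exact/measurable_EFinP.
apply: le_lt_trans ig'; apply: ae_ge0_le_integral => //=.
- by apply/measurable_EFinP; apply: measurableT_comp.
- by apply/measurable_EFinP; apply: measurableT_comp => //; exact: itg_meas.
- by apply: filterS fg => x h Dx; rewrite lee_fin (le_trans (h Dx))// ler_norm.
Qed.

Lemma sqi_bnd M f h : measurable_fun D h ->
  {ae mu, forall x, D x -> `|h x| <= M} -> sqi f -> sqi (fun x => h x * f x).
Proof.
move=> mh hM [mf qf]; have mhf := measurable_funM mh mf; split => //.
apply: (itg_le_ae _ (itgZ (M ^+ 2) qf)); first exact: measurable_funX.
apply: filterS hM => x /[apply] hx; rewrite ger0_norm ?sqr_ge0// exprMn.
rewrite ler_wpM2r ?sqr_ge0// -(real_normK (num_real (h x))).
by rewrite lerXn2r ?nnegrE// (le_trans _ hx).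
Qed.

(** As f is nonnegative, g can be replaced by its absolute value, which reduces
    the statement to the comparison of nonnegative integrals. *)
Lemma Rint_le_ae f g : itg f -> itg g -> (forall x, 0 <= f x) ->
  {ae mu, forall x, D x -> f x <= g x} ->
  \int[mu]_(x in D) f x <= \int[mu]_(x in D) g x.
Proof.
move=> jf jg f0 fg; have jn := itg_norm jg.
have -> : \int[mu]_(x in D) g x = \int[mu]_(x in D) `|g x|.
  apply: ae_Rint; [exact: itg_meas jg|exact: itg_meas jn|].
  by apply: filterS fg => x /[apply] h; rewrite /= ger0_norm// (le_trans _ h).
have E h : itg h -> (\int[mu]_(x in D) (h x))%:E = (\int[mu]_(x in D) (h x)%:E)%E.
  by move=> ih; rewrite fineK//; exact: integrable_fin_num.
rewrite -lee_fin !E//; apply: ae_ge0_le_integral => //=.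
- by move=> x _; rewrite lee_fin.
- by apply/measurable_EFinP; exact: itg_meas jf.
- by apply/measurable_EFinP; exact: itg_meas jn.
- by apply: filterS fg => x /[apply] h; rewrite lee_fin (le_trans h)// ler_norm.
Qed.

Lemma nsq_bnd M f h : measurable_fun D h ->
  {ae mu, forall x, D x -> `|h x| <= M} -> sqi f ->
  nsq (fun x => h x * f x) <= M ^+ 2 * nsq f.
Proof.
move=> mh hM sf; have [_ qhf] := sqi_bnd mh hM sf; move: sf => [mf qf].
rewrite /nsq -RintegralZl//; apply: Rint_le_ae => //; first exact: itgZ.
  by move=> x; exact: sqr_ge0.
apply: filterS hM => x /[apply] hx; rewrite exprMn.
rewrite ler_wpM2r ?sqr_ge0// -(real_normK (num_real (h x))).
by rewrite lerXn2r ?nnegrE// (le_trans _ hx).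
Qed.

Lemma restrictT_itg f : itg f <-> mu.-integrable setT (EFin \o (f \_ D)).
Proof. by rewrite /itg (integrable_mkcond _ mD) restrict_EFin. Qed.

Lemma nsq_ge0 f : 0 <= nsq f.
Proof. by apply: Rintegral_ge0 => x _; rewrite sqr_ge0. Qed.

Lemma nsq_ae f g : measurable_fun D f -> measurable_fun D g ->
  f = g %[ae mu in D] -> nsq f = nsq g.
Proof.
move=> mf mg fg; apply: ae_Rint; try exact: measurable_funX.
exact: (ae_eq_comp (fun y : R => y ^+ 2) fg).
Qed.

Lemma nsq_ext f g : (forall x, D x -> f x = g x) -> nsq f = nsq g.
Proof. by move=> fg; apply: Rint_ext => x /fg ->. Qed.

Lemma nsqZ a f : sqi f -> nsq (fun x => a * f x) = a ^+ 2 * nsq f.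
Proof.
move=> [mf qf]; rewrite /nsq -RintegralZl//.
by apply: Rint_ext => x _; rewrite exprMn.
Qed.

Lemma nsqN f : nsq (fun x => - f x) = nsq f.
Proof. by apply: Rint_ext => x _; rewrite sqrrN. Qed.

Lemma nsqD f g : sqi f -> sqi g ->
  nsq (fun x => f x + g x) <= 2 * nsq f + 2 * nsq g.
Proof.
move=> hf hg; have [_ qfg] := sqiD hf hg; case: hf => mf qf; case: hg => mg qg.
rewrite /nsq -!RintegralZl// -RintegralD//; try exact: itgZ.
apply: le_Rintegral => //; first by apply: itgD; exact: itgZ.
by move=> x _; have := sqr_ge0 (f x - g x); nra.
Qed.

Lemma nsq_le f g : sqi f -> sqi g -> (forall x, D x -> `|f x| <= `|g x|) ->
  nsq f <= nsq g.
Proof.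
move=> [mf qf] [mg qg] fg; apply: le_Rintegral => // x Dx.
rewrite -(real_normK (num_real (f x))) -(real_normK (num_real (g x))).
by rewrite lerXn2r ?nnegrE// fg.
Qed.

(** The quadratic polynomial l |-> nsq (f + l g) is nonnegative. *)
Lemma cauchy_schwarz f g : sqi f -> sqi g ->
  (\int[mu]_(x in D) (f x * g x)) ^+ 2 <= nsq f * nsq g.
Proof.
move=> hf hg; have hfg := sqi_mul hf hg.
have [mf qf] := hf; have [mg qg] := hg.
set B := Rintegral _ _ _.
have key l : 0 <= nsq f + 2 * l * B + l ^+ 2 * nsq g.
  rewrite /nsq /B -!RintegralZl// -!RintegralD//; try exact: itgZ; last first.
    by apply: itgD => //; exact: itgZ.
  apply: Rintegral_ge0 => x _.
  by have := sqr_ge0 (f x + l * g x); nra.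
have := nsq_ge0 g; rewrite le_eqVlt => /predU1P[C0|C0]; last first.
  have := key (- B / nsq g); have -> : nsq f + 2 * (- B / nsq g) * B + (- B / nsq g) ^+ 2 * nsq g = nsq f - B ^+ 2 / nsq g.
    by field; rewrite gt_eqF.
  by rewrite subr_ge0 ler_pdivrMr.
rewrite -C0 mulr0; have [->|B0] := eqVneq B 0; first by rewrite expr0n.
(* If nsq g = 0 the polynomial is affine; at this l it would be -1. *)
have := key (- (nsq f + 1) / (2 * B)); rewrite -C0.
have -> : nsq f + 2 * (- (nsq f + 1) / (2 * B)) * B + (- (nsq f + 1) / (2 * B)) ^+ 2 * 0 = -1.
  by field.
by rewrite oppr_ge0 ler10.
Qed.

Lemma dom_cvg (f_ : nat -> X -> R) f g :
  (forall n, measurable_fun D (f_ n)) -> measurable_fun D f ->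
  {ae mu, forall x, D x -> f_ n x @[n --> \oo] --> f x} ->
  itg g -> {ae mu, forall x n, D x -> `|f_ n x| <= g x} ->
  \int[mu]_(x in D) f_ n x @[n --> \oo] --> \int[mu]_(x in D) f x.
Proof.
move=> mf_ mf ff ig fg.
have [] := @dominated_convergence _ _ _ mu D mD (fun n x => (f_ n x)%:E)
  (fun x => (f x)%:E) (fun x => (g x)%:E).
- by move=> n; exact/measurable_EFinP.
- exact/measurable_EFinP.
- apply: filterS ff => x /[apply] h; apply: cvg_EFin => //; exact: nearW.
- exact: ig.
- by apply: filterS fg => x h n Dx; rewrite /= lee_fin h.
move=> intf _ h; apply: fine_cvg.
by rewrite fineK//; exact: integrable_fin_num.
Qed.

Lemma LfunP2 f : (f \_ D) \in Lfun mu 2%:E <-> sqi f.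
Proof.
split.
- move=> h; have := Lfun2_integrable_sqr h.
  move: h => /[!inE]/andP[/[!inE]/= mf _] /= h.
  have mf' : measurable_fun D f by apply/(measurable_restrictT _ mD).
  split => //; apply/(integrable_mkcond _ mD).
  move: h; congr (_.-integrable _ _); apply/funext => x; rewrite /= !patchE.
  by case: ifPn => //; rewrite expr0n.
- move=> [mf qf]; rewrite inE; apply/andP; split; rewrite inE/=.
    by apply/(measurable_restrictT _ mD).
  rewrite /finite_norm unlock; apply: poweR_lty.
  move: qf => /(integrable_mkcond _ mD)/integrableP[_].
  congr (_ < _)%E; apply: eq_integral => x _; rewrite /= !patchE.
  case: ifPn => _ /=; last by rewrite normr0 powR0.
  by rewrite ger0_norm ?sqr_ge0// powR_mulrn// real_normK// num_real.
Qed.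

Lemma norm2E f : sqi f -> 'N[mu]_2%:E[EFin \o (f \_ D)]%E = (Num.sqrt (nsq f))%:E.
Proof.
move=> [mf qf]; rewrite unlock.
have -> : (\int[mu]_x (`|(EFin \o f \_ D) x| `^ 2) = (nsq f)%:E)%E.
  rewrite fineK; last exact: integrable_fin_num.
  rewrite [RHS]integral_mkcond; apply: eq_integral => x _; rewrite /= !patchE.
  case: ifPn => _ /=; last by rewrite normr0 powR0.
  by rewrite powR_mulrn// real_normK// num_real.
by rewrite poweR_EFin powR12_sqrt// nsq_ge0.
Qed.

Lemma norm2_cvg0 {I} {F : set_system I} {FF : Filter F} (f_ : I -> X -> R) :
  (\forall i \near F, sqi (f_ i)) ->
  ('N[mu]_2%:E[EFin \o (f_ i \_ D)] @[i --> F] --> 0)%E <->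
  nsq (f_ i) @[i --> F] --> 0.
Proof.
move=> hs; split => h.
- have h1 : Num.sqrt (nsq (f_ i)) @[i --> F] --> 0.
    apply: (@cvg_trans _ (fine ('N[mu]_2%:E[EFin \o (f_ i \_ D)])%E @[i --> F])).
      by apply: near_eq_cvg; near=> i; rewrite norm2E//; near: i.
    exact: (fine_cvg h).
  have -> : (0 : R) = 0 ^+ 2 by rewrite expr0n.
  have := @cvgM _ _ _ FF _ _ _ _ h1 h1; rewrite -expr2; apply: cvg_trans.
  by apply: near_eq_cvg; apply: nearW => i /=; rewrite -expr2 sqr_sqrtr ?nsq_ge0.
- have h1 : Num.sqrt (nsq (f_ i)) @[i --> F] --> 0.
    rewrite -[X in _ --> X]sqrtr0; apply: (cvg_comp _ _ h).
    exact: sqrt_continuous.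
  apply: (@cvg_trans _ ((Num.sqrt (nsq (f_ i)))%:E @[i --> F])).
    by apply: near_eq_cvg; near=> i; rewrite norm2E//; near: i.
  by apply: cvg_EFin => //; exact: nearW.
Unshelve. all: by end_near. Qed.

End L2.

(** * Smooth functions and flat bumps *)

Section derive_real.
Context {R : realType}.
Implicit Types (f g : R -> R) (x a b c : R).

Lemma isdM f g x a b : is_derive x (1 : R) f a -> is_derive x (1 : R) g b ->
  is_derive x (1 : R) (fun y => f y * g y) (f x * b + g x * a).
Proof. move=> hf hg; exact: (@is_deriveM _ _ f g x 1 a b hf hg). Qed.

Lemma isdD f g x a b : is_derive x (1 : R) f a -> is_derive x (1 : R) g b ->
  is_derive x (1 : R) (fun y => f y + g y) (a + b).
Proof. move=> hf hg; exact: (@is_deriveD _ _ _ f g x 1 a b hf hg). Qed.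

Lemma isdN f x a : is_derive x (1 : R) f a ->
  is_derive x (1 : R) (fun y => - f y) (- a).
Proof. move=> hf; exact: (@is_deriveN _ _ _ f x 1 a hf). Qed.

Lemma isd_cst c x : is_derive x (1 : R) (fun=> c) 0.
Proof. exact: (@is_derive_cst _ _ _ c x 1). Qed.

Lemma isd_id x : is_derive x (1 : R) (fun y => y) 1.
Proof. exact: (@is_derive_id _ _ x 1). Qed.

Lemma isdZ c f x a : is_derive x (1 : R) f a ->
  is_derive x (1 : R) (fun y => c * f y) (c * a).
Proof. by move=> /(isdM (isd_cst c x)); rewrite mulr0 addr0. Qed.

Lemma isd_comp f g x a b : is_derive (g x) (1 : R) f a ->
  is_derive x (1 : R) g b -> is_derive x (1 : R) (fun y => f (g y)) (a * b).
Proof. exact: is_derive1_comp. Qed.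

Lemma isd_eq f x a b : is_derive x (1 : R) f a -> a = b ->
  is_derive x (1 : R) f b.
Proof. by move=> h <-. Qed.

End derive_real.

Section smoothness.
Context {R : realType}.
Implicit Types (f g h : R -> R).

(** Smoothness without computing any derivative: it is enough to exhibit a class
    of functions that is stable under directional derivatives. *)
Lemma smooth_class {V : normedModType R} (S : set (V -> R)) :
  (forall phi, S phi -> [/\ continuous phi, forall x e, derivable phi x e &
                            forall e, S ('D_e phi)]) ->
  forall phi, S phi -> smooth phi.
Proof.
move=> HS phi Sphi vs /=.
have : S (foldr (fun (e : V) (h : V -> R) => 'D_e h) phi vs).
  by elim: vs => [//|e vs IH] /=; have [_ _] := HS _ IH; apply.
by move=> /HS[].
Qed.

Definition smooth1 f := forall n (x : R), derivable (derive1n n f) x 1.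

Lemma smooth1_class (S : set (R -> R)) :
  (forall f, S f -> (forall x, derivable f x 1) /\ S (derive1 f)) ->
  forall f, S f -> smooth1 f.
Proof.
move=> HS f Sf n; have : S (derive1n n f).
  by elim: n => [//|n IH]; rewrite derive1nS; exact: (HS _ IH).2.
by move=> /HS[].
Qed.

Lemma smooth1_deriv f : smooth1 f -> smooth1 (derive1 f).
Proof. by move=> h n x; rewrite -derive1Sn; exact: h. Qed.

Lemma smooth1_derivn f n : smooth1 f -> smooth1 (derive1n n f).
Proof. by move=> h m x; have := h (m + n)%N x; rewrite /derive1n iterD. Qed.

Lemma derivable_cont f x : derivable f x 1 -> {for x, continuous f}.
Proof. by move=> /derivable1_diffP/differentiable_continuous. Qed.

Lemma smooth1_is_derive f x : smooth1 f -> is_derive x (1 : R) f (derive1 f x).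
Proof. by move=> /(_ 0%N x) fx; apply: DeriveDef => //; rewrite derive1E. Qed.

Lemma is_derive_derive1 f x l : is_derive x (1 : R) f l -> (derive1 f) x = l.
Proof. by move=> [_ <-]; rewrite derive1E. Qed.

Lemma smooth1_cont f : smooth1 f -> continuous f.
Proof. by move=> h x; apply: derivable_cont; exact: (h 0%N). Qed.

Lemma derivable_dir f e x : derivable f x 1 ->
  derivable f x e /\ 'D_e f x = e * (derive1 f) x.
Proof.
move=> /derivable1_diffP df; split; first exact: diff_derivable.
by rewrite deriveE// derive1E deriveE// -[in LHS](mulr1 e) -[e * 1]/(e *: 1) linearZ.
Qed.

(** On the line, each directional derivative is a multiple of the ordinary one. *)
Lemma smoothP f : smooth f <-> smooth1 f.
Proof.
split => [h n x|h].
  have [_] := h (nseq n 1); set psi := foldr _ _ _.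
  suff -> : psi = (derive1n n f) by apply.
  rewrite /psi; elim: n {psi} => [//|n IH]; rewrite derive1nS /= IH.
  by apply/funext => y; rewrite derive1E.
pose S : set (R -> R) := [set g | exists c n, g = (fun x => c * (derive1n n f) x)].
apply: (@smooth_class _ S); last first.
  by exists 1, 0%N; apply/funext => x; rewrite mul1r.
move=> _ [c [n ->]].
have dg (x : R) : is_derive x (1 : R) (fun x => c * (derive1n n f) x) (c * (derive1n n.+1 f) x).
  have := smooth1_is_derive x (smooth1_derivn (n := n) h); rewrite -derive1nS => d.
  exact: isdZ.
split.
- by move=> x; apply: derivable_cont; exact: ex_derive.
- by move=> x e; apply: (derivable_dir e _).1; exact: ex_derive.
- move=> e; exists (e * c), n.+1; apply/funext => x.
  have [dg1 _] := dg x; rewrite (derivable_dir e dg1).2 (is_derive_derive1 (dg x)).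
  by rewrite mulrA.
Qed.

(** Products of smooth functions are not stable under derivation, but sums of
    products are. *)
Inductive mul_class : (R -> R) -> Prop :=
| prod_mul f g of smooth1 f & smooth1 g : mul_class (fun x => f x * g x)
| prod_add f g of mul_class f & mul_class g : mul_class (fun x => f x + g x).

Lemma mul_classP h : mul_class h ->
  (forall x, derivable h x 1) /\ mul_class (derive1 h).
Proof.
elim => {h} [f g sf sg|f g _ [df pf] _ [dg pg]].
- have d (x : R) : is_derive x (1 : R) (fun x => f x * g x) (f x * (derive1 g) x + g x * (derive1 f) x).
    have := smooth1_is_derive x sf; have := smooth1_is_derive x sg => dg df.
    exact: isdM.
  split=> [x|]; first exact: ex_derive.
  rewrite (_ : (derive1 _) = (fun x => f x * (derive1 g) x + g x * (derive1 f) x)); last first.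
    by apply/funext => x; exact: is_derive_derive1.
  exact: prod_add (prod_mul sf (smooth1_deriv sg)) (prod_mul sg (smooth1_deriv sf)).
- have d (x : R) : is_derive x (1 : R) (fun x => f x + g x) ((derive1 f) x + (derive1 g) x).
    by apply: isdD; apply: DeriveDef => //; rewrite derive1E.
  split=> [x|]; first exact: ex_derive.
  rewrite (_ : (derive1 _) = (fun x => (derive1 f) x + (derive1 g) x)); last first.
    by apply/funext => x; exact: is_derive_derive1.
  exact: prod_add.
Qed.

Lemma smooth1M f g : smooth1 f -> smooth1 g -> smooth1 (fun x => f x * g x).
Proof. by move=> sf sg; apply: (smooth1_class mul_classP); exact: prod_mul. Qed.

Lemma smooth1_cst c : smooth1 (fun=> c).
Proof.
pose S : set (R -> R) := [set f | exists c, f = (fun=> c)].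
apply: (@smooth1_class S) => [_ [e ->]|]; last by exists c.
split; first by move=> x; exact: derivable_cst.
by exists 0; apply/funext => x; rewrite derive1_cst.
Qed.

Lemma smooth1D f g : smooth1 f -> smooth1 g -> smooth1 (fun x => f x + g x).
Proof.
move=> sf sg; pose S : set (R -> R) := [set h | exists f g,
  [/\ smooth1 f, smooth1 g & h = (fun x => f x + g x)]].
apply: (@smooth1_class S); last by exists f, g.
move=> _ [u [v [su sv ->]]].
have d (x : R) : is_derive x (1 : R) (fun x => u x + v x) (derive1 u x + derive1 v x).
  by apply: isdD; exact: smooth1_is_derive.
split=> [x|]; first exact: ex_derive.
exists (derive1 u), (derive1 v); split; [exact: smooth1_deriv|exact: smooth1_deriv|].
by apply/funext => x; exact: is_derive_derive1.
Qed.

Lemma smooth1_affine al be f : smooth1 f -> smooth1 (fun x => f (al * x + be)).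
Proof.
move=> sf; pose S : set (R -> R) := [set g | exists c n,
  g = (fun x => c * (derive1n n f) (al * x + be))].
apply: (@smooth1_class S); last first.
  by exists 1, 0%N; apply/funext => x; rewrite mul1r.
move=> _ [c [n ->]].
have d (x : R) : is_derive x (1 : R) (fun x => c * (derive1n n f) (al * x + be))
    (c * al * (derive1n n.+1 f) (al * x + be)).
  have h1 : is_derive x (1 : R) (fun x => al * x + be) al.
    by apply: (isd_eq (isdD (isdZ al (isd_id x)) (isd_cst be x))); rewrite addr0 mulr1.
  have := smooth1_is_derive (al * x + be) (smooth1_derivn (n := n) sf).
  rewrite -derive1nS => h2.
  apply: (isd_eq (@isdZ R c _ x _ (@isd_comp R _ _ x _ _ h2 h1))); ring.
split=> [x|]; first exact: ex_derive.
by exists (c * al), n.+1; apply/funext => x; exact: is_derive_derive1.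
Qed.

End smoothness.

Section expflat.
Context {R : realType}.
Variable c : R.
Hypothesis c0 : 0 < c.

(** Induction on the polynomial: one half of the exponential absorbs the factor
    y, the other half is left for the induction hypothesis. *)
Lemma poly_expR_bounded (p : {poly R}) e : 0 < e ->
  exists M, forall y, 0 <= y -> `|p.[y]| * expR (- (e * y)) <= M.
Proof.
elim/poly_ind: p e => [e _|p a IH e e0].
  by exists 0 => y _; rewrite horner0 normr0 mul0r.
have e20 : 0 < e / 2 by rewrite divr_gt0.
have [M HM] := IH _ e20.
exists (M * (2 / e) + `|a|) => y y0; rewrite hornerD hornerM hornerX hornerC.
have E0 : 0 <= expR (- (e * y)) by exact: expR_ge0.
have E1 : expR (- (e * y)) <= 1 by rewrite expR_le1 oppr_le0 mulr_ge0// ltW.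
apply: (@le_trans _ _ ((`|p.[y]| * y + `|a|) * expR (- (e * y)))).
  by rewrite ler_wpM2r// (le_trans (ler_normD _ _))// normrM (ger0_norm y0).
rewrite mulrDl lerD//; last by rewrite ler_piMr.
have -> : expR (- (e * y)) = expR (- (e / 2 * y)) * expR (- (e / 2 * y)).
  by rewrite -expRD; congr expR; field.
have E2 : 0 <= expR (- (e / 2 * y)) by exact: expR_ge0.
rewrite mulrACA; apply: ler_pM; [exact: mulr_ge0|exact: mulr_ge0| |].
- exact: HM.
- rewrite expRN ler_pdivrMr ?expR_gt0//.
  have := expR_ge1Dx (e / 2 * y) => h.
  have {}h : e / 2 * y <= expR (e / 2 * y) by apply: le_trans h; rewrite lerDr.
  by rewrite -[2 / e]invf_div ler_pdivlMl.
Qed.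

(** The derivative of p(1/x) exp(-c/x) has the same form for another polynomial,
    so these functions are smooth at 0 as well. *)
Definition flatp (p : {poly R}) (x : R) : R :=
  if 0 < x then p.[x^-1] * expR (- (c * x^-1)) else 0.

Lemma flatp_bound p : exists M, forall x, `|flatp p x| <= M * x ^+ 2.
Proof.
have [M HM] := poly_expR_bounded (p * 'X ^+ 2) c0.
exists M => x; rewrite /flatp; case: ifPn => [x0|_]; last first.
  rewrite normr0 mulr_ge0 ?sqr_ge0//.
  have := HM 0 (lexx _); apply: le_trans; by rewrite mulr_ge0// expR_ge0.
have := HM x^-1; rewrite invr_ge0 (ltW x0) => /(_ isT).
rewrite hornerM hornerXn [X in _ -> X <= _]normrM (@ger0_norm _ (expR _)) ?expR_ge0// => h.
rewrite -ler_pdivrMr ?exprn_gt0//; apply: le_trans h.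
rewrite normrM [`|x^-1 ^+ 2|]ger0_norm ?sqr_ge0// exprVn.
by rewrite mulrAC.
Qed.

Lemma is_derive_quad (h : R -> R) M : (forall x, `|h x| <= M * x ^+ 2) ->
  is_derive (0 : R) (1 : R) h 0.
Proof.
move=> hM.
have h0 : h 0 = 0.
  by apply/eqP; rewrite -normr_le0 (le_trans (hM 0))// expr0n mulr0.
have M0 : 0 <= M by have := le_trans (normr_ge0 _) (hM 1); rewrite expr1n mulr1.
have key : (fun t : R => t^-1 *: ((h \o shift (0 : R)) (t *: (1 : R)) - h 0)) @ 0^' --> (0 : R).
  apply/cvgr0Pnorm_le => e e0; near=> t.
  rewrite /= h0 subr0 addr0 -[t *: 1]/(t * 1) mulr1 -[_ *: _]/(_ * _) normrM.
  have t0 : t != 0 by near: t; exact: nbhs_dnbhs_neq.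
  rewrite normfV ler_pdivrMl ?normr_gt0//.
  have tM : `|t| <= e / (M + 1).
    by near: t; apply: dnbhs0_le; rewrite divr_gt0// ltr_wpDl.
  apply: (le_trans (hM t)); rewrite -real_normK ?num_real//.
  have : `|t| * (M + 1) <= e by rewrite -ler_pdivlMr// ltr_wpDl.
  by have := normr_ge0 t; nra.
by apply: DeriveDef; [apply/cvg_ex; exists 0 | apply/cvg_lim].
Unshelve. all: by end_near. Qed.

Lemma flatp_derive p (x : R) : is_derive x (1 : R) (flatp p)
  (flatp ('X ^+ 2 * (c *: p - p^`())) x).
Proof.
have [x0|x0|->] := ltgtP x 0.
- rewrite [flatp _ x]/flatp ltNge (ltW x0)/=.
  suff h : \near x, 0 = flatp p x by exact: (near_eq_is_derive h (isd_cst 0 x)).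
  near=> y; rewrite /flatp ltNge ifF//; apply/negbF; apply: ltW.
  by near: y; exact: lt_nbhsl.
- rewrite [flatp _ x]/flatp x0.
  have e : \near x, p.[x^-1] * expR (- (c * x^-1)) = flatp p x.
    by near=> y; rewrite /flatp ifT//; near: y; exact: lt_nbhsr.
  apply: (near_eq_is_derive e).
  have dv : is_derive x (1 : R) (fun y : R => y^-1) (- x ^- 2).
    have := @is_deriveV R (fun y => y) x 1 1; rewrite gt_eqF// => /(_ isT (isd_id _)) h.
    by apply: (isd_eq h); rewrite -[_ *: _]/(_ * _) mulr1.
  have d1 := isd_comp (is_derive_poly p x^-1) dv.
  have d2 : is_derive x (1 : R) (fun y => - (c * y^-1)) (c * x ^- 2).
    by apply: (isd_eq (isdN (isdZ c dv))); ring.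
  have d3 := isd_comp (is_derive_expR _) d2.
  apply: (isd_eq (isdM d1 d3)).
  by rewrite hornerM hornerXn hornerD hornerN hornerZ -exprVn; ring.
- rewrite [flatp _ 0]/flatp ltxx.
  by have [M] := flatp_bound p; exact: is_derive_quad.
Unshelve. all: by end_near. Qed.

Lemma flatp_smooth p : smooth1 (flatp p).
Proof.
pose S : set (R -> R) := [set f | exists p, f = flatp p].
apply: (@smooth1_class _ S); last by exists p.
move=> _ [q ->]; split => [x|].
  by have [] := flatp_derive q x.
exists ('X ^+ 2 * (c *: q - q^`())); apply/funext => x.
exact/is_derive_derive1/flatp_derive.
Qed.

(** A smooth bump supported by [p, q]; it tends to the indicator of ]p, q[ as c
    tends to 0. *)
Definition flatbump (p q x : R) : R := flatp 1 (x - p) * flatp 1 (q - x).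

Lemma flatbump_smooth p q : smooth1 (flatbump p q).
Proof.
apply: smooth1M.
- rewrite (_ : (fun x => _) = (fun x => flatp 1 (1 * x + (- p)))).
    by apply: smooth1_affine; exact: flatp_smooth.
  by apply/funext => x; rewrite mul1r.
- rewrite (_ : (fun x => _) = (fun x => flatp 1 (-1 * x + q))).
    by apply: smooth1_affine; exact: flatp_smooth.
  by apply/funext => x; rewrite mulN1r addrC.
Qed.

Lemma flatbumpE p q x : flatbump p q x =
  if p < x < q then expR (- (c * (x - p)^-1) - c * (q - x)^-1) else 0.
Proof.
rewrite /flatbump /flatp !subr_gt0; case: ifPn => /= px; last by rewrite mul0r.
by case: ifPn => qx; rewrite ?mulr0// !hornerC !mul1r -expRD.
Qed.

Lemma flatbump_ge0 p q x : 0 <= flatbump p q x.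
Proof. by rewrite flatbumpE; case: ifPn => // _; exact: expR_ge0. Qed.

Lemma flatbump_le1 p q x : flatbump p q x <= 1.
Proof.
rewrite flatbumpE; case: ifPn => [/andP[px xq]|//].
by rewrite expR_le1 -opprD oppr_le0 addr_ge0// mulr_ge0// ?invr_ge0 ?subr_ge0 ltW.
Qed.

End expflat.

(** * Test functions on an interval *)

Section interval_tests.
Context {R : realType}.
Local Notation mu := (@lebesgue_measure R).
Implicit Types (f g h phi : R -> R) (a b x y : R).

(** Compact support inside ]a, b[ means vanishing outside some [c, d]. *)
Definition tst a b phi := smooth1 phi /\
  exists c d, [/\ a < c, d < b & forall x, x < c \/ d < x -> phi x = 0].

Lemma tstP a b phi : test_function `]a, b[ phi <-> tst a b phi.
Proof.
split=> [[/smoothP sphi [K [cK Kab K0]]]|[sphi [c [d [ac db phi0]]]]].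
- split=> //; have [KE|/set0P Kn0] := eqVneq K set0.
    rewrite {}KE in K0; by exists (a + 1), (b - 1); split=> [||x _]; rewrite ?ltrDl// ?ltrBlDr ?ltrDl// K0.
  have cid : {within K, continuous (@id R)} by apply: continuous_subspaceT => x; exact: cvg_id.
  have [d /set_mem Kd dmax] := compact_EVT_max Kn0 cK cid.
  have [c /set_mem Kc cmin] := compact_EVT_min Kn0 cK cid.
  exists c, d; split.
  + by have /= := Kab _ Kc; rewrite in_itv/= => /andP[].
  + by have /= := Kab _ Kd; rewrite in_itv/= => /andP[].
  + move=> x xcd; apply: K0 => Kx; move: xcd => [] /lt_geF.
      by rewrite cmin// inE.
    by rewrite dmax// inE.
- split; first exact/smoothP.
  exists (`[c, d]%classic); split.
  + exact: segment_compact.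
  + move=> x /=; rewrite !in_itv/= => /andP[cx xd].
    by rewrite (lt_le_trans ac cx) (le_lt_trans xd db).
  + move=> x /=; rewrite in_itv/= => /negP; rewrite negb_and -!ltNge => /orP xcd.
    by apply: phi0; case: xcd; [left|right].
Qed.

Lemma tst_cont a b phi : tst a b phi -> continuous phi.
Proof. by move=> [/smooth1_cont]. Qed.

Lemma cont_meas f (D : set R) : continuous f -> measurable_fun (D : set (measurableTypeR R)) f.
Proof. by move=> cf; apply: measurable_funTS; exact: continuous_measurable_fun. Qed.

Lemma tst_bounded a b phi : tst a b phi ->
  exists2 M, 0 <= M & forall x, `|phi x| <= M.
Proof.
move=> tphi; have cphi := tst_cont tphi; have [_ [c [d [ac db phi0]]]] := tphi.
have [dc|cd] := ltP d c.
  exists 0 => // x; rewrite phi0 ?normr0//.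
  by have [?|?] := ltP x c; [left|right; exact: lt_le_trans dc _].
have cp : {within `[c, d], continuous (fun x => `|phi x|)}.
  apply: continuous_subspaceT => x; apply: cvg_norm; exact: cphi.
have [m _ Hm] := EVT_max cd cp.
exists `|phi m| => // x.
have [xc|cx] := ltP x c; first by rewrite phi0 ?normr0//; left.
have [dx|xd] := ltP d x; first by rewrite phi0 ?normr0//; right.
by apply: Hm; rewrite in_itv/= cx xd.
Qed.

Lemma tst_deriv a b phi : tst a b phi -> tst a b (derive1 phi).
Proof.
move=> [sphi [c [d [ac db phi0]]]]; split; first exact: smooth1_deriv.
exists c, d; split => // x xcd; apply: is_derive_derive1.
suff h : \near x, 0 = phi x by exact: (near_eq_is_derive h (isd_cst 0 x)).
case: xcd => [xc|dx]; near=> y; rewrite phi0//; [left|right].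
- by near: y; exact: lt_nbhsl.
- by near: y; exact: lt_nbhsr.
Unshelve. all: by end_near. Qed.

Lemma tst_derivn a b n phi : tst a b phi -> tst a b (derive1n n phi).
Proof. by move=> tp; elim: n => [//|n /tst_deriv]; rewrite derive1nS. Qed.

Lemma tstZ a b c phi : tst a b phi -> tst a b (fun x => c * phi x).
Proof.
move=> [sp [p [q [ap qb p0]]]]; split; first exact: (@smooth1M _ (fun=> c) phi (@smooth1_cst _ c) sp).
by exists p, q; split => // x /p0 ->; rewrite mulr0.
Qed.

Lemma tstD a b phi psi : tst a b phi -> tst a b psi ->
  tst a b (fun x => phi x + psi x).
Proof.
move=> [sp [p [q [ap qb p0]]]] [sp' [p' [q' [ap' qb' p0']]]].
split; first exact: smooth1D.
exists (Num.min p p'), (Num.max q q'); split.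
- by rewrite lt_min ap.
- by rewrite gt_max qb.
- move=> x [|]; rewrite ?lt_min ?gt_max => /andP[h h'].
  + by rewrite p0 ?p0' ?addr0//; left.
  + by rewrite p0 ?p0' ?addr0//; right.
Qed.

Lemma flatbump_tst a b (c p q : R) : 0 < c -> a < p -> q < b -> tst a b (flatbump c p q).
Proof.
move=> c0 ap qb; split; first exact: flatbump_smooth.
exists p, q; split => // x xpq; rewrite flatbumpE.
by case: xpq => /ltW; rewrite leNgt => /negbTE ->; rewrite ?andbF.
Qed.

Lemma meas_oo a b : measurable (`]a, b[%classic : set (measurableTypeR R)).
Proof. exact: measurable_itv. Qed.

Lemma mu_itv_fin a b : (mu `]a, b[ < +oo)%E.
Proof. by rewrite lebesgue_measure_itv/=; case: ifP => _; rewrite ?ltry// -EFinB ltry. Qed.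

Lemma itg_cst_set (D : set (measurableTypeR R)) c : measurable D -> (mu D < +oo)%E ->
  itg mu D (fun=> c).
Proof.
move=> mD Dfin; apply/integrableP; split; first exact: measurable_cst.
have -> : (\int[mu]_(x in D) `|(EFin \o (fun=> c)) x| = `|c|%:E * mu D)%E.
  exact: integral_cst.
by rewrite lte_mul_pinfty.
Qed.

Lemma itg_cst a b c : itg mu `]a, b[ (fun=> c).
Proof. by apply: itg_cst_set; [exact: meas_oo|exact: mu_itv_fin]. Qed.

Lemma mu_itvE (l r : bool) a b : a <= b ->
  fine (mu ([set` Interval (BSide l a) (BSide r b)])) = b - a.
Proof.
move=> ab; rewrite lebesgue_measure_itv/= lte_fin.
by move: ab; rewrite le_eqVlt => /predU1P[->|->//]; rewrite ltxx subrr.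
Qed.

Lemma itg_bounded a b f M : measurable_fun (`]a, b[ : set (measurableTypeR R)) f ->
  (forall x, x \in `]a, b[ -> `|f x| <= M) -> itg mu `]a, b[ f.
Proof.
move=> mf fM; apply: (@itg_le _ _ _ _ _ (meas_oo a b) _ (cst M)) => //.
exact: itg_cst.
Qed.

Lemma sqi_bounded a b f M : measurable_fun (`]a, b[ : set (measurableTypeR R)) f ->
  (forall x, x \in `]a, b[ -> `|f x| <= M) -> sqi mu `]a, b[ f.
Proof.
move=> mf fM; split => //; apply: (@itg_bounded _ _ _ (M ^+ 2)).
  exact: measurable_funX.
move=> x xab; rewrite normrX lerXn2r ?nnegrE//; last exact: fM.
by rewrite (le_trans _ (fM _ xab)).
Qed.

Lemma sqi_cst a b c : sqi mu `]a, b[ (fun=> c).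
Proof. by apply: (@sqi_bounded _ _ _ `|c|). Qed.

Lemma sqi_itg a b f : sqi mu `]a, b[ f -> itg mu `]a, b[ f.
Proof.
move=> sf; have := sqi_mul (meas_oo a b) sf (sqi_cst a b 1).
by congr itg; apply/funext => x; rewrite mulr1.
Qed.

Lemma tst_sqi a b phi : tst a b phi -> sqi mu `]a, b[ phi.
Proof.
move=> tp; have [M _ HM] := tst_bounded tp.
by apply: (@sqi_bounded _ _ _ M) => //; apply: cont_meas; exact: tst_cont tp.
Qed.

(** Since F and f vanish near a and b, the fundamental theorem is only needed on
    a closed subinterval. *)
Lemma int_deriv0 a b c d (F f : R -> R) : a < c -> d < b ->
  (forall x, x \in `]a, b[ -> is_derive x (1 : R) F (f x)) ->
  (forall x, x \in `]a, b[ -> {for x, continuous f}) ->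
  (forall x, x < c \/ d < x -> F x = 0 /\ f x = 0) ->
  \int[mu]_(x in `]a, b[) f x = 0.
Proof.
move=> ac db dF cf F0.
have [dc|cd] := ltP d c.
  rewrite (@Rint_ext _ _ _ _ _ _ (cst 0)) ?Rintegral_cst// ?mul0r// => x _.
  apply: (F0 x _).2; have [?|?] := ltP x c; [by left|right].
  exact: lt_le_trans dc _.
(* The fundamental theorem is applied on [c', d'], with F c' = F d' = 0. *)
pose c' := (a + c) / 2; pose d' := (d + b) / 2.
have ac' : a < c' by rewrite /c'; lra.
have c'c : c' < c by rewrite /c'; lra.
have dd' : d < d' by rewrite /d'; lra.
have d'b : d' < b by rewrite /d'; lra.
have sub : `[c', d'] `<=` `]a, b[.
  by apply: subset_itv; rewrite bnd_simp.
have cd' : c' < d' by lra.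
have h : (\int[mu]_(x in `[c', d']) (f x)%:E = (F d')%:E - (F c')%:E)%E.
  apply: continuous_FTC2 => //.
  - apply: continuous_in_subspaceT => x /set_mem xcd; apply: cf; exact: sub.
  - split.
    + by move=> x xcd; have [|//] := dF x; apply: sub; exact: subset_itv_oo_cc.
    + apply: cvg_at_right_filter; apply: derivable_cont.
      by have [|//] := dF c'; apply: sub; rewrite /= in_itv/= lexx ltW.
    + apply: cvg_at_left_filter; apply: derivable_cont.
      by have [|//] := dF d'; apply: sub; rewrite /= in_itv/= lexx ltW.
  - move=> x xcd; apply: is_derive_derive1; apply: dF; apply: sub.
    exact: subset_itv_oo_cc.
have -> : \int[mu]_(x in `]a, b[) f x = \int[mu]_(x in `[c', d']) f x.
  have -> : `[c', d']%classic = `]a, b[%classic `&` `[c', d']%classic :> set R.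
    by apply/seteqP; split => x //=; [move=> h'; split => //; exact: sub|case].
  rewrite Rintegral_mkcondr; apply: Rint_ext => x _; rewrite patchE.
  case: ifPn => // /negP; rewrite inE/= in_itv/= => /negP.
  rewrite negb_and -!ltNge => xcd; apply: (F0 _ _).2.
  by case/orP: xcd => h'; [left|right]; [exact: lt_trans h' c'c|exact: lt_trans dd' h'].
rewrite /Rintegral h.
by rewrite (F0 d' _).1 ?(F0 c' _).1 ?sube0//=; [left|right].
Qed.

Lemma ibp_tst a b (F f : R -> R) phi : tst a b phi ->
  (forall x, x \in `]a, b[ -> is_derive x (1 : R) F (f x)) ->
  (forall x, x \in `]a, b[ -> {for x, continuous f}) ->
  \int[mu]_(x in `]a, b[) (F x * derive1 phi x + phi x * f x) = 0.
Proof.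
move=> tp dF cf; have [sp [c [d [ac db p0]]]] := tp.
have [_ [c' [d' [ac' db' p0']]]] := tst_deriv tp.
apply: (@int_deriv0 a b (Num.min c c') (Num.max d d') (fun x => F x * phi x)).
- by rewrite lt_min ac.
- by rewrite gt_max db.
- by move=> x xab; apply: isdM; [exact: dF|exact: smooth1_is_derive].
- move=> x xab; apply: cvgD; apply: cvgM.
  + by apply: derivable_cont; have [] := dF _ xab.
  + exact: tst_cont (tst_deriv tp) _.
  + exact: tst_cont tp _.
  + exact: cf.
- move=> x [|]; rewrite ?lt_min ?gt_max => /andP[h h'].
  + by rewrite p0 ?p0' ?mulr0 ?mul0r ?addr0//; left.
  + by rewrite p0 ?p0' ?mulr0 ?mul0r ?addr0//; right.
Qed.

End interval_tests.

(** * Primitives of square-integrable functions *)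

Section primitive.
Context {R : realType}.
Local Notation mu := (@lebesgue_measure R).
Implicit Types (f g h phi : R -> R) (x y : R).
Variables a b : R.
Local Notation D := (`]a, b[%classic : set (measurableTypeR R)).
Local Notation mD := (meas_oo a b).

(** The primitive vanishing at a.  Writing the bound t <= x as a factor makes it
    an L_2-pairing, defined for all real x and constant outside ]a, b[. *)
Definition prim h x := \int[mu]_(t in `]a, b[) (h t * (t <= x)%R%:R).

Lemma step_meas x : measurable_fun D (fun t : R => (t <= x)%R%:R : R).
Proof.
apply: measurable_funTS.
rewrite (_ : (fun t => _) = \1_(`]-oo, x]%classic : set (measurableTypeR R))).
  exact: measurable_indic.
by apply/funext => t; rewrite indicE mem_setE in_itv.
Qed.

Lemma step_sqi x : sqi mu D (fun t : R => (t <= x)%R%:R).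
Proof.
apply: (@sqi_bounded _ _ _ _ 1); first exact: step_meas.
by move=> t _; case: (t <= x); rewrite /= ?normr1// normr0.
Qed.

Lemma step_itg h x : itg mu D h -> itg mu D (fun t => h t * (t <= x)%R%:R).
Proof.
move=> ih; apply: (itg_le _ _ (itg_norm ih)) => //.
  by apply: measurable_funM; [exact: itg_meas ih|exact: step_meas].
by move=> t _; rewrite normrM; case: (t <= x); rewrite /= ?normr1 ?mulr1// normr0 mulr0.
Qed.

Lemma primB h1 h2 x : itg mu D h1 -> itg mu D h2 ->
  prim (fun t => h1 t - h2 t) x = prim h1 x - prim h2 x.
Proof.
move=> i1 i2; rewrite /prim -RintegralB//; try exact: step_itg.
by apply: Rint_ext => t _; rewrite mulrBl.
Qed.

Lemma prim_le h x : itg mu D h -> `|prim h x| <= \int[mu]_(t in D) `|h t|.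
Proof.
move=> ih; rewrite (le_trans (le_normr_Rintegral _ (step_itg x ih)))//.
apply: le_Rintegral => //.
- exact: (itg_norm (step_itg x ih)).
- exact: (itg_norm ih).
- move=> t _; rewrite normrM; case: (t <= x); by rewrite /= ?normr1 ?mulr1// normr0 mulr0.
Qed.

Lemma prim_sqr_le h x : a <= b -> sqi mu D h ->
  prim h x ^+ 2 <= (b - a) * nsq mu D h.
Proof.
move=> ab sh; rewrite mulrC (le_trans (cauchy_schwarz mD sh (step_sqi x)))//.
rewrite ler_wpM2l ?nsq_ge0//.
have -> : b - a = \int[mu]_(t in D) 1.
  by rewrite Rintegral_cst// mul1r mu_itvE.
apply: le_Rintegral => //; first by have [] := step_sqi x.
  exact: sqi_itg (sqi_cst _ _ 1).
by move=> t _; case: (t <= x); rewrite /= ?expr1n// expr0n.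
Qed.

(** Cauchy-Schwarz against the indicator of ]x, y]. *)
Lemma prim_holder h x y : sqi mu D h ->
  (prim h y - prim h x) ^+ 2 <= nsq mu D h * `|y - x|.
Proof.
move=> sh; wlog xy : x y / x <= y.
  move=> H; have [/H//|/ltW/H] := leP x y.
  by rewrite distrC -[X in X ^+ 2 <= _]opprB sqrrN.
have ih := sqi_itg sh.
rewrite /prim -RintegralB//; try exact: step_itg.
have -> : \int[mu]_(t in `]a, b[) (h t * (t <= y)%R%:R - h t * (t <= x)%R%:R) =
   \int[mu]_(t in D) (h t * ((t <= y)%R%:R - (t <= x)%R%:R)).
  by apply: Rint_ext => t _; rewrite mulrBr.
have sd := sqiB mD (step_sqi y) (step_sqi x).
rewrite (le_trans (cauchy_schwarz mD sh sd))// ler_wpM2l ?nsq_ge0//.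
rewrite ger0_norm ?subr_ge0//.
have -> : y - x = \int[mu]_(t in `]x, y]) 1.
  by rewrite Rintegral_cst// mul1r mu_itvE.
rewrite /nsq Rintegral_mkcond [leRHS]Rintegral_mkcond.
have i1 : itg mu setT (((fun t : R => ((t <= y)%R%:R - (t <= x)%R%:R) ^+ 2 : R) \_ D)).
  exact: (restrictT_itg _ mD _).1 sd.2.
have i2 : itg mu setT ((fun=> 1 : R) \_ `]x, y]).
  have mxy : measurable (`]x, y]%classic : set (measurableTypeR R)) by exact: measurable_itv.
  apply: (restrictT_itg _ mxy _).1; apply: itg_cst_set => //.
  by rewrite lebesgue_measure_itv/=; case: ifP => _; rewrite ?ltry// -EFinB ltry.
apply: le_Rintegral => // t _.
rewrite !patchE; case: ifPn => _; last by case: ifPn.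
rewrite mem_setE in_itv/=; have [ty|ty] := leP t y; have [tx|tx] := leP t x => /=.
- by rewrite subrr expr0n.
- by rewrite subr0 expr1n.
- by move: (le_trans tx xy); rewrite leNgt ty.
- by rewrite subrr expr0n.
Qed.

Lemma prim_cont h : sqi mu D h -> continuous (prim h).
Proof.
move=> sh x; apply/cvgrPdist_le => e e0; near=> y.
have := prim_holder y x sh.
have n0 := nsq_ge0 mu D h.
have xy : `|x - y| <= e ^+ 2 / (nsq mu D h + 1).
  near: y; apply: (@cvgr_dist_le _ _ _ _ _ (fun y => y)) => //.
  by rewrite divr_gt0 ?exprn_gt0// ltr_wpDl ?nsq_ge0.
have : `|x - y| * (nsq mu D h + 1) <= e ^+ 2 by rewrite -ler_pdivlMr// ltr_wpDl ?nsq_ge0.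
move=> h1 h2; rewrite -ler_sqr ?nnegrE ?(ltW e0)// real_normK ?num_real//.
by rewrite (le_trans h2)// (le_trans _ h1)// mulrC ler_wpM2l// lerDl.
Unshelve. all: by end_near. Qed.

Lemma primE h y : itg mu D h ->
  prim h y = \int[mu]_(t in `]-oo, y]) (h \_ D) t.
Proof.
move=> ih; rewrite -Rintegral_mkcondl /prim Rintegral_mkcondr.
apply: Rint_ext => t _; rewrite patchE mem_setE in_itv/=.
by case: (t <= y); rewrite /= ?mulr1 ?mulr0.
Qed.

Lemma prim_derive h x : sqi mu D h -> x \in `]a, b[ -> lebesgue_pt (h \_ D) x ->
  is_derive x (1 : R) (prim h) (h x).
Proof.
move=> /sqi_itg ih xab lx.
have ihT : mu.-integrable setT (EFin \o (h \_ D)).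
  exact: (restrictT_itg _ mD _).1 ih.
have [] := @FTC1_lebesgue_pt R (h \_ D) -oo%O x (x + 1) _ _ _ lx.
- by rewrite ltrDl.
- by apply: integrableS ihT.
- exact: ltNyr.
move=> /= d1 d2.
have -> : prim h = (fun y => \int[mu]_(t in `]-oo, y]) (h \_ D) t).
  by apply/funext => y; rewrite primE.
apply: DeriveDef => //.
by rewrite -derive1E d2 patchE mem_set.
Qed.

Lemma prim_ae_derive h : sqi mu D h ->
  {ae mu, forall x, x \in `]a, b[ -> is_derive x (1 : R) (prim h) (h x)}.
Proof.
move=> sh; have ih := sqi_itg sh.
have ihT : mu.-integrable setT (EFin \o (h \_ D)).
  exact: (restrictT_itg _ mD _).1 ih.
have : locally_integrable setT (h \_ D).
  by apply: open_integrable_locally => //; exact: openT.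
move=> /lebesgue_differentiation.
apply: filterS; first exact: (ae_filter_ringOfSetsType mu).
move=> x lx xab.
exact: prim_derive.
Qed.

Lemma prim_cont_derive h x : sqi mu D h -> x \in `]a, b[ -> {for x, continuous h} ->
  is_derive x (1 : R) (prim h) (h x).
Proof.
move=> sh xab cx; apply: prim_derive => //.
have oD : open_nbhs x `]a, b[ by split => //; exact: interval_open.
apply: (@continuous_lebesgue_pt _ _ _ `]a, b[) => //.
- apply/measurable_restrict => //; rewrite setIid; by case: sh.
- rewrite /prop_for/continuous_at patchE mem_set//.
  apply: cvg_trans cx; apply: near_eq_cvg.
  have := open_nbhs_nbhs oD; apply: filterS => y yD.
  by rewrite patchE mem_set.
Qed.

End primitive.

(** * The fundamental lemma of the calculus of variations *)

Section fundamental_lemma.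
Context {R : realType}.
Local Notation mu := (@lebesgue_measure R).
Implicit Types (f g h phi : R -> R) (x y : R).

Lemma ae_mu (P Q : R -> Prop) : (forall x, P x -> Q x) ->
  {ae mu, forall x, P x} -> {ae mu, forall x, Q x}.
Proof. by move=> PQ; apply: filterS; first exact: (ae_filter_ringOfSetsType mu). Qed.

Lemma ae_mu2 (P Q S : R -> Prop) : (forall x, P x -> Q x -> S x) ->
  {ae mu, forall x, P x} -> {ae mu, forall x, Q x} -> {ae mu, forall x, S x}.
Proof. by move=> PQ; apply: filterS2; first exact: (ae_filter_ringOfSetsType mu). Qed.

Lemma ae_neq (q : R) : {ae mu, forall x, x != q}.
Proof.
exists [set q]; split => //; first exact: lebesgue_measure_set1.
by move=> x /= /negP; rewrite negbK => /eqP.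
Qed.

Lemma flatbump_cvg p q x :
  flatbump n.+1%:R^-1 p q x @[n --> \oo] --> ((p < x < q)%R%:R : R).
Proof.
under eq_cvg => n do rewrite flatbumpE.
have [/andP[px xq]|_] := boolP (p < x < q); last exact: cvg_cst.
have -> : true%:R = expR (- (0 * (x - p)^-1) - 0 * (q - x)^-1) :> R.
  by rewrite !mul0r subr0 oppr0 expR0.
apply: continuous_cvg; first exact: continuous_expR.
have h : n.+1%:R^-1 @[n --> \oo] --> (0 : R) by exact: cvg_harmonic.
by apply: cvgB; [apply: cvgN|]; apply: cvgMl.
Qed.

Variables a b : R.
Local Notation D := (`]a, b[%classic : set (measurableTypeR R)).
Local Notation mD := (meas_oo a b).

(** The bumps tend boundedly to the indicator of ]p, q[, and the integral of h
    against this indicator is the increment of the primitive. *)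
Lemma rat_flat h (p q : R) : sqi mu D h -> p <= q ->
  (forall n, \int[mu]_(x in D) (h x * flatbump n.+1%:R^-1 p q x) = 0) ->
  prim a b h q = prim a b h p.
Proof.
move=> sh pq h0; have ih := sqi_itg sh; have mh := itg_meas ih.
have mb n : measurable_fun D (flatbump n.+1%:R^-1 p q : R -> R).
  by apply: cont_meas; apply: smooth1_cont; apply: flatbump_smooth; rewrite invr_gt0.
have ms : measurable_fun D (fun x : R => (p < x < q)%R%:R : R).
  apply: measurable_funTS.
  rewrite (_ : (fun t => _) = \1_(`]p, q[%classic : set (measurableTypeR R))).
    exact: measurable_indic.
  by apply/funext => t; rewrite indicE mem_setE in_itv.
have : \int[mu]_(x in D) (h x * flatbump n.+1%:R^-1 p q x) @[n --> \oo] -->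
    \int[mu]_(x in D) (h x * (p < x < q)%R%:R).
  apply: (dom_cvg mD _ _ _ (itg_norm ih)).
  - by move=> n; exact: measurable_funM.
  - exact: measurable_funM.
  - apply: aeW => x _; apply: cvgMr; exact: flatbump_cvg.
  - apply: aeW => x n _; rewrite normrM ler_piMr//.
    rewrite ger0_norm ?flatbump_ge0//; apply: flatbump_le1; by rewrite invr_gt0.
under eq_cvg => n do rewrite h0.
move=> /(cvg_unique (@Rhausdorff R) (cvg_cst _)) => e.
apply/eqP; rewrite -subr_eq0 /prim -RintegralB//; try exact: step_itg.
rewrite e; apply/eqP/ae_Rint => //.
- by apply: measurable_funB; apply: measurable_funM => //; exact: step_meas.
- exact: measurable_funM.
- apply: ae_mu (ae_neq q) => x xq _; rewrite -mulrBr; congr (_ * _).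
  have [xp|px] := leP x p.
    by rewrite (le_trans xp pq) subrr.
  by rewrite subr0 le_eqVlt (negbTE xq).
Qed.

Lemma prim_const_zero h C : sqi mu D h ->
  (forall x, x \in `]a, b[ -> prim a b h x = C) ->
  {ae mu, forall x, x \in `]a, b[ -> h x = 0}.
Proof.
move=> sh hC; apply: ae_mu (prim_ae_derive sh) => x /[swap] xab /(_ xab) d.
have h1 : \near x, prim a b h x = C.
  have oD : open_nbhs x (`]a, b[%classic : set R) by split => //; exact: interval_open.
  by have := open_nbhs_nbhs oD; apply: filterS => y; exact: hC.
have d2 := near_eq_is_derive h1 d.
by rewrite -(is_derive_derive1 d2) derive1_cst.
Qed.

(** By continuity the primitive of h is constant as soon as its increments between
    rationals vanish, so countably many test functions decide.  This countability
    lets exceptional null sets be gathered in Q_zero. *)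
Lemma fundamental_rat h : sqi mu D h ->
  (forall (p q : rat) n, a < ratr p -> ratr q < b ->
    \int[mu]_(x in D) (h x * flatbump n.+1%:R^-1 (ratr p) (ratr q) x) = 0) ->
  {ae mu, forall x, x \in `]a, b[ -> h x = 0}.
Proof.
move=> sh h0.
have key (p q : rat) : a < ratr p -> ratr q < b -> ratr p <= ratr q :> R ->
    prim a b h (ratr q) = prim a b h (ratr p).
  by move=> ap qb pq; apply: rat_flat => // n; exact: h0.
have [ab|ba] := ltP a b; last first.
  apply: aeW => x; rewrite in_itv/= => /andP[ax xb].
  by move: (lt_le_trans (lt_trans ax xb) ba); rewrite ltxx.
have [q0] := rat_in_itvoo ab; rewrite in_itv/= => /andP[aq0 q0b].
apply: (@prim_const_zero _ (prim a b h (ratr q0)) sh) => x.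
rewrite in_itv/= => /andP[ax xb].
apply/eqP; rewrite -subr_eq0 -normr_le0; apply/ler_addgt0Pl => e e0; rewrite addr0.
have := @prim_cont _ _ _ _ sh x => /cvgrPdist_le/(_ _ e0)[d/= d0 Hd].
have xd : x < Num.min b (x + d) by rewrite lt_min xb ltrDl.
have [q] := rat_in_itvoo xd; rewrite in_itv/= lt_min => /andP[xq /andP[qb qd]].
have <- : prim a b h (ratr q) = prim a b h (ratr q0).
  have aq := lt_trans ax xq.
  by have [qq|/ltW qq] := leP (ratr q0 : R) (ratr q); [exact: key|exact/esym/key].
apply: Hd => /=; rewrite ltr0_norm ?subr_lt0// opprB.
by rewrite ltrBlDl.
Qed.

Lemma fundamental h : sqi mu D h ->
  (forall phi, tst a b phi -> \int[mu]_(x in D) (h x * phi x) = 0) ->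
  {ae mu, forall x, x \in `]a, b[ -> h x = 0}.
Proof.
move=> sh h0; apply: fundamental_rat => // p q n ap qb.
by apply: h0; apply: flatbump_tst => //; rewrite invr_gt0.
Qed.

Lemma ae_itv_false : a < b -> {ae mu, forall x, x \in `]a, b[ -> False} -> False.
Proof.
move=> ab [N [mN N0 sN]].
have : (mu `]a, b[ <= mu N)%E.
  apply: le_measure; rewrite ?inE//.
  by move=> x xab; apply: sN => /=; apply; exact: xab.
by rewrite N0 lebesgue_measure_itv/= lte_fin ab -EFinB lee_fin subr_le0 leNgt ab.
Qed.

(** If all test functions had mean zero, the fundamental lemma would give 1 = 0. *)
Lemma unit_tst : a < b -> exists2 psi, tst a b psi & \int[mu]_(x in D) psi x = 1.
Proof.
move=> ab; have [[psi tp pn0]|none] := pselect (exists2 psi, tst a b psi &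
    \int[mu]_(x in D) psi x <> 0).
  exists (fun x => (\int[mu]_(x in D) psi x)^-1 * psi x); first exact: tstZ.
  rewrite RintegralZl//; first by rewrite mulVf//; exact/eqP.
  exact: sqi_itg (tst_sqi tp).
exfalso; apply: (ae_itv_false ab).
have h1 : {ae mu, forall x, x \in `]a, b[ -> (1 : R) = 0}.
  apply: (@fundamental (fun=> 1)); first exact: sqi_cst.
  move=> phi tp; apply: contrapT => pn0; apply: none; exists phi => //.
  by under eq_Rintegral => x _ do rewrite -[phi x]mul1r.
by apply: ae_mu h1 => x h /h /eqP; rewrite oner_eq0.
Qed.

(** Mean zero makes the primitive vanish to the right of the support. *)
Lemma zero_mean_prim phi : tst a b phi -> \int[mu]_(x in D) phi x = 0 ->
  tst a b (prim a b phi) /\ derive1 (prim a b phi) = phi.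
Proof.
move=> tp p0; have [sp [c [d [ac db phi0]]]] := tp.
have sq := tst_sqi tp.
have out x : x < c \/ d < x -> prim a b phi x = 0.
  move=> [xc|dx]; rewrite /prim.
    rewrite (@Rint_ext _ _ _ _ _ _ (cst 0)) ?Rintegral_cst// ?mul0r// => t _.
    have [tx|] := leP t x; last by rewrite mulr0.
    by rewrite phi0 ?mul0r//; left; exact: le_lt_trans tx xc.
  rewrite -[RHS]p0; apply: Rint_ext => t _.
  have [tx|xt] := leP t x; first by rewrite mulr1.
  by rewrite mulr0 phi0//; right; exact: lt_trans dx xt.
have dprim x : is_derive x (1 : R) (prim a b phi) (phi x).
  have [xc|cx] := ltP x c.
    rewrite phi0; last by left.
    suff h : \near x, 0 = prim a b phi x by exact: (near_eq_is_derive h (isd_cst 0 x)).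
    by near=> y; rewrite out//; left; near: y; exact: lt_nbhsl.
  have [dx|xd] := ltP d x.
    rewrite phi0; last by right.
    suff h : \near x, 0 = prim a b phi x by exact: (near_eq_is_derive h (isd_cst 0 x)).
    by near=> y; rewrite out//; right; near: y; exact: lt_nbhsr.
  apply: prim_cont_derive => //.
    by rewrite in_itv/= (lt_le_trans ac cx) (le_lt_trans xd db).
  exact: smooth1_cont.
have E : derive1 (prim a b phi) = phi.
  by apply/funext => x; exact: is_derive_derive1.
split=> //; split.
  move=> [|n] x; first by have [] := dprim x.
  by rewrite derive1Sn E; exact: sp.
by exists c, d.
Unshelve. all: by end_near. Qed.

(** For psi of mass one, phi - (int phi) psi has mean zero, hence is the
    derivative of a test function. *)
Lemma dubois_reymond h : a < b -> sqi mu D h ->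
  (forall phi, tst a b phi -> \int[mu]_(x in D) (h x * derive1 phi x) = 0) ->
  exists C, {ae mu, forall x, x \in `]a, b[ -> h x = C}.
Proof.
move=> ab sh h0; have [psi tpsi psi1] := unit_tst ab.
exists (\int[mu]_(x in D) (h x * psi x)); set C := Rintegral _ _ _.
have sC : sqi mu D (fun x => h x - C) by apply: (sqiB mD sh); exact: sqi_cst.
suff H : forall phi, tst a b phi -> \int[mu]_(x in D) ((h x - C) * phi x) = 0.
  by apply: ae_mu (fundamental sC H) => x {}H /H /eqP; rewrite subr_eq0 => /eqP.
move=> phi tp; pose m := \int[mu]_(x in D) phi x.
have tchi : tst a b (fun x => phi x + (- m) * psi x) by apply: tstD => //; exact: tstZ.
have ip := sqi_itg (tst_sqi tp); have ipsi := sqi_itg (tst_sqi tpsi).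
have chi0 : \int[mu]_(x in D) (phi x + (- m) * psi x) = 0.
  rewrite RintegralD//; last exact: itgZ.
  by rewrite RintegralZl// psi1 mulr1 subrr.
have [tX dX] := zero_mean_prim tchi chi0.
have := h0 _ tX; rewrite dX => e.
have ihp := sqi_mul mD sh (tst_sqi tp); have ihpsi := sqi_mul mD sh (tst_sqi tpsi).
have : \int[mu]_(x in D) (h x * phi x + (- m) * (h x * psi x)) = 0.
  by rewrite -[RHS]e; apply: Rint_ext => x _; ring.
rewrite RintegralD//; last exact: itgZ.
rewrite RintegralZl// -/C => e2.
transitivity (\int[mu]_(x in D) (h x * phi x + (- C) * phi x)).
  by apply: Rint_ext => x _; ring.
rewrite RintegralD//; last exact: itgZ.
by rewrite RintegralZl// -/m mulNr mulrC -mulNr.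
Qed.

End fundamental_lemma.

(** * The chain rule for primitives *)

Section chain_rule.
Context {R : realType}.
Local Notation mu := (@lebesgue_measure R).
Implicit Types (f g h phi : R -> R) (x y : R).
Variables a b : R.
Hypothesis ab : a < b.
Local Notation D := (`]a, b[%classic : set (measurableTypeR R)).
Local Notation mD := (meas_oo a b).

Lemma cont_bounded_ball g M : continuous g ->
  exists2 B, 0 <= B & forall y, `|y| <= M -> `|g y| <= B.
Proof.
move=> cg; have [M0|M0] := ltP M 0.
  exists 0 => // y yM; have := le_lt_trans yM M0; by rewrite normr_lt0.
have cp : {within `[-M, M], continuous (fun x => `|g x|)}.
  by apply: continuous_subspaceT => x; apply: cvg_norm; exact: cg.
have MM : - M <= M by lra.
have [m _ Hm] := EVT_max MM cp.
exists `|g m| => // y; rewrite ler_norml => yM; apply: Hm.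
by rewrite in_itv.
Qed.

Lemma sqi_cont g : continuous g -> sqi mu D g.
Proof.
move=> cg; have [B _ HB] := cont_bounded_ball (Num.max `|a| `|b|) cg.
apply: (@sqi_bounded _ _ _ _ B); first exact: cont_meas.
move=> x; rewrite in_itv/= => /andP[ax xb]; apply: HB.
rewrite ler_norml; apply/andP; split.
  rewrite lerNl le_max (le_trans (y := - a))//; first by rewrite lerN2 ltW.
  by rewrite -normrN ler_norm.
by rewrite le_max (le_trans (ltW xb) (ler_norm _)) orbT.
Qed.

(** Approximate h in L_1 by continuous functions g_n.  For these c + prim g_n is
    C^1 and the formula is integration by parts; the primitives converge
    uniformly, which allows the limit in each term. *)
Lemma chain_prim (H H' : R -> R) c h phi : sqi mu D h -> tst a b phi ->
  (forall y, is_derive y (1 : R) H (H' y)) -> continuous H' ->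
  \int[mu]_(x in D) (H (c + prim a b h x) * derive1 phi x) =
  - \int[mu]_(x in D) (H' (c + prim a b h x) * h x * phi x).
Proof.
move=> sh tp dH cH'; have ih := sqi_itg sh; have mh := itg_meas ih.
have cH : continuous H by move=> y; apply: derivable_cont; have [] := dH y.
have [g0 [cg0 ig0 g0h]] := approximation_continuous_integrable mD (mu_itv_fin a b) ih.
have eps0 : \int[mu]_(z in D) `|h z - g0 n z| @[n --> \oo] --> 0 by exact: (fine_cvg g0h).
have [N _ HN] : \forall n \near \oo, \int[mu]_(z in D) `|h z - g0 n z| <= 1.
  move/cvgrPdist_le : eps0 => /(_ _ ltr01); apply: filterS => n; rewrite sub0r normrN.
  exact: le_trans (ler_norm _).
(* After dropping N terms all the L_1 errors are at most 1, so that all the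
   primitives take their values in one ball. *)
pose g n := g0 (n + N)%N; pose eps n := \int[mu]_(z in D) `|h z - g n z|.
have eps_cvg : eps n @[n --> \oo] --> 0.
  by apply: (cvg_comp _ _ (cvg_addnr N) eps0).
have eps1 n : eps n <= 1 by apply: HN => /=; exact: leq_addl.
have cg n : continuous (g n) by exact: cg0.
have sg n : sqi mu D (g n) by exact: sqi_cont.
have ig n := sqi_itg (sg n).
pose v x := c + prim a b h x; pose vn n x := c + prim a b (g n) x.
have cv : continuous v by move=> x; apply: cvgD; [exact: cvg_cst|exact: prim_cont].
have cvn n : continuous (vn n) by move=> x; apply: cvgD; [exact: cvg_cst|exact: prim_cont].
have vd n x : `|v x - vn n x| <= eps n.
  rewrite /v /vn opprD addrACA subrr add0r -primB//.
  by apply: prim_le; exact: itgB.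
have vcvg x : vn n x @[n --> \oo] --> v x.
  apply/cvgrPdist_le => e e0; move/cvgrPdist_le : eps_cvg => /(_ _ e0).
  apply: filterS => n; rewrite sub0r normrN => en.
  by rewrite (le_trans (vd n x))// (le_trans (ler_norm _)).
pose M := `|c| + \int[mu]_(z in D) `|h z| + 1.
have vM x : `|v x| <= M.
  rewrite /M (le_trans (ler_normD _ _))// -addrA lerD2l.
  by rewrite (le_trans (prim_le x ih)) ?lerDl.
have vnM n x : `|vn n x| <= M.
  have -> : vn n x = v x - (v x - vn n x) by ring.
  rewrite (le_trans (ler_normB _ _))// /M lerD//; last exact: le_trans (vd n x) _.
  by rewrite (le_trans (ler_normD _ _))// lerD2l (prim_le x ih).
have [B B0 HB] := cont_bounded_ball M cH.
have [B' B'0 HB'] := cont_bounded_ball M cH'.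
have [P P0 HP] := tst_bounded tp; have [P' P'0 HP'] := tst_bounded (tst_deriv tp).
have cphi := tst_cont tp; have cdphi := tst_cont (tst_deriv tp).
have mcomp (G w : R -> R) : continuous G -> continuous w -> measurable_fun D (fun x => G (w x)).
  by move=> cG cw; apply: cont_meas => x; apply: continuous_comp; [exact: cw|exact: cG].
have i1 n : itg mu D (fun x => H (vn n x) * derive1 phi x).
  apply: (@itg_bounded _ _ _ _ (B * P')).
    by apply: measurable_funM; [exact: mcomp|exact: cont_meas].
  by move=> x _; rewrite normrM ler_pM// HB.
have m2 n : measurable_fun D (fun x => H' (vn n x) * h x * phi x).
  by apply: measurable_funM; [apply: measurable_funM => //; exact: mcomp|exact: cont_meas].
have i2 n : itg mu D (fun x => H' (vn n x) * h x * phi x).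
  apply: (itg_le mD (m2 n) (itgZ mD (B' * P) (itg_norm ih))) => x _.
  by rewrite !normrM mulrAC ler_wpM2r// ler_pM// HB'.
have m3 n : measurable_fun D (fun x => H' (vn n x) * (g n x - h x) * phi x).
  apply: measurable_funM; last exact: cont_meas.
  apply: measurable_funM; first exact: mcomp.
  by apply: measurable_funB => //; exact: cont_meas.
have ihg n := itg_norm (itgB mD ih (ig n)).
have b3 n x : `|H' (vn n x) * (g n x - h x) * phi x| <= B' * P * `|h x - g n x|.
  by rewrite !normrM mulrAC distrC ler_wpM2r// ler_pM// HB'.
have i3 n : itg mu D (fun x => H' (vn n x) * (g n x - h x) * phi x).
  by apply: (itg_le mD (m3 n) (itgZ mD (B' * P) (ihg n))) => x _; exact: b3.
have Z n : \int[mu]_(x in D) (H (vn n x) * derive1 phi x) +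
    \int[mu]_(x in D) (H' (vn n x) * h x * phi x) +
    \int[mu]_(x in D) (H' (vn n x) * (g n x - h x) * phi x) = 0.
  rewrite -(RintegralD mD (i1 n) (i2 n)) -(RintegralD mD (itgD mD (i1 n) (i2 n)) (i3 n)).
  rewrite -[RHS](@ibp_tst _ a b (fun x => H (vn n x)) (fun x => H' (vn n x) * g n x) phi tp).
  - by apply: Rint_ext => x _; ring.
  - move=> x xab.
    have d1 := isd_eq (isdD (isd_cst c x) (prim_cont_derive (sg n) xab (cg n x))) (add0r _).
    exact: (@isd_comp _ H (vn n) x _ _ (dH (vn n x)) d1).
  - move=> x xab; apply: cvgM; last exact: cg.
    by apply: continuous_comp; [exact: cvn|exact: cH'].
have L1 : \int[mu]_(x in D) (H (vn n x) * derive1 phi x) @[n --> \oo] -->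
    \int[mu]_(x in D) (H (v x) * derive1 phi x).
  apply: (dom_cvg mD _ _ _ (itg_cst a b (B * P'))).
  - by move=> n; exact: itg_meas (i1 n).
  - by apply: measurable_funM; [exact: mcomp|exact: cont_meas].
  - apply: aeW => x _; apply: cvgMl.
    by apply: continuous_cvg; [exact: cH|exact: vcvg].
  - by apply: aeW => x n _; rewrite normrM ler_pM// HB.
have L2 : \int[mu]_(x in D) (H' (vn n x) * h x * phi x) @[n --> \oo] -->
    \int[mu]_(x in D) (H' (v x) * h x * phi x).
  apply: (dom_cvg mD _ _ _ (itgZ mD (B' * P) (itg_norm ih))).
  - by move=> n; exact: itg_meas (i2 n).
  - by apply: measurable_funM; [apply: measurable_funM => //; exact: mcomp|exact: cont_meas].
  - apply: aeW => x _; apply: cvgMl; apply: cvgMl.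
    by apply: continuous_cvg; [exact: cH'|exact: vcvg].
  - by apply: aeW => x n _; rewrite !normrM mulrAC ler_wpM2r// ler_pM// HB'.
have L3 : \int[mu]_(x in D) (H' (vn n x) * (g n x - h x) * phi x) @[n --> \oo] --> 0.
  apply/cvgr0Pnorm_le => e e0.
  have h0 : B' * P * eps n @[n --> \oo] --> 0.
    by rewrite -(mulr0 (B' * P)); exact: cvgMr.
  move/cvgrPdist_le : h0 => /(_ _ e0); apply: filterS => n; rewrite sub0r normrN.
  apply: le_trans; rewrite (le_trans _ (ler_norm _))//.
  rewrite (le_trans (le_normr_Rintegral mD (i3 n)))//.
  rewrite /eps -RintegralZl//; last exact: ihg.
  exact: (le_Rintegral mD (itg_norm (i3 n)) (itgZ mD _ (ihg n)) (fun x _ => b3 n x)).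
have L : (\int[mu]_(x in D) (H (vn n x) * derive1 phi x) +
    \int[mu]_(x in D) (H' (vn n x) * h x * phi x) +
    \int[mu]_(x in D) (H' (vn n x) * (g n x - h x) * phi x)) @[n --> \oo] -->
    \int[mu]_(x in D) (H (v x) * derive1 phi x) +
    \int[mu]_(x in D) (H' (v x) * h x * phi x) + 0.
  by apply: cvgD => //; exact: cvgD.
(* The left-hand sides vanish identically by Z, so their limit is 0. *)
move: L; rewrite (funext Z : _ = (fun=> 0)).
move=> /(cvg_unique (@Rhausdorff R) (cvg_cst _)) /esym/eqP.
by rewrite addr0 addr_eq0 => /eqP.
Qed.

Lemma prim_weak c h phi : sqi mu D h -> tst a b phi ->
  \int[mu]_(x in D) ((c + prim a b h x) * derive1 phi x) =
  - \int[mu]_(x in D) (h x * phi x).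
Proof.
move=> sh tp; have := @chain_prim (fun y => y) (fun=> 1) c h phi sh tp (@isd_id _) (fun=> cvg_cst _).
by move=> ->; congr (- _); apply: Rint_ext => x _; rewrite mul1r.
Qed.

Lemma prim_sqi c h : sqi mu D h -> sqi mu D (fun x => c + prim a b h x).
Proof.
move=> sh; apply: sqi_cont => x; apply: cvgD; [exact: cvg_cst|exact: prim_cont].
Qed.

(** The difference f - prim h has weak derivative zero. *)
Lemma weak_char f h : sqi mu D f -> sqi mu D h ->
  (forall phi, tst a b phi -> \int[mu]_(x in D) (f x * derive1 phi x) =
    - \int[mu]_(x in D) (h x * phi x)) ->
  exists c, {ae mu, forall x, x \in `]a, b[ -> f x = c + prim a b h x}.
Proof.
move=> sf sh fh.
have sC : sqi mu D (fun x => f x - (0 + prim a b h x)) by apply: sqiB => //; exact: prim_sqi.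
suff H : forall phi, tst a b phi ->
    \int[mu]_(x in D) ((f x - (0 + prim a b h x)) * derive1 phi x) = 0.
  have [c Hc] := dubois_reymond ab sC H.
  by exists c; apply: ae_mu Hc => x {}H /H <-; ring.
move=> phi tp; have sd := tst_sqi (tst_deriv tp).
transitivity (\int[mu]_(x in D) (f x * derive1 phi x - (0 + prim a b h x) * derive1 phi x)).
  by apply: Rint_ext => x _; ring.
rewrite RintegralB//; try (apply: sqi_mul => //; exact: prim_sqi).
by rewrite fh// prim_weak// subrr.
Qed.

End chain_rule.

(** * First weak derivatives and continuous representatives *)

Section product_rule.
Context {R : realType}.
Local Notation mu := (@lebesgue_measure R).
Implicit Types (f g h phi : R -> R) (x y : R).
Variables a b : R.
Hypothesis ab : a < b.
Local Notation D := (`]a, b[%classic : set (measurableTypeR R)).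
Local Notation mD := (meas_oo a b).

Lemma contv c h : sqi mu D h -> continuous (fun x => c + prim a b h x).
Proof. by move=> sh x; apply: cvgD; [exact: cvg_cst|exact: prim_cont]. Qed.

Lemma sqi_cmul g h : continuous g -> sqi mu D h -> sqi mu D (fun x => g x * h x).
Proof.
move=> cg sh; have [B _ HB] := cont_bounded_ball (Num.max `|a| `|b|) cg.
apply: (@sqi_bnd _ _ _ _ _ mD B) => //; first exact: cont_meas.
apply: aeW => x /=; rewrite in_itv/= => /andP[ax xb]; apply: HB.
rewrite ler_norml; apply/andP; split.
  rewrite lerNl le_max (le_trans (y := - a))//; first by rewrite lerN2 ltW.
  by rewrite -normrN ler_norm.
by rewrite le_max (le_trans (ltW xb) (ler_norm _)) orbT.
Qed.

End product_rule.

Section weak_derivative.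
Context {R : realType}.
Local Notation mu := (@lebesgue_measure R).
Implicit Types (f g h phi : R -> R) (x y : R).
Variable L : R.
Hypothesis L0 : 0 < L.
Local Notation D := (`]0, L[%classic : set (measurableTypeR R)).
Local Notation mD := (meas_oo 0 L).

Lemma L2IP f : L2I L f <-> sqi mu D f.
Proof. exact: LfunP2. Qed.

Lemma weak_dxP j f h : weak_dx L j f h <-> [/\ sqi mu D f, sqi mu D h &
  forall phi, tst 0 L phi -> \int[mu]_(x in D) (f x * derive1n j phi x) =
     (-1) ^+ j * \int[mu]_(x in D) (h x * phi x)].
Proof.
split=> [[/L2IP sf /L2IP sh H]|[/L2IP sf /L2IP sh H]]; split => // phi.
- by move=> /tstP/H.
- by move=> /tstP/H.
Qed.

Lemma weak1P f h : weak_dx L 1 f h <-> [/\ sqi mu D f, sqi mu D h &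
  forall phi, tst 0 L phi -> \int[mu]_(x in D) (f x * derive1 phi x) =
     - \int[mu]_(x in D) (h x * phi x)].
Proof.
split=> [/weak_dxP[sf sh H]|[sf sh H]].
- by split => // phi /H; rewrite expr1 mulN1r.
- by apply/weak_dxP; split => // phi /H; rewrite expr1 mulN1r.
Qed.

Lemma ae_Rint_mul f g p : sqi mu D f -> sqi mu D g -> sqi mu D p ->
  {ae mu, forall x, x \in `]0, L[ -> f x = g x} ->
  \int[mu]_(x in D) (f x * p x) = \int[mu]_(x in D) (g x * p x).
Proof.
move=> [mf _] [mg _] [mp _] fg; apply: (ae_Rint mD).
- exact: measurable_funM.
- exact: measurable_funM.
- by apply: ae_mu fg => x + Dx => ->.
Qed.

Lemma weak_dx_ext j f f' h h' : sqi mu D f' -> sqi mu D h' ->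
  {ae mu, forall x, x \in `]0, L[ -> f x = f' x} ->
  {ae mu, forall x, x \in `]0, L[ -> h x = h' x} ->
  weak_dx L j f h -> weak_dx L j f' h'.
Proof.
move=> sf' sh' ff' hh' /weak_dxP[sf sh H]; apply/weak_dxP; split => // phi tp.
rewrite -(ae_Rint_mul sf sf' _ ff'); last exact/tst_sqi/tst_derivn.
by rewrite H// (ae_Rint_mul sh sh' (tst_sqi tp) hh').
Qed.

Lemma weak_dxD j f f' h h' : weak_dx L j f h -> weak_dx L j f' h' ->
  weak_dx L j (fun x => f x + f' x) (fun x => h x + h' x).
Proof.
move=> /weak_dxP[sf sh H] /weak_dxP[sf' sh' H']; apply/weak_dxP; split.
- exact: sqiD.
- exact: sqiD.
move=> phi tp; have sd := tst_sqi (tst_derivn j tp); have sp := tst_sqi tp.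
under Rint_ext => x _ do rewrite mulrDl.
under [in RHS]Rint_ext => x _ do rewrite mulrDl.
rewrite (RintegralD mD (sqi_mul mD sf sd) (sqi_mul mD sf' sd)).
rewrite (RintegralD mD (sqi_mul mD sh sp) (sqi_mul mD sh' sp)).
by rewrite H// H'// mulrDr.
Qed.

Lemma weak_dxZ j c f h : weak_dx L j f h ->
  weak_dx L j (fun x => c * f x) (fun x => c * h x).
Proof.
move=> /weak_dxP[sf sh H]; apply/weak_dxP; split.
- exact: sqiZ.
- exact: sqiZ.
move=> phi tp; have sd := tst_sqi (tst_derivn j tp); have sp := tst_sqi tp.
under Rint_ext => x _ do rewrite -mulrA.
under [in RHS]Rint_ext => x _ do rewrite -mulrA.
rewrite (RintegralZl c mD (sqi_mul mD sf sd)) (RintegralZl c mD (sqi_mul mD sh sp)).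
by rewrite H// mulrCA.
Qed.

Lemma weak_dx0 f : sqi mu D f -> weak_dx L 0 f f.
Proof. by move=> sf; apply/weak_dxP; split => // phi tp; rewrite expr0 mul1r. Qed.

Lemma derive1nD i j phi : derive1n (i + j) phi = derive1n i (derive1n j phi).
Proof. by rewrite /derive1n iterD. Qed.

Lemma weak_dx_comp i j f h h' : weak_dx L i f h -> weak_dx L j h h' ->
  weak_dx L (i + j) f h'.
Proof.
move=> /weak_dxP[sf sh H] /weak_dxP[_ sh' H']; apply/weak_dxP; split => // phi tp.
rewrite derive1nD H; last exact: tst_derivn.
by rewrite H'// exprD mulrA.
Qed.

Lemma weak1_cst c : weak_dx L 1 (fun=> c) (fun=> 0).
Proof.
apply/weak1P; split; [exact: sqi_cst|exact: sqi_cst|move=> phi tp].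
have H0 : forall x : R, 0 + prim 0 L (fun=> 0) x = 0 :> R.
  move=> x; rewrite add0r /prim (@Rint_ext _ _ _ _ _ _ (cst 0)) ?Rintegral_cst ?mul0r//.
  by move=> t _; rewrite mul0r.
rewrite -(@prim_weak _ 0 L c (fun=> 0) phi) //; last exact: sqi_cst.
by apply: Rint_ext => x _; congr (_ * _); rewrite -[LHS]addr0; congr (_ + _); rewrite -[RHS]add0r H0.
Qed.

Lemma int1_itv : \int[mu]_(x in D) (1 : R) = L.
Proof. by rewrite Rintegral_cst ?mul1r ?mu_itvE ?subr0// ltW. Qed.

(** The continuous representative of f when h is its weak derivative.  Its
    constant is the mean of f - prim h, so that it is linear and bounded as a
    function of the pair (f, h) in L_2 x L_2. *)
Definition acrep f h x := L^-1 * \int[mu]_(y in D) (f y - prim 0 L h y) + prim 0 L h x.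

Lemma prim0_sqi h : sqi mu D h -> sqi mu D (prim 0 L h).
Proof. by move=> sh; apply: sqi_cont; exact: prim_cont. Qed.

Lemma acrep_cont f h : sqi mu D h -> continuous (acrep f h).
Proof. exact: contv. Qed.

Lemma acrepP f h : weak_dx L 1 f h ->
  {ae mu, forall x, x \in `]0, L[ -> f x = acrep f h x}.
Proof.
move=> /weak1P[sf sh H]; have [c Hc] := weak_char L0 sf sh H.
suff -> : acrep f h = (fun x => c + prim 0 L h x) by [].
apply/funext => x; congr (_ + _).
rewrite (@ae_Rint _ _ _ _ _ mD _ (fun=> c)).
- by rewrite Rintegral_cst// mu_itvE ?subr0 ?(ltW L0)// mulrCA mulVf ?mulr1// gt_eqF.
- by have [] := sqiB mD sf (prim0_sqi sh).
- exact: measurable_cst.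
- by apply: ae_mu Hc => y + Dy => ->//; rewrite addrK.
Qed.

Lemma acrepB f1 h1 f2 h2 x : sqi mu D f1 -> sqi mu D h1 -> sqi mu D f2 -> sqi mu D h2 ->
  acrep (fun x => f1 x - f2 x) (fun x => h1 x - h2 x) x = acrep f1 h1 x - acrep f2 h2 x.
Proof.
move=> sf1 sh1 sf2 sh2; rewrite /acrep primB; try exact: sqi_itg.
have i1 := sqi_itg (sqiB mD sf1 (prim0_sqi sh1)).
have i2 := sqi_itg (sqiB mD sf2 (prim0_sqi sh2)).
have -> : \int[mu]_(y in D) (f1 y - f2 y - prim 0 L (fun x => h1 x - h2 x) y) =
   \int[mu]_(y in D) (f1 y - prim 0 L h1 y) - \int[mu]_(y in D) (f2 y - prim 0 L h2 y).
  rewrite -RintegralB//; apply: Rint_ext => y _; rewrite primB; try exact: sqi_itg.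
  by ring.
by rewrite mulrBr opprD addrACA.
Qed.

Definition acrep_const : R := 4 / L + 6 * L.

(** The embedding of H^1(0, L) into bounded continuous functions. *)
Lemma acrep_bound f h x : sqi mu D f -> sqi mu D h ->
  acrep f h x ^+ 2 <= acrep_const * (nsq mu D f + nsq mu D h).
Proof.
move=> sf sh; have sp := prim0_sqi sh; have sB := sqiB mD sf sp.
have p2 y : prim 0 L h y ^+ 2 <= L * nsq mu D h.
  by have := prim_sqr_le y (ltW L0) sh; rewrite subr0.
have np : nsq mu D (prim 0 L h) <= L * (L * nsq mu D h).
  have -> : L * (L * nsq mu D h) = \int[mu]_(y in D) (L * nsq mu D h).
    by rewrite Rintegral_cst// mu_itvE ?subr0 ?(ltW L0)// mulrC.
  apply: le_Rintegral => //; first by have [] := sp.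
  exact: itg_cst.
have nB : nsq mu D (fun y => f y - prim 0 L h y) <= 2 * nsq mu D f + 2 * nsq mu D (prim 0 L h).
  by have := nsqD mD sf (sqiN mD sp); rewrite nsqN.
have cs := cauchy_schwarz mD sB (sqi_cst 0 L 1).
have n1 : nsq mu D (fun=> 1) = L.
  by rewrite -[RHS]int1_itv; apply: Rint_ext => y _; rewrite expr1n.
have e1 : \int[mu]_(y in D) ((f y - prim 0 L h y) * 1) = \int[mu]_(y in D) (f y - prim 0 L h y).
  by apply: Rint_ext => y _; rewrite mulr1.
rewrite n1 e1 in cs; rewrite /acrep.
set I := Rintegral _ _ _ in cs *; set p := prim 0 L h x; set F := nsq mu D f in nB *.
set H := nsq mu D h in p2 np *; set P := nsq mu D (prim 0 L h) in np nB.
set B := nsq mu D _ in nB cs.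
have F0 : 0 <= F by exact: nsq_ge0.
have H0 : 0 <= H by exact: nsq_ge0.
have h1 : (L^-1 * I + p) ^+ 2 <= 2 * (L^-1 * I) ^+ 2 + 2 * p ^+ 2.
  by have := sqr_ge0 (L^-1 * I - p); nra.
have h2 : (L^-1 * I) ^+ 2 <= L^-1 * B.
  rewrite exprMn expr2 -mulrA ler_wpM2l ?invr_ge0 ?(ltW L0)//.
  by rewrite ler_pdivrMl// mulrC.
have h3 : L^-1 * B <= L^-1 * (2 * F + 2 * (L * (L * H))).
  by rewrite ler_wpM2l ?invr_ge0 ?(ltW L0)//; lra.
have h4 : L^-1 * (2 * F + 2 * (L * (L * H))) = 2 / L * F + 2 * L * H.
  by field; rewrite gt_eqF.
have h5 := p2 x; rewrite -/p in h5.
have h6 : 0 <= 6 * L * F by rewrite !mulr_ge0// ltW.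
have h7 : 0 <= 4 / L * H by rewrite mulr_ge0// divr_ge0// ltW.
rewrite /acrep_const; have -> : (4 / L + 6 * L) * (F + H) =
   2 * (2 / L * F + 2 * L * H) + 2 * (L * H) + (6 * L * F + 4 / L * H) by ring.
lra.
Qed.

Lemma weak1_comp f h (G G' : R -> R) : weak_dx L 1 f h ->
  (forall y, is_derive y (1 : R) G (G' y)) -> continuous G' ->
  weak_dx L 1 (fun x => G (acrep f h x)) (fun x => G' (acrep f h x) * h x).
Proof.
move=> /weak1P[sf sh _] dG cG'; have ca := @acrep_cont f h sh.
have cG : continuous G by move=> y; apply: derivable_cont; have [] := dG y.
apply/weak1P; split.
- by apply: sqi_cont => x; apply: continuous_comp; [exact: ca|exact: cG].
- apply: (@sqi_cmul _ 0 L (fun x => G' (acrep f h x))) => // x.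
  by apply: continuous_comp; [exact: ca|exact: cG'].
- by move=> phi tp; exact: chain_prim.
Qed.

(** Polarization of the chain rule for y |-> y ^+ 2. *)
Lemma weak1_mul f h f' h' : weak_dx L 1 f h -> weak_dx L 1 f' h' ->
  weak_dx L 1 (fun x => acrep f h x * acrep f' h' x)
    (fun x => acrep f h x * h' x + acrep f' h' x * h x).
Proof.
move=> w w'; have [sf sh _] := (weak1P f h).1 w; have [sf' sh' _] := (weak1P f' h').1 w'.
have wB : weak_dx L 1 (fun x => f x - f' x) (fun x => h x - h' x).
  by have := weak_dxD w (weak_dxZ (-1) w'); congr weak_dx; apply/funext => x; rewrite mulN1r.
have dsq (y : R) : is_derive y (1 : R) (fun y => y ^+ 2) (2 * y).
  by apply: (isd_eq (isdM (isd_id y) (isd_id y))); rewrite mulr1 mulr_natl.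
have csq : continuous (fun y : R => 2 * y) by move=> y; apply: cvgMr; exact: cvg_id.
have sq k k' (wk : weak_dx L 1 k k') := weak1_comp wk dsq csq.
have E := weak_dxZ 2^-1 (weak_dxD (weak_dxD (sq _ _ w) (sq _ _ w')) (weak_dxZ (-1) (sq _ _ wB))).
apply: (weak_dx_ext _ _ _ _ E).
- by apply: sqi_cont => x; apply: cvgM; exact: acrep_cont.
- by apply: sqiD => //; apply: sqi_cmul => //; exact: acrep_cont.
- by apply: aeW => x _; rewrite acrepB//; field.
- by apply: aeW => x _; rewrite acrepB//; field.
Qed.

End weak_derivative.

(** * Curves in L_2 and curves of continuous functions *)

Section curves.
Context {R : realType}.
Local Notation mu := (@lebesgue_measure R).
Implicit Types (f g h phi : R -> R) (x y s t : R) (V Z : R -> R -> R).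
Variables T L : R.
Hypothesis (T0 : 0 < T) (L0 : 0 < L).
Local Notation D := (`]0, L[%classic : set (measurableTypeR R)).
Local Notation mD := (meas_oo 0 L).
Local Notation W t := (within `[0, T]%classic (nbhs (t : R))).

Lemma near_within_cc (P : R -> Prop) t : (forall s, s \in `[0, T] -> P s) ->
  \forall s \near W t, P s.
Proof. by move=> h; rewrite near_withinE; apply: nearW => s; exact: h. Qed.

Lemma sq_squeeze {I} {F : set_system I} {FF : Filter F} (x y : I -> R) K :
  (\forall s \near F, x s ^+ 2 <= K * y s) -> y s @[s --> F] --> 0 ->
  x s @[s --> F] --> 0.
Proof.
move=> xy y0; apply/cvgr0Pnorm_le => e e0.
have K1 : 0 < `|K| + 1 by rewrite ltr_wpDl.
have d0 : 0 < e ^+ 2 / (`|K| + 1) by rewrite divr_gt0// exprn_gt0.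
move/cvgr0Pnorm_le : y0 => /(_ _ d0); apply: filterS2 xy => s xs ys.
rewrite -ler_sqr ?nnegrE ?(ltW e0)// real_normK ?num_real//.
apply: (le_trans xs); apply: (@le_trans _ _ (`|K| * `|y s|)).
  by rewrite -normrM ler_norm.
move: ys; rewrite ler_pdivlMr// => /(le_trans _); apply.
by rewrite mulrC ler_wpM2l// lerDl.
Qed.

Lemma cvg0Z {I} {F : set_system I} {FF : Filter F} (x : I -> R) K :
  x s @[s --> F] --> 0 -> K * x s @[s --> F] --> 0.
Proof. by move=> x0; rewrite -[X in _ --> X](mulr0 K); exact: cvgMr. Qed.

(** Limits within [0, T], as in the definition of L2_continuous. *)
Definition scont (e : R -> R) := forall t, t \in `[0, T] -> e s @[s --> W t] --> e t.

Lemma scont_bounded e : scont e -> exists2 M, 0 <= M & forall t, t \in `[0, T] -> `|e t| <= M.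
Proof.
move=> he; have cn : {within `[0, T], continuous (fun t => `|e t|)}.
  by apply/subspace_continuousP => t /he ?; exact: cvg_norm.
have [m _ Hm] := EVT_max (ltW T0) cn.
by exists `|e m|.
Qed.

Lemma L2cP V : L2_continuous T L V <-> forall t, t \in `[0, T] ->
  sqi mu D (V t) /\ nsq mu D (fun x => V s x - V t x) @[s --> W t] --> 0.
Proof.
have key : (forall t, t \in `[0, T] -> sqi mu D (V t)) -> forall t, t \in `[0, T] ->
    \forall s \near W t, sqi mu D (fun x => V s x - V t x).
  by move=> sV t tT; apply: near_within_cc => s sT; apply: sqiB => //; exact: sV.
split=> H.
- have sV t : t \in `[0, T] -> sqi mu D (V t) by move=> /H[/L2IP].
  move=> t tT; split; first exact: sV.
  by apply/(norm2_cvg0 mD (key sV t tT)); exact: (H t tT).2.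
- have sV t : t \in `[0, T] -> sqi mu D (V t) by move=> /H[].
  move=> t tT; split; first exact/L2IP/sV.
  by apply/(norm2_cvg0 mD (key sV t tT)); exact: (H t tT).2.
Qed.

Lemma L2c_sqi V t : L2_continuous T L V -> t \in `[0, T] -> sqi mu D (V t).
Proof. by move=> /L2cP H /H[]. Qed.

Lemma pairing_scont V p : L2_continuous T L V -> sqi mu D p ->
  scont (fun t => \int[mu]_(x in D) (V t x * p x)).
Proof.
move=> cV sp t tT; have [sV V0] := (L2cP V).1 cV t tT.
apply/subr_cvg0.
have H : \forall s \near W t, (\int[mu]_(x in D) (V s x * p x) - \int[mu]_(x in D) (V t x * p x)) ^+ 2
   <= nsq mu D p * nsq mu D (fun x => V s x - V t x).
  apply: near_within_cc => s sT; have sVs := L2c_sqi cV sT.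
  rewrite -(RintegralB mD (sqi_mul mD sVs sp) (sqi_mul mD sV sp)).
  under eq_Rintegral => x _ do rewrite -mulrBl.
  rewrite mulrC; apply: cauchy_schwarz => //; exact: sqiB.
exact: (sq_squeeze H V0).
Qed.

Lemma nsq_expand f g : sqi mu D f -> sqi mu D g ->
  nsq mu D f = nsq mu D (fun x => f x - g x) +
    2 * \int[mu]_(x in D) ((f x - g x) * g x) + nsq mu D g.
Proof.
move=> sf sg; have sB := sqiB mD sf sg.
have i1 : itg mu D (fun x => (f x - g x) ^+ 2) by case: sB.
have i2 := sqi_mul mD sB sg.
have i3 : itg mu D (fun x => g x ^+ 2) by case: sg.
rewrite /nsq -(RintegralZl 2 mD i2) -(RintegralD mD i1 (itgZ mD 2 i2)).
rewrite -(RintegralD mD (itgD mD i1 (itgZ mD 2 i2)) i3).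
by apply: Rint_ext => x _; ring.
Qed.

(** Expand the square of V s = (V s - V t) + V t. *)
Lemma nsq_scont V : L2_continuous T L V -> scont (fun t => nsq mu D (V t)).
Proof.
move=> cV t tT; have [sV V0] := (L2cP V).1 cV t tT.
have H : \forall s \near W t, (\int[mu]_(x in D) ((V s x - V t x) * V t x)) ^+ 2
   <= nsq mu D (V t) * nsq mu D (fun x => V s x - V t x).
  apply: near_within_cc => s sT; have sVs := L2c_sqi cV sT.
  by rewrite mulrC; apply: cauchy_schwarz => //; exact: sqiB.
have h2 : \int[mu]_(x in D) ((V s x - V t x) * V t x) @[s --> W t] --> 0.
  exact: sq_squeeze H V0.
have h3 : nsq mu D (fun x => V s x - V t x) +
    2 * \int[mu]_(x in D) ((V s x - V t x) * V t x) + nsq mu D (V t) @[s --> W t] -->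
    0 + 0 + nsq mu D (V t).
  by apply: cvgD; [apply: cvgD => //; exact: cvg0Z|exact: cvg_cst].
rewrite !add0r in h3; apply: cvg_trans h3; apply: near_eq_cvg.
by apply: near_within_cc => s sT; rewrite -nsq_expand//; exact: L2c_sqi.
Qed.

Lemma L2c_bounded V : L2_continuous T L V ->
  exists2 M, 0 <= M & forall t, t \in `[0, T] -> nsq mu D (V t) <= M.
Proof.
move=> /nsq_scont/scont_bounded[M M0 HM]; exists M => // t /HM.
exact: le_trans (ler_norm _).
Qed.

Lemma nsq_cvg0D {I} {F : set_system I} {FF : Filter F} (f_ g_ : I -> R -> R) :
  (\forall i \near F, sqi mu D (f_ i)) -> (\forall i \near F, sqi mu D (g_ i)) ->
  nsq mu D (f_ i) @[i --> F] --> 0 -> nsq mu D (g_ i) @[i --> F] --> 0 ->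
  nsq mu D (fun x => f_ i x + g_ i x) @[i --> F] --> 0.
Proof.
move=> sf sg f0 g0.
have h : 2 * nsq mu D (f_ i) + 2 * nsq mu D (g_ i) @[i --> F] --> 0.
  by rewrite -[X in _ --> X](addr0 0); apply: cvgD; exact: cvg0Z.
apply: (@squeeze_cvgr _ _ _ _ (fun=> 0) _ _ _ _ (cvg_cst _) h).
apply: filterS2 sf sg => i sf sg; rewrite nsq_ge0/=; exact: nsqD.
Qed.

Lemma L2cD V Z : L2_continuous T L V -> L2_continuous T L Z ->
  L2_continuous T L (fun t x => V t x + Z t x).
Proof.
move=> cV cZ; apply/L2cP => t tT; have [sV V0] := (L2cP V).1 cV t tT.
have [sZ Z0] := (L2cP Z).1 cZ t tT; split; first exact: sqiD.
have := @nsq_cvg0D _ (W t) _ (fun s x => V s x - V t x) (fun s x => Z s x - Z t x) _ _ V0 Z0.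
rewrite (_ : (fun s => nsq mu D (fun x => V s x - V t x + (Z s x - Z t x))) =
  (fun s => nsq mu D (fun x => V s x + Z s x - (V t x + Z t x)))); last first.
  by apply/funext => s; apply: nsq_ext => x _; ring.
apply.
- by apply: near_within_cc => s sT; apply: sqiB => //; exact: L2c_sqi.
- by apply: near_within_cc => s sT; apply: sqiB => //; exact: L2c_sqi.
Qed.

Lemma L2cZ c V : L2_continuous T L V -> L2_continuous T L (fun t x => c * V t x).
Proof.
move=> cV; apply/L2cP => t tT; have [sV V0] := (L2cP V).1 cV t tT.
split; first exact: sqiZ.
have h : c ^+ 2 * nsq mu D (fun x => V s x - V t x) @[s --> W t] --> 0.
  exact: cvg0Z.
apply: cvg_trans h; apply: near_eq_cvg; apply: near_within_cc => s sT.
rewrite -nsqZ//; last by apply: sqiB => //; exact: L2c_sqi.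
by apply: nsq_ext => x _; ring.
Qed.

Lemma L2c_cst e : scont e -> L2_continuous T L (fun t x => e t).
Proof.
move=> ce; apply/L2cP => t tT; split; first exact: sqi_cst.
have h1 : (e s - e t) @[s --> W t] --> 0 by apply/subr_cvg0; exact: ce.
have h2 : (e s - e t) * (e s - e t) * L @[s --> W t] --> 0 * 0 * L.
  by apply: cvgMl; exact: cvgM.
rewrite !mul0r in h2; apply: cvg_trans h2; apply: near_eq_cvg; apply: nearW => s.
by rewrite /nsq Rintegral_cst// mu_itvE ?(ltW L0)// subr0 expr2.
Qed.

Lemma L2c_ae V Z : (forall t, t \in `[0, T] -> sqi mu D (Z t)) ->
  (forall t, t \in `[0, T] -> {ae mu, forall x, x \in `]0, L[ -> V t x = Z t x}) ->
  L2_continuous T L V -> L2_continuous T L Z.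
Proof.
move=> sZ VZ cV; apply/L2cP => t tT; have [sV V0] := (L2cP V).1 cV t tT.
split; first exact: sZ.
apply: cvg_trans V0; apply: near_eq_cvg; apply: near_within_cc => s sT.
have [m1 _] := sqiB mD (L2c_sqi cV sT) sV.
have [m2 _] := sqiB mD (sZ _ sT) (sZ _ tT).
apply: (nsq_ae mD) => //.
by apply: ae_mu2 (VZ _ sT) (VZ _ tT) => x h1 h2 xD; rewrite h1// h2.
Qed.

(** Continuous curves in the space of bounded continuous functions with the
    supremum norm.  The values are functions on the whole line, as primitives
    and continuous representatives are. *)
Definition Ccurve Z :=
  [/\ exists M, forall t x, t \in `[0, T] -> `|Z t x| <= M,
      forall t, t \in `[0, T] -> continuous (Z t) &
      forall t e, t \in `[0, T] -> 0 < e ->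
        \forall s \near W t, forall x, `|Z s x - Z t x| <= e].

Lemma Ccurve_pos Z : Ccurve Z ->
  exists2 M, 0 <= M & forall t x, t \in `[0, T] -> `|Z t x| <= M.
Proof.
move=> [[M HM] _ _]; exists M => //; apply: le_trans (HM 0 0 _) => //.
by rewrite in_itv/= lexx ltW.
Qed.

Lemma CcurveD Y Z : Ccurve Y -> Ccurve Z -> Ccurve (fun t x => Y t x + Z t x).
Proof.
move=> [[M HM] cY uY] [[N HN] cZ uZ]; split.
- exists (M + N) => t x tT; rewrite (le_trans (ler_normD _ _))// lerD//; [exact: HM|exact: HN].
- by move=> t tT x; apply: cvgD; [exact: cY|exact: cZ].
- move=> t e tT e0; have e20 : 0 < e / 2 by rewrite divr_gt0.
  apply: filterS2 (uY _ _ tT e20) (uZ _ _ tT e20) => s h1 h2 x.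
  rewrite opprD addrACA (le_trans (ler_normD _ _))// (splitr e) lerD//.
Qed.

Lemma CcurveM Y Z : Ccurve Y -> Ccurve Z -> Ccurve (fun t x => Y t x * Z t x).
Proof.
move=> hY hZ; have [M M0 HM] := Ccurve_pos hY; have [N N0 HN] := Ccurve_pos hZ.
move: hY hZ => [_ cY uY] [_ cZ uZ]; split.
- exists (M * N) => t x tT; rewrite normrM ler_pM//; [exact: HM|exact: HN].
- by move=> t tT x; apply: cvgM; [exact: cY|exact: cZ].
- move=> t e tT e0.
  have d0 : 0 < e / (M + N + 1) by rewrite divr_gt0// ltr_wpDl// addr_ge0.
  have wT : \forall s \near W t, s \in `[0, T] by exact: near_within_cc.
  apply: filterS3 wT (uY _ _ tT d0) (uZ _ _ tT d0) => s sT hY hZ x.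
  have -> : Y s x * Z s x - Y t x * Z t x = Y s x * (Z s x - Z t x) + (Y s x - Y t x) * Z t x by ring.
  apply: (@le_trans _ _ (M * (e / (M + N + 1)) + (e / (M + N + 1)) * N)).
    rewrite (le_trans (ler_normD _ _))// !normrM lerD// ler_pM//; [exact: HM|exact: HN].
  have -> : M * (e / (M + N + 1)) + (e / (M + N + 1)) * N = e * ((M + N) / (M + N + 1)) by ring.
  by rewrite ger_pMr// ler_pdivrMr ?mul1r ?lerDl// ltr_wpDl// addr_ge0.
Qed.

Lemma Ccurve_cst c : Ccurve (fun _ _ => c).
Proof.
split; [by exists (`|c|)|by move=> t _ x; exact: cvg_cst|].
by move=> t e _ e0; apply: nearW => s x; rewrite subrr normr0 ltW.
Qed.

(** Uniform continuity near a compact interval; z itself may leave the ball. *)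
Lemma unif_cont_ball g M e : continuous g -> 0 < e ->
  exists2 d, 0 < d & forall y z, `|y| <= M -> `|z - y| <= d -> `|g z - g y| <= e.
Proof.
move=> cg e0.
have H : forall y, `[- M, M]%classic y -> \forall y' \near y & d \near (0 : R)^'+,
    forall z, `|z - y'| <= d -> `|g z - g y'| <= e.
  move=> y _; have e20 : 0 < e / 2 by rewrite divr_gt0.
  move/cvgrPdist_le : (cg y) => /(_ _ e20)[d /= d0 Hd].
  have d20 : 0 < d / 2 by rewrite divr_gt0.
  near=> y' r => z zy'.
  have yy' : `|y - y'| < d / 2 by near: y'; exact: (@cvgr_dist_lt _ _ _ _ _ (fun y => y)).
  have rd : r < d / 2 by near: r; exact: nbhs_right_lt.
  have h1 : `|g y - g y'| <= e / 2.
    by apply: Hd => /=; apply: (lt_trans yy'); rewrite ltr_pdivrMr// ltr_pMr// ltr1n.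
  have h2 : `|g y - g z| <= e / 2.
    apply: Hd => /=; have -> : y - z = (y - y') - (z - y') by ring.
    rewrite (le_lt_trans (ler_normB _ _))// (splitr d) ltrD//.
    exact: le_lt_trans zy' rd.
  have -> : g z - g y' = (g y - g y') - (g y - g z) by ring.
  by rewrite (le_trans (ler_normB _ _))// (splitr e) lerD.
have := (compact_near_coveringP _).1 (@segment_compact R (- M) M) R (0 : R)^'+
  (fun d y => forall z, `|z - y| <= d -> `|g z - g y| <= e) _ H.
move=> {}H; near (0 : R)^'+ => d; exists d => // y z yM zy.
have : `[- M, M]%classic `<=` (fun y => forall z, `|z - y| <= d -> `|g z - g y| <= e).
  by near: d; exact: H.
by apply => //=; rewrite in_itv/= -ler_norml.
Unshelve. all: by end_near. Qed.

Lemma Ccurve_comp g Z : continuous g -> Ccurve Z -> Ccurve (fun t x => g (Z t x)).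
Proof.
move=> cg hZ; have [M M0 HM] := Ccurve_pos hZ; move: hZ => [_ cZ uZ]; split.
- have [B _ HB] := cont_bounded_ball M cg.
  by exists B => t x tT; apply: HB; exact: HM.
- by move=> t tT x; apply: continuous_comp; [exact: cZ|exact: cg].
- move=> t e tT e0; have [d d0 Hd] := unif_cont_ball M cg e0.
  apply: filterS (uZ _ _ tT d0) => s hs x.
  by apply: Hd; [exact: HM|exact: hs].
Qed.

Lemma Ccurve_sqi Z t : Ccurve Z -> t \in `[0, T] -> sqi mu D (Z t).
Proof. by move=> [_ cZ _] tT; apply: sqi_cont; exact: cZ. Qed.

(** Split Z s V s - Z t V t into Z s (V s - V t), where Z is bounded, and
    (Z s - Z t) V t, where Z is small in the supremum norm. *)
Lemma L2c_mul Z V : Ccurve Z -> L2_continuous T L V ->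
  L2_continuous T L (fun t x => Z t x * V t x).
Proof.
move=> hZ cV; have [M M0 HM] := Ccurve_pos hZ.
have sZV t s : t \in `[0, T] -> s \in `[0, T] -> sqi mu D (fun x => Z t x * V s x).
  move=> tT sT; apply: (@sqi_bnd _ _ _ _ _ mD M).
  - by have [] := Ccurve_sqi hZ tT.
  - by apply: aeW => x _; exact: HM.
  - exact: L2c_sqi cV sT.
apply/L2cP => t tT; have [sV V0] := (L2cP V).1 cV t tT.
split; first exact: sZV.
have := @nsq_cvg0D _ (W t) _ (fun s x => Z s x * (V s x - V t x)) (fun s x => (Z s x - Z t x) * V t x).
rewrite (_ : (fun s => nsq mu D (fun x => Z s x * (V s x - V t x) + (Z s x - Z t x) * V t x)) =
  (fun s => nsq mu D (fun x => Z s x * V s x - Z t x * V t x))); last first.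
  by apply/funext => s; apply: nsq_ext => x _; ring.
apply.
- apply: near_within_cc => s sT; have := sqiB mD (sZV s s sT sT) (sZV s t sT tT).
  by apply: (sqi_ext mD) => x _; rewrite mulrBr.
- apply: near_within_cc => s sT; have := sqiB mD (sZV s t sT tT) (sZV t t tT tT).
  by apply: (sqi_ext mD) => x _; rewrite mulrBl.
- have h1 : M ^+ 2 * nsq mu D (fun x => V s x - V t x) @[s --> W t] --> 0.
    exact: cvg0Z.
  apply: (@squeeze_cvgr _ _ _ _ (fun=> 0) _ _ _ _ (cvg_cst _) h1).
  apply: near_within_cc => s sT; rewrite nsq_ge0/=; apply: nsq_bnd.
  + exact: mD.
  + by have [] := Ccurve_sqi hZ sT.
  + by apply: aeW => x _; exact: HM.
  + by apply: sqiB => //; exact: L2c_sqi cV sT.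
- apply/cvgr0Pnorm_le => e e0.
  have N0 := nsq_ge0 mu D (V t).
  pose d := Num.sqrt (e / (nsq mu D (V t) + 1)).
  have q0 : 0 < e / (nsq mu D (V t) + 1) by rewrite divr_gt0// ltr_wpDl.
  have d0 : 0 < d by rewrite sqrtr_gt0.
  have [_ _ uZ] := hZ.
  have wT : \forall s \near W t, s \in `[0, T] by exact: near_within_cc.
  apply: filterS2 wT (uZ _ _ tT d0) => s sT hs.
  rewrite ger0_norm ?nsq_ge0//; apply: (@le_trans _ _ (d ^+ 2 * nsq mu D (V t))).
    have mB : measurable_fun D (fun x => Z s x - Z t x).
      by have [] := sqiB mD (Ccurve_sqi hZ sT) (Ccurve_sqi hZ tT).
    by apply: (nsq_bnd mD mB (aeW _ _) sV) => x _; exact: hs.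
  rewrite sqr_sqrtr ?(ltW q0)// mulrAC ler_pdivrMr ?ltr_wpDl//.
  by rewrite ler_wpM2l ?(ltW e0)// lerDl.
Qed.

Lemma Ccurve_L2c Z : Ccurve Z -> L2_continuous T L Z.
Proof.
move=> hZ; have h1 : scont (fun=> 1) by move=> t _; exact: cvg_cst.
have := L2c_mul hZ (L2c_cst h1); congr L2_continuous.
by apply/funext => t; apply/funext => x; rewrite mulr1.
Qed.

Lemma Ccurve_acrep V V' : L2_continuous T L V -> L2_continuous T L V' ->
  Ccurve (fun t => acrep L (V t) (V' t)).
Proof.
move=> cV cV'; have [M M0 HM] := L2c_bounded cV; have [N N0 HN] := L2c_bounded cV'.
have K0 : 0 <= acrep_const L.
  by rewrite /acrep_const addr_ge0 ?divr_ge0 ?mulr_ge0// ltW.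
split.
- exists (Num.sqrt (acrep_const L * (M + N))) => t x tT.
  rewrite -ler_sqr ?nnegrE ?sqrtr_ge0// real_normK ?num_real// sqr_sqrtr; last first.
    by rewrite mulr_ge0 // addr_ge0.
  rewrite (le_trans (acrep_bound L0 x (L2c_sqi cV tT) (L2c_sqi cV' tT)))//.
  by rewrite ler_wpM2l// lerD// ?HM// HN.
- by move=> t tT; apply: acrep_cont => //; exact: L2c_sqi cV' tT.
- move=> t e tT e0; have [sV V0] := (L2cP V).1 cV t tT.
  have [sV' V'0] := (L2cP V').1 cV' t tT.
  have q0 : 0 < e ^+ 2 / (acrep_const L + 1) by rewrite divr_gt0 ?exprn_gt0// ltr_wpDl.
  have h : nsq mu D (fun x => V s x - V t x) + nsq mu D (fun x => V' s x - V' t x) @[s --> W t] --> 0.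
    by rewrite -[X in _ --> X](addr0 0); exact: cvgD.
  have wT : \forall s \near W t, s \in `[0, T] by exact: near_within_cc.
  move/cvgr0Pnorm_le : h => /(_ _ q0); apply: filterS2 wT => s sT hs x.
  have sVs := L2c_sqi cV sT; have sV's := L2c_sqi cV' sT.
  rewrite -acrepB//.
  rewrite -ler_sqr ?nnegrE ?(ltW e0)// real_normK ?num_real//.
  rewrite (le_trans (acrep_bound L0 x (sqiB mD sVs sV) (sqiB mD sV's sV')))//.
  rewrite ger0_norm in hs; last by rewrite addr_ge0// nsq_ge0.
  move: hs; rewrite ler_pdivlMr ?ltr_wpDl// => /(le_trans _); apply.
  by rewrite mulrC ler_wpM2l ?addr_ge0 ?nsq_ge0// lerDl.
Qed.

End curves.

(** * Curves in H^s and the nonlinear terms *)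

Section regularity_classes.
Context {R : realType}.
Local Notation mu := (@lebesgue_measure R).
Implicit Types (f g h phi : R -> R) (x y t : R) (V Z : R -> R -> R).
Variables T L : R.
Hypothesis (T0 : 0 < T) (L0 : 0 < L).
Local Notation D := (`]0, L[%classic : set (measurableTypeR R)).
Local Notation mD := (meas_oo 0 L).

(** The curves in C([0, T]; H^s), unfolded one derivative at a time so that
    closure properties follow by induction on s. *)
Fixpoint CH (s : nat) V : Prop :=
  L2_continuous T L V /\
  if s is s'.+1 then
    exists V', (forall t, t \in `[0, T] -> weak_dx L 1 (V t) (V' t)) /\ CH s' V'
  else True.

Lemma CH_L2c s V : CH s V -> L2_continuous T L V.
Proof. by case: s => [|s] []. Qed.

Lemma CHS s V : CH s.+1 V -> CH s V.
Proof.
elim: s V => [|s IH] V [cV [V' [wV hV]]]; first by split.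
by split => //; exists V'; split => //; exact: IH.
Qed.

Lemma CH_le s s' V : (s' <= s)%N -> CH s V -> CH s' V.
Proof.
elim: s => [|s IH]; first by rewrite leqn0 => /eqP ->.
by rewrite leq_eqVlt ltnS => /predU1P[->//|ss] /CHS; exact: IH.
Qed.

Definition ae_curve V Z := forall t, t \in `[0, T] ->
  {ae mu, forall x, x \in `]0, L[ -> V t x = Z t x}.

Lemma ae_curve_refl V : ae_curve V V.
Proof. by move=> t _; exact: aeW. Qed.

Lemma CH_ae s V Z : (forall t, t \in `[0, T] -> sqi mu D (Z t)) -> ae_curve V Z ->
  CH s V -> CH s Z.
Proof.
move=> sZ VZ; case: s => [|s] [cV].
  by move=> _; split => //; exact: (L2c_ae sZ VZ cV).
move=> [V' [wV hV]]; split; first exact: (L2c_ae sZ VZ cV).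
exists V'; split => // t tT; apply: (weak_dx_ext _ _ _ _ (wV t tT)).
- exact: sZ.
- exact: L2c_sqi (CH_L2c hV) tT.
- exact: VZ.
- exact: aeW.
Qed.

Lemma CHD s V Z : CH s V -> CH s Z -> CH s (fun t x => V t x + Z t x).
Proof.
elim: s V Z => [|s IH] V Z [cV] + [cZ]; first by move=> _ _; split => //; exact: L2cD.
move=> [V' [wV hV]] [Z' [wZ hZ]]; split; first exact: L2cD.
exists (fun t x => V' t x + Z' t x); split; last exact: IH.
by move=> t tT; apply: weak_dxD; [exact: wV|exact: wZ].
Qed.

Lemma CHZ s c V : CH s V -> CH s (fun t x => c * V t x).
Proof.
elim: s V => [|s IH] V [cV]; first by move=> _; split => //; exact: L2cZ.
move=> [V' [wV hV]]; split; first exact: L2cZ.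
exists (fun t x => c * V' t x); split; last exact: IH.
by move=> t tT; apply: weak_dxZ; exact: wV.
Qed.

Lemma CH_cst s (e : R -> R) : scont T e -> CH s (fun t x => e t).
Proof.
elim: s e => [|s IH] e ce; first by split => //; exact: L2c_cst.
split; first exact: L2c_cst.
exists (fun t x => 0); split; first by move=> t _; exact: weak1_cst.
by apply: (IH (fun=> 0)) => t _; exact: cvg_cst.
Qed.

Lemma CH_rep V V' : (forall t, t \in `[0, T] -> weak_dx L 1 (V t) (V' t)) ->
  ae_curve V (fun t => acrep L (V t) (V' t)).
Proof. by move=> wV t tT; apply: acrepP => //; exact: wV. Qed.

Lemma weak1_mul_rep f f' h h' fr hr : continuous fr -> continuous hr ->
  weak_dx L 1 f f' -> weak_dx L 1 h h' ->
  {ae mu, forall x, x \in `]0, L[ -> f x = fr x} ->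
  {ae mu, forall x, x \in `]0, L[ -> h x = hr x} ->
  weak_dx L 1 (fun x => fr x * hr x) (fun x => fr x * h' x + hr x * f' x).
Proof.
move=> cf ch wf wh ff hh; have [sf sf' _] := (weak1P L f f').1 wf.
have [sh sh' _] := (weak1P L h h').1 wh.
have af := acrepP L0 wf; have ah := acrepP L0 wh.
have e1 : {ae mu, forall x, x \in `]0, L[ -> acrep L f f' x = fr x}.
  by apply: ae_mu2 ff af => x h1 h2 xD; rewrite -h1// h2.
have e2 : {ae mu, forall x, x \in `]0, L[ -> acrep L h h' x = hr x}.
  by apply: ae_mu2 hh ah => x h1 h2 xD; rewrite -h1// h2.
apply: (weak_dx_ext _ _ _ _ (weak1_mul wf wh)).
- by apply: sqi_cont => x; apply: cvgM; [exact: cf|exact: ch].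
- by apply: sqiD => //; exact: sqi_cmul.
- by apply: ae_mu2 e1 e2 => x h1 h2 xD; rewrite h1// h2.
- by apply: ae_mu2 e1 e2 => x h1 h2 xD; rewrite h1// h2.
Qed.

(** H^(s+1) acts on H^s by multiplication: in the Leibniz rule both terms are
    again products of a factor in H^(s+1) by a factor in H^s. *)
Lemma CH_mul s Z V Zr : CH s.+1 Z -> CH s V -> Ccurve T Zr -> ae_curve Z Zr ->
  CH s (fun t x => Zr t x * V t x).
Proof.
elim: s Z V Zr => [|s IH] Z V Zr hZ hV cZr ZZr.
  by split => //; apply: L2c_mul => //; exact: CH_L2c hV.
have [cZ [Z' [wZ hZ']]] := hZ; have [cV [V' [wV hV']]] := hV.
split; first exact: L2c_mul.
pose Vr t := acrep L (V t) (V' t).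
have cVr : Ccurve T Vr by apply: Ccurve_acrep => //; exact: CH_L2c hV'.
have VVr : ae_curve V Vr by exact: CH_rep.
exists (fun t x => Zr t x * V' t x + Vr t x * Z' t x); split; last first.
  apply: CHD.
    by apply: IH cZr ZZr => //; exact: CHS.
  by apply: IH cVr VVr => //; exact: CHS.
move=> t tT; have [_ kZ _] := cZr; have [_ kV _] := cVr.
have w := weak1_mul_rep (kZ t tT) (kV t tT) (wZ t tT) (wV t tT) (ZZr t tT) (VVr t tT).
apply: (weak_dx_ext _ _ _ _ w).
- exact: L2c_sqi (L2c_mul T0 cZr cV) tT.
- apply: sqiD => //.
    exact: L2c_sqi (L2c_mul T0 cZr (CH_L2c hV')) tT.
  exact: L2c_sqi (L2c_mul T0 cVr hZ'.1) tT.
- by apply: ae_mu (VVr t tT) => x h xD; rewrite h.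
- exact: aeW.
Qed.

Lemma CH_alg s Z V Zr Vr : CH s.+1 Z -> CH s.+1 V ->
  Ccurve T Zr -> ae_curve Z Zr -> Ccurve T Vr -> ae_curve V Vr ->
  CH s.+1 (fun t x => Zr t x * Vr t x).
Proof.
move=> hZ hV cZr ZZr cVr VVr.
have [cZ [Z' [wZ hZ']]] := hZ; have [cV [V' [wV hV']]] := hV.
split; first by apply: Ccurve_L2c => //; exact: CcurveM.
exists (fun t x => Zr t x * V' t x + Vr t x * Z' t x); split.
  move=> t tT; have [_ kZ _] := cZr; have [_ kV _] := cVr.
  by apply: weak1_mul_rep; [exact: kZ|exact: kV|exact: wZ|exact: wV|exact: ZZr|exact: VVr].
by apply: CHD; [exact: CH_mul hZ hV' cZr ZZr|exact: CH_mul hV hZ' cVr VVr].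
Qed.

Lemma Cn_cont n g j : C_n n g -> (j <= n)%N -> continuous (derive1n j g).
Proof.
move=> [dg cg]; rewrite leq_eqVlt => /predU1P[->//|jn] x.
by apply: derivable_cont; exact: dg.
Qed.

Lemma Cn_is_derive n g j x : C_n n g -> (j < n)%N ->
  is_derive x (1 : R) (derive1n j g) (derive1n j.+1 g x).
Proof.
move=> [dg _] jn; apply: DeriveDef; first exact: dg.
by rewrite -derive1E -derive1nS.
Qed.

Lemma Cn_sub n g j m : C_n n g -> (j + m <= n)%N -> C_n m (derive1n j g).
Proof.
move=> hg jm; split.
- move=> i x im; rewrite -derive1nD addnC; case: hg => dg _; apply: dg.
  by apply: leq_trans jm; rewrite ltn_add2l.
- by rewrite -derive1nD addnC; apply: (Cn_cont hg).
Qed.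

(** The derivative is the product of the derivative of V by g'(V), which has one
    derivative less by induction and multiplies H^s. *)
Lemma CH_comp s V Vr g : C_n s.+1 g -> CH s.+1 V -> Ccurve T Vr -> ae_curve V Vr ->
  CH s.+1 (fun t x => g (Vr t x)).
Proof.
elim: s V Vr g => [|s IH] V Vr g hg hV cVr VVr.
all: have cg : continuous g by exact: (Cn_cont (j := 0) hg).
all: have cg' : continuous (derive1 g) by exact: (Cn_cont (j := 1) hg).
all: have dg y : is_derive y (1 : R) g (derive1 g y) by exact: (Cn_is_derive (j := 0) y hg).
all: have [cV [V' [wV hV']]] := hV.
all: have cG : Ccurve T (fun t x => g (Vr t x)) by exact: Ccurve_comp.
all: have cG' : Ccurve T (fun t x => derive1 g (Vr t x)) by exact: Ccurve_comp.
all: split; first exact: Ccurve_L2c.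
all: exists (fun t x => derive1 g (Vr t x) * V' t x); split.
1,3: move=> t tT; apply: (weak_dx_ext _ _ _ _ (weak1_comp (wV t tT) dg cg')).
- by have [_ k _] := cG; apply: sqi_cont => //; exact: k.
- exact: L2c_sqi (L2c_mul T0 cG' hV'.1) tT.
- by apply: ae_mu2 (VVr t tT) (acrepP L0 (wV t tT)) => x h1 h2 xD; rewrite -h1// h2.
- by apply: ae_mu2 (VVr t tT) (acrepP L0 (wV t tT)) => x h1 h2 xD; rewrite -h1// h2.
- by have [_ k _] := cG; apply: sqi_cont => //; exact: k.
- exact: L2c_sqi (L2c_mul T0 cG' hV'.1) tT.
- by apply: ae_mu2 (VVr t tT) (acrepP L0 (wV t tT)) => x h1 h2 xD; rewrite -h1// h2.
- by apply: ae_mu2 (VVr t tT) (acrepP L0 (wV t tT)) => x h1 h2 xD; rewrite -h1// h2.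
- by split => //; apply: L2c_mul => //; exact: hV'.1.
- have hg' : CH s.+1 (fun t x => derive1 g (Vr t x)).
    by apply: IH (CHS hV) cVr VVr; exact: (Cn_sub (j := 1) hg).
  have [cV' [V'' [wV' hV'']]] := hV'.
  have cr := Ccurve_acrep T0 L0 cV' (CH_L2c hV''); have er := CH_rep wV'.
  apply: CH_ae (CH_alg hg' hV' cG' (@ae_curve_refl _) cr er).
    by move=> t tT; exact: L2c_sqi (L2c_mul T0 cG' cV') tT.
  by move=> t tT; apply: ae_mu (er t tT) => x h xD; rewrite h.
Qed.

Section nonlinear_terms.
Variables (g : R -> R) (U : nat -> R -> R -> R).

Definition mono (ns : seq nat) t x :=
  derive1n (size ns) g (U 0%N t x) * \prod_(n <- ns) U n t x.

(** When U n stands for d_t^n u, this is d_t^m g(u); see is_derive_Gsum. *)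
Definition Gsum (m : nat) t x := \sum_(ns <- fd_terms m) mono ns t x.

Lemma fd_termsP m ns : ns \in fd_terms m ->
  (size ns <= m)%N /\ {in ns, forall n, (n <= m)%N}.
Proof.
elim: m ns => [|m IH] ns /=; first by rewrite inE => /eqP ->.
move=> /flattenP[l /mapP[ms /IH[sm am] ->]].
rewrite inE => /predU1P[->|/mapP[i + ->]].
  split=> [//|n]; rewrite inE => /predU1P[->//|/am]; exact: leqW.
rewrite mem_iota add0n => /= im; rewrite size_incr_nth im; split; first exact: leqW.
move=> n /(nthP 0%N)[j]; rewrite size_incr_nth im => jm <-.
rewrite nth_incr_nth; have := am _ (mem_nth 0%N jm) => h.
by case: (i == j); rewrite ?add1n ?ltnS ?add0n// leqW.
Qed.

Lemma Ccurve_prod K ns : (forall n, (n <= K)%N -> Ccurve T (U n)) ->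
  {in ns, forall n, (n <= K)%N} -> Ccurve T (fun t x => \prod_(n <- ns) U n t x).
Proof.
move=> cU; elim: ns => [|n ns IH] nK.
  rewrite (_ : (fun t x => _) = (fun _ _ => 1)); first exact: Ccurve_cst.
  by apply/funext => t; apply/funext => x; rewrite big_nil.
rewrite (_ : (fun t x => _) = (fun t x => U n t x * \prod_(n <- ns) U n t x)); last first.
  by apply/funext => t; apply/funext => x; rewrite big_cons.
apply: CcurveM => //; first by apply: cU; apply: nK; rewrite mem_head.
by apply: IH => i ins; apply: nK; rewrite inE ins orbT.
Qed.

Lemma CH_prod s K ns : (forall n, (n <= K)%N -> Ccurve T (U n) /\ CH s.+1 (U n)) ->
  {in ns, forall n, (n <= K)%N} -> CH s.+1 (fun t x => \prod_(n <- ns) U n t x).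
Proof.
move=> cU; elim: ns => [|n ns IH] nK.
  rewrite (_ : (fun t x => _) = (fun _ _ => 1)).
    by apply: (@CH_cst _ (fun=> 1)) => t _; exact: cvg_cst.
  by apply/funext => t; apply/funext => x; rewrite big_nil.
rewrite (_ : (fun t x => _) = (fun t x => U n t x * \prod_(n <- ns) U n t x)); last first.
  by apply/funext => t; apply/funext => x; rewrite big_cons.
have nK0 : (n <= K)%N by apply: nK; rewrite mem_head.
have nsK : {in ns, forall n, (n <= K)%N} by move=> i ins; apply: nK; rewrite inE ins orbT.
apply: (CH_alg (cU _ nK0).2 (IH nsK) (cU _ nK0).1 (@ae_curve_refl _) _ (@ae_curve_refl _)).
by apply: Ccurve_prod nsK => i /cU[].
Qed.

Lemma Ccurve_mono K N ns : C_n N g -> (size ns <= N)%N ->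
  (forall n, (n <= K)%N -> Ccurve T (U n)) ->
  {in ns, forall n, (n <= K)%N} -> Ccurve T (mono ns).
Proof.
move=> hg sN cU nK; apply: CcurveM => //; last exact: Ccurve_prod nK.
apply: (@Ccurve_comp _ T) => //; first exact: Cn_cont hg sN.
exact: cU.
Qed.

Lemma CH_mono s K N ns : C_n N g -> (size ns + s.+1 <= N)%N ->
  (forall n, (n <= K)%N -> Ccurve T (U n) /\ CH s.+1 (U n)) ->
  {in ns, forall n, (n <= K)%N} -> CH s.+1 (mono ns).
Proof.
move=> hg sN cU nK; have cU0 := cU 0%N (leq0n _).
have sN' : (size ns <= N)%N by apply: leq_trans sN; exact: leq_addr.
have h1 : CH s.+1 (fun t x => derive1n (size ns) g (U 0%N t x)).
  apply: (CH_comp _ cU0.2 cU0.1 (@ae_curve_refl _)).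
  exact: Cn_sub hg sN.
apply: (CH_alg h1 (CH_prod cU nK) _ (@ae_curve_refl _) _ (@ae_curve_refl _)).
  by apply: Ccurve_comp cU0.1 => //; exact: Cn_cont hg sN'.
by apply: Ccurve_prod nK => i /cU[].
Qed.

Lemma Ccurve_sum (I : eqType) (l : seq I) (F : I -> R -> R -> R) :
  {in l, forall i, Ccurve T (F i)} -> Ccurve T (fun t x => \sum_(i <- l) F i t x).
Proof.
elim: l => [|i l IH] cF.
  rewrite (_ : (fun t x => _) = (fun _ _ => 0)); first exact: Ccurve_cst.
  by apply/funext => t; apply/funext => x; rewrite big_nil.
rewrite (_ : (fun t x => _) = (fun t x => F i t x + \sum_(i <- l) F i t x)); last first.
  by apply/funext => t; apply/funext => x; rewrite big_cons.
apply: CcurveD; first by apply: cF; rewrite mem_head.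
by apply: IH => j jl; apply: cF; rewrite inE jl orbT.
Qed.

Lemma CH_sum s (I : eqType) (l : seq I) (F : I -> R -> R -> R) :
  {in l, forall i, CH s (F i)} -> CH s (fun t x => \sum_(i <- l) F i t x).
Proof.
elim: l => [|i l IH] cF.
  rewrite (_ : (fun t x => _) = (fun _ _ => 0)).
    by apply: (@CH_cst _ (fun=> 0)) => t _; exact: cvg_cst.
  by apply/funext => t; apply/funext => x; rewrite big_nil.
rewrite (_ : (fun t x => _) = (fun t x => F i t x + \sum_(i <- l) F i t x)); last first.
  by apply/funext => t; apply/funext => x; rewrite big_cons.
apply: CHD; first by apply: cF; rewrite mem_head.
by apply: IH => j jl; apply: cF; rewrite inE jl orbT.
Qed.

Lemma Ccurve_Gsum N m : C_n N g -> (m <= N)%N ->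
  (forall n, (n <= m)%N -> Ccurve T (U n)) -> Ccurve T (Gsum m).
Proof.
move=> hg mN cU; apply: Ccurve_sum => ns /fd_termsP[sm nm].
exact: Ccurve_mono hg (leq_trans sm mN) cU nm.
Qed.

Lemma CH_Gsum s N m : C_n N g -> (m + s.+1 <= N)%N ->
  (forall n, (n <= m)%N -> Ccurve T (U n) /\ CH s.+1 (U n)) -> CH s.+1 (Gsum m).
Proof.
move=> hg mN cU; apply: CH_sum => ns /fd_termsP[sm nm].
apply: CH_mono hg _ cU nm; apply: leq_trans mN.
by rewrite leq_add2r.
Qed.

Lemma is_derive_sum (I : eqType) (l : seq I) (F : I -> R -> R) (dF : I -> R) t :
  {in l, forall i, is_derive t (1 : R) (F i) (dF i)} ->
  is_derive t (1 : R) (fun s => \sum_(i <- l) F i s) (\sum_(i <- l) dF i).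
Proof.
elim: l => [|i l IH] hF.
  rewrite big_nil (_ : (fun s => _) = (fun=> 0)); first exact: isd_cst.
  by apply/funext => s; rewrite big_nil.
rewrite big_cons (_ : (fun s => _) = (fun s => F i s + \sum_(i <- l) F i s)); last first.
  by apply/funext => s; rewrite big_cons.
apply: isdD; first by apply: hF; rewrite mem_head.
by apply: IH => j jl; apply: hF; rewrite inE jl orbT.
Qed.

Lemma is_derive_prod K t x ns :
  (forall n, (n <= K)%N -> is_derive t (1 : R) (fun s => U n s x) (U n.+1 t x)) ->
  {in ns, forall n, (n <= K)%N} ->
  is_derive t (1 : R) (fun s => \prod_(n <- ns) U n s x)
    (\sum_(i <- iota 0 (size ns)) \prod_(n <- incr_nth ns i) U n t x).
Proof.
move=> dU; elim: ns => [|n ns IH] nK.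
  rewrite big_nil (_ : (fun s => _) = (fun=> 1)); first exact: isd_cst.
  by apply/funext => s; rewrite big_nil.
rewrite (_ : (fun s => _) = (fun s => U n s x * \prod_(n <- ns) U n s x)); last first.
  by apply/funext => s; rewrite big_cons.
have nK0 : (n <= K)%N by apply: nK; rewrite mem_head.
have nsK : {in ns, forall n, (n <= K)%N} by move=> i ins; apply: nK; rewrite inE ins orbT.
apply: (isd_eq (isdM (dU _ nK0) (IH nsK))).
rewrite /= big_cons /= big_cons addrC [in LHS]mulrC; congr (_ + _).
rewrite mulr_sumr (_ : iota 1 (size ns) = [seq i.+1 | i <- iota 0 (size ns)]); last first.
  by rewrite -(addn0 1%N) iotaDl.
by rewrite big_map; apply: eq_bigr => i _; rewrite /= big_cons.
Qed.

(** The recursion of fd_terms is the product rule: differentiating g^(l)(U_0) adds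
    a factor of index 1, differentiating a factor U_n raises its index. *)
Lemma is_derive_Gsum N m t x : C_n N g -> (m < N)%N ->
  (forall n, (n <= m)%N -> is_derive t (1 : R) (fun s => U n s x) (U n.+1 t x)) ->
  is_derive t (1 : R) (fun s => Gsum m s x) (Gsum m.+1 t x).
Proof.
move=> hg mN dU; rewrite /Gsum /= big_flatten /= big_map.
apply: is_derive_sum => ns /fd_termsP[sm nm]; rewrite big_cons big_map.
have d0 : is_derive t (1 : R) (fun s => derive1n (size ns) g (U 0%N s x))
    (derive1n (size ns).+1 g (U 0%N t x) * U 1%N t x).
  apply: (@isd_comp _ (derive1n (size ns) g) (fun s => U 0%N s x)); last exact: dU.
  by apply: (Cn_is_derive _ hg); exact: leq_ltn_trans sm mN.
apply: (isd_eq (isdM d0 (is_derive_prod dU nm))).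
rewrite [LHS]addrC; congr (_ + _).
  by rewrite /mono /= big_cons; ring.
rewrite mulr_sumr; apply: eq_big_seq => i; rewrite mem_iota add0n /= => im.
by rewrite /mono size_incr_nth im.
Qed.

End nonlinear_terms.

End regularity_classes.

(** * Measurability and iterated integrals on the cylinder *)

Section cylinder.
Context {R : realType}.
Local Notation mu := (@lebesgue_measure R).
Local Notation mu2 := (mu \x mu)%E.
Implicit Types (f g phi : R -> R) (x y s t : R) (V Z : R -> R -> R) (h v w : R * R -> R).

(** F is the limit of the functions F(floor(n t) / n, x), which are built from
    countably many sections of F. *)
Lemma caratheodory_meas (F : R -> R -> R) :
  (forall t, measurable_fun [set: measurableTypeR R] (F t)) ->
  (forall x, continuous (fun t => F t x)) ->
  measurable_fun [set: measurableTypeR R * measurableTypeR R] (fun p => F p.1 p.2).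
Proof.
move=> mF cF.
pose r (n : nat) (t : R) : R := (Num.floor (n.+1%:R * t))%:~R / n.+1%:R.
apply: (@measurable_fun_cvg _ _ _ _ (fun n p => F (r n p.1) p.2)); last first.
  move=> [t x] _ /=.
  have rt : r n t @[n --> \oo] --> t.
    apply/cvgrPdist_le => e e0.
    have [N _ HN] := near_infty_natSinv_lt (PosNum e0).
    exists N => // n /HN /= hn; apply: le_trans (ltW hn).
    have n0 : 0 < n.+1%:R :> R by rewrite ltr0n.
    have -> : t - r n t = (n.+1%:R * t - (Num.floor (n.+1%:R * t))%:~R) / n.+1%:R.
      by rewrite mulrBl mulrAC mulfV ?lt0r_neq0// mul1r.
    have /andP[h1 h2] := floor_itv (n.+1%:R * t).
    rewrite intrD1 in h2.
    rewrite normrM (ger0_norm (x := n.+1%:R^-1)) ?invr_ge0// -[leRHS]mul1r ler_wpM2r//.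
    by rewrite ler_norml; lra.
  exact: (cvg_comp _ _ rt (cF x t)).
move=> n _ B mB; rewrite setTI.
rewrite (_ : _ @^-1` B = \bigcup_(k : int)
   ([set t : R | (k%:~R <= n.+1%:R * t) && (n.+1%:R * t < (k + 1)%:~R)] `*`
    (F (k%:~R / n.+1%:R) @^-1` B))); last first.
  apply/seteqP; split => [[t x] /= Bx|[t x] [k _ [/= kt Bx]]].
    exists (Num.floor (n.+1%:R * t)) => //; split => //=; exact: floor_itv.
  by rewrite /r (floor_def kt).
apply: countable_bigcupT_measurable; first exact: countableP.
move=> k; apply: measurableX; last first.
  by rewrite -[X in measurable X]setTI; exact: mF.
rewrite (_ : [set t | _] = (fun t => n.+1%:R * t) @^-1` `[k%:~R, (k + 1)%:~R[%classic); last first.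
  by apply/seteqP; split => t /=; rewrite in_itv.
rewrite -[X in measurable X]setTI.
have m1 : measurable_fun [set: measurableTypeR R] (fun t : R => n.+1%:R * t).
  by apply: measurable_funM => //; exact: measurable_id.
by apply: m1 => //; exact: measurable_itv.
Qed.

Variables T L : R.
Hypothesis (T0 : 0 < T) (L0 : 0 < L).
Local Notation I := (`]0, T[%classic : set (measurableTypeR R)).
Local Notation D := (`]0, L[%classic : set (measurableTypeR R)).
Local Notation Q := (QT T L : set (measurableTypeR R * measurableTypeR R)).

Lemma meas_QT : measurable Q.
Proof. by apply: measurableX; exact: meas_oo. Qed.

Lemma L2QP v : L2Q T L v <-> sqi mu2 Q v.
Proof. exact: (LfunP2 mu2 meas_QT v). Qed.

Lemma patch_section h t : t \in `]0, T[ ->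
  (fun x => (h \_ Q) (t, x)) = (fun x => h (t, x)) \_ D.
Proof.
move=> tI; apply/funext => x; rewrite /patch /QT in_setX /=.
by rewrite (_ : t \in `]0, T[%classic)//; exact/mem_set.
Qed.

Lemma patch_section_x h x : x \in `]0, L[ ->
  (fun t => (h \_ Q) (t, x)) = (fun t => h (t, x)) \_ I.
Proof.
move=> xD; apply/funext => t; rewrite /patch /QT in_setX /=.
by rewrite (_ : x \in `]0, L[%classic) ?andbT//; exact/mem_set.
Qed.

Lemma patch_out h t x : ~ ((t \in `]0, T[) /\ (x \in `]0, L[)) -> (h \_ Q) (t, x) = 0.
Proof.
move=> tx; rewrite /patch /QT in_setX /=; case: ifP => // /andP[/set_mem tI /set_mem xD].
by exfalso; apply: tx.
Qed.

(** Marginals are extended real-valued; they are finite almost everywhere. *)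
Lemma fine_itg a b (F : R -> \bar R) : mu.-integrable setT F ->
  (forall t, t \notin `]a, b[ -> F t = 0%E) ->
  itg mu `]a, b[ (fun t => fine (F t)) /\
  \int[mu]_(t in `]a, b[) fine (F t) = fine (\int[mu]_t F t).
Proof.
move=> iF F0.
have mF : measurable_fun [set: measurableTypeR R] F by exact: measurable_int iF.
have mf : measurable_fun [set: measurableTypeR R] (fun t => fine (F t)).
  by apply: measurableT_comp => //; exact: fine_measurable.
have i1 : itg mu `]a, b[ (fun t => fine (F t)).
  apply: (@integrableS _ _ _ mu setT _ _ measurableT (meas_oo a b)) => //.
  apply: le_integrable iF => //; first exact/measurable_EFinP.
  by move=> t _ /=; case: (F t) => //=; rewrite ?normr0 ?leey.
split => //; rewrite /Rintegral; congr fine.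
rewrite [RHS](_ : _ = \int[mu]_(t in `]a, b[) F t)%E; last first.
  rewrite [RHS]integral_mkcond; apply: eq_integral => t _.
  rewrite /patch; case: ifPn => // tab; apply: F0.
  by apply: contra tab => h; exact/mem_set.
apply: (ae_eq_integral _ _ (meas_oo a b)); [exact/measurable_EFinP/measurable_funTS|exact: measurable_funTS|].
have := integrable_ae measurableT iF; apply: filterS => t h _.
by rewrite fineK// h.
Unshelve. all: by end_near. Qed.

Lemma fubini_tx h : itg mu2 Q h ->
  [/\ {ae mu, forall t, t \in `]0, T[ -> itg mu D (fun x => h (t, x))},
      itg mu I (fun t => \int[mu]_(x in D) h (t, x)) &
      \int[mu2]_(p in Q) h p = \int[mu]_(t in I) \int[mu]_(x in D) h (t, x)].
Proof.
move=> ih; have i2 := (restrictT_itg _ meas_QT h).1 ih.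
pose F := fubini_F mu (EFin \o (h \_ Q)).
have FE t : t \in `]0, T[ -> fine (F t) = \int[mu]_(x in D) h (t, x).
  move=> tI; rewrite /Rintegral integral_mkcond; congr fine.
  by apply: eq_integral => x _ /=; rewrite restrict_EFin/= -patch_section.
have F0 t : t \notin `]0, T[ -> F t = 0%E.
  move=> tI; rewrite /F /fubini_F -[RHS](integral0 mu setT).
  apply: eq_integral => x _ /=; rewrite patch_out// => -[h1 _].
  by move: tI; rewrite h1.
have [j1 j2] := fine_itg (integrable_fubini_F i2) F0.
split.
- apply: filterS (ae_integrable1 i2) => t it tI.
  by apply/restrictT_itg; [exact: meas_oo|rewrite -patch_section].
- by apply: (itg_ext (meas_oo 0 T) _ j1) => t; exact: FE.
- rewrite -(Rint_ext mu (D := `]0, T[%classic) FE) j2 integral12_prod_meas1//.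
  by rewrite /Rintegral integral_mkcond restrict_EFin.
Qed.

Lemma fubini_xt h : itg mu2 Q h ->
  [/\ {ae mu, forall x, x \in `]0, L[ -> itg mu I (fun t => h (t, x))},
      itg mu D (fun x => \int[mu]_(t in I) h (t, x)) &
      \int[mu2]_(p in Q) h p = \int[mu]_(x in D) \int[mu]_(t in I) h (t, x)].
Proof.
move=> ih; have i2 := (restrictT_itg _ meas_QT h).1 ih.
pose F := fubini_G mu (EFin \o (h \_ Q)).
have FE x : x \in `]0, L[ -> fine (F x) = \int[mu]_(t in I) h (t, x).
  move=> tI; rewrite /Rintegral integral_mkcond; congr fine.
  by apply: eq_integral => t _ /=; rewrite restrict_EFin/= -patch_section_x.
have F0 x : x \notin `]0, L[ -> F x = 0%E.
  move=> xD; rewrite /F /fubini_G -[RHS](integral0 mu setT).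
  apply: eq_integral => t _ /=; rewrite patch_out// => -[_ h1].
  by move: xD; rewrite h1.
have mf := measurable_int _ i2.
have iG : mu.-integrable setT F.
  have mG : measurable_fun setT (fun y => \int[mu]_x `|(EFin \o (h \_ Q)) (x, y)|)%E.
    apply: (measurable_fun_fubini_tonelli_G (abse \o (EFin \o (h \_ Q)))) => [|p]; last exact: abse_ge0.
    exact: measurableT_comp.
  apply/integrableP; split; first exact: (measurable_fubini_G i2).
  apply: le_lt_trans ((integrable21ltyP _ _ mf).1 i2); apply: ge0_le_integral => //.
    by apply: measurableT_comp => //; exact: (measurable_fubini_G i2).
  move=> y _; apply: le_abse_integral => //; exact: measurable_fun_pair1.
have [j1 j2] := fine_itg iG F0.
split.
- apply: filterS (ae_integrable2 i2) => x it xD.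
  by apply/restrictT_itg; [exact: meas_oo|rewrite -patch_section_x].
- by apply: (itg_ext (meas_oo 0 L) _ j1) => x; exact: FE.
- rewrite -(Rint_ext mu (D := `]0, L[%classic) FE) j2 integral21_prod_meas1//.
  by rewrite /Rintegral integral_mkcond restrict_EFin.
Qed.

Lemma meas_section v t : measurable_fun Q v -> t \in `]0, T[ ->
  measurable_fun D (fun x => v (t, x)).
Proof.
move=> mv tI; apply/(measurable_restrictT _ (meas_oo 0 L)).
rewrite -patch_section//; apply: measurable_fun_pair2.
exact/(measurable_restrictT _ meas_QT).
Qed.

Lemma meas_section_x v x : measurable_fun Q v -> x \in `]0, L[ ->
  measurable_fun I (fun t => v (t, x)).
Proof.
move=> mv tI; apply/(measurable_restrictT _ (meas_oo 0 T)).
rewrite -patch_section_x//; apply: measurable_fun_pair1.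
exact/(measurable_restrictT _ meas_QT).
Qed.

Lemma sqi_section v : sqi mu2 Q v ->
  {ae mu, forall t, t \in `]0, T[ -> sqi mu D (fun x => v (t, x))}.
Proof.
move=> [mv iv]; have [h _ _] := fubini_tx iv.
by apply: ae_mu h => t ht tI; split; [exact: meas_section|exact: ht].
Qed.

Lemma sqi_section_x v : sqi mu2 Q v ->
  {ae mu, forall x, x \in `]0, L[ -> sqi mu I (fun t => v (t, x))}.
Proof.
move=> [mv iv]; have [h _ _] := fubini_xt iv.
by apply: ae_mu h => t ht tI; split; [exact: meas_section_x|exact: ht].
Qed.

(** Tonelli's theorem. *)
Lemma sqi_of_sections w M : measurable_fun Q w -> 0 <= M ->
  {ae mu, forall t, t \in `]0, T[ -> sqi mu D (fun x => w (t, x)) /\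
     nsq mu D (fun x => w (t, x)) <= M} -> sqi mu2 Q w.
Proof.
move=> mw M0 Hw; split => //; apply/(restrictT_itg _ meas_QT).
have mf : measurable_fun [set: measurableTypeR R * measurableTypeR R]
    (EFin \o ((fun p => w p ^+ 2) \_ Q)).
  by apply/measurable_EFinP/(measurable_restrictT _ meas_QT); exact: measurable_funX.
apply/(integrable12ltyP _ _ mf).
apply: (@le_lt_trans _ _ (\int[mu]_(t in I) M%:E)%E); last first.
  by rewrite integral_cst ?meas_oo//= lte_mul_pinfty// ?lee_fin// mu_itv_fin.
rewrite [leRHS]integral_mkcond; apply: ae_ge0_le_integral => //.
- by move=> t _; apply: integral_ge0 => x _; exact: abse_ge0.
- apply: (measurable_fun_fubini_tonelli_F (abse \o (EFin \o ((fun p => w p ^+ 2) \_ Q)))) => [|p]; last exact: abse_ge0.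
  exact: measurableT_comp.
- by move=> t _; rewrite /patch; case: ifP => // _; rewrite lee_fin.
- by apply: (measurable_restrictT _ (meas_oo 0 T)).1; exact: measurable_cst.
- apply: ae_mu Hw => t Hw _; rewrite [X in (_ <= X)%E]/patch; case: ifPn => [/set_mem tI|tI].
    have [[ms is_] le] := Hw tI.
    apply: (@le_trans _ _ (nsq mu D (fun x => w (t, x)))%:E); last by rewrite lee_fin.
    rewrite /nsq /Rintegral fineK; last exact: integrable_fin_num.
    rewrite [leRHS]integral_mkcond le_eqVlt; apply/orP; left; apply/eqP.
    apply: eq_integral => x _; rewrite restrict_EFin /= -(patch_section (fun p => w p ^+ 2) tI).
    by rewrite ger0_norm// /patch; case: ifP => // _; exact: sqr_ge0.
  rewrite le_eqVlt; apply/orP; left; apply/eqP; rewrite -[RHS](integral0 mu setT).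
  apply: eq_integral => x _ /=; rewrite patch_out ?normr0// => -[h1 _].
  by move: tI; rewrite mem_setE h1.
Qed.

End cylinder.

(** * Curves versus functions on the cylinder *)

Section cylinder_curves.
Context {R : realType}.
Local Notation mu := (@lebesgue_measure R).
Local Notation mu2 := (mu \x mu)%E.
Implicit Types (f g a p phi e : R -> R) (x y s t : R) (V Z : R -> R -> R) (h v w : R * R -> R).
Variables T L : R.
Hypothesis (T0 : 0 < T) (L0 : 0 < L).
Local Notation I := (`]0, T[%classic : set (measurableTypeR R)).
Local Notation D := (`]0, L[%classic : set (measurableTypeR R)).
Local Notation Q := (QT T L : set (measurableTypeR R * measurableTypeR R)).

(** The retraction of the line onto [0, T], in a form whose continuity is plain.
    Composing with it extends functions continuous on [0, T]. *)
Definition clamp t : R := (`|t| + T - `|t - T|) / 2.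

Lemma clamp_cont : continuous clamp.
Proof.
move=> t; apply: cvgMl; apply: cvgB.
  by apply: cvgD; [exact: norm_continuous|exact: cvg_cst].
apply: cvg_norm; apply: cvgB; [exact: cvg_id|exact: cvg_cst].
Qed.

Lemma clamp_in t : clamp t \in `[0, T].
Proof.
have T1 := T0; rewrite in_itv/= /clamp.
by have [h1|h1] := leP 0 t; have [h2|h2] := leP 0 (t - T);
  rewrite ?(ger0_norm h1) ?(ltr0_norm h1) ?(ger0_norm h2) ?(ltr0_norm h2);
  apply/andP; split; lra.
Qed.

Lemma clampE t : t \in `[0, T] -> clamp t = t.
Proof.
rewrite in_itv/= /clamp => /andP[t0 tT]; rewrite ger0_norm// ler0_norm ?subr_le0//; lra.
Qed.

Lemma itv_oo_cc t : t \in `]0, T[ -> t \in `[0, T].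
Proof. by rewrite !in_itv/= => /andP[h1 h2]; rewrite !ltW. Qed.

Lemma scont_clamp e : scont T e -> continuous (e \o clamp).
Proof.
move=> he t; apply: (@cvg_comp _ _ _ clamp e _ (within `[0, T]%classic (nbhs (clamp t)))).
  move=> P; rewrite /within/= => /clamp_cont; apply: (@filterS _ (nbhs t)) => s; apply.
  exact: clamp_in.
exact: (he _ (clamp_in t)).
Qed.

Lemma scont_meas e : scont T e -> measurable_fun I e.
Proof.
move=> he; apply: (@meas_ext _ _ _ _ (e \o clamp)).
  by move=> t tI; rewrite /= clampE// itv_oo_cc.
by apply: cont_meas; exact: scont_clamp.
Qed.

Lemma scont_sqi e : scont T e -> sqi mu I e.
Proof.
move=> he; have [M _ HM] := scont_bounded T0 he.
apply: (@sqi_bounded _ _ _ _ M); first exact: scont_meas.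
by move=> t tI; apply: HM; exact: itv_oo_cc.
Qed.

(** A curve in L_2 determines each V t only up to null sets, so joint
    measurability has to be produced.  The primitive F of V in x is continuous in
    each variable, hence measurable; w is the upper limit of its difference
    quotients, equal to V t almost everywhere by Lebesgue's differentiation
    theorem. *)
Lemma measurable_version V : L2_continuous T L V ->
  exists w, sqi mu2 Q w /\ forall t, t \in `]0, T[ ->
    {ae mu, forall x, x \in `]0, L[ -> w (t, x) = V t x}.
Proof.
move=> cV; pose F t x := prim 0 L (V (clamp t)) x.
have sV t : sqi mu D (V (clamp t)) by apply: (L2c_sqi cV); exact: clamp_in.
have cF x : continuous (fun t => F t x).
  exact: (scont_clamp (pairing_scont cV (step_sqi 0 L x))).
have cFt t : continuous (F t) by exact: prim_cont.
pose q (n : nat) (p : R * R) := n.+1%:R * (F p.1 (p.2 + n.+1%:R^-1) - F p.1 p.2).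
pose w (p : R * R) := fine (limn_esup (fun n => (q n p)%:E)).
have mq n : measurable_fun [set: measurableTypeR R * measurableTypeR R] (q n).
  apply: measurable_funM; first exact: measurable_cst.
  apply: measurable_funB.
    apply: (@caratheodory_meas _ (fun t x => F t (x + n.+1%:R^-1))).
      move=> t; apply: cont_meas => x; apply: (@cvg_comp _ _ _ _ (F t)); last exact: cFt.
      by apply: cvgD; [exact: cvg_id|exact: cvg_cst].
    by move=> x; exact: cF.
  by apply: (@caratheodory_meas _ F) => [t|x]; [apply: cont_meas; exact: cFt|exact: cF].
have mw : measurable_fun [set: measurableTypeR R * measurableTypeR R] w.
  have ml : measurable_fun [set: measurableTypeR R * measurableTypeR R]
      (fun z : R * R => limn_esup (fun n => (q n z)%:E)).
    have := @measurable_fun_limn_esup _ (measurableTypeR R * measurableTypeR R)%type R setT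
      (fun n z => (q n z)%:E); apply => n.
    exact/measurable_EFinP.
  exact: (measurableT_comp (fine_measurable measurableT) ml).
have wV t : t \in `]0, T[ -> {ae mu, forall x, x \in `]0, L[ -> w (t, x) = V t x}.
  move=> tI; apply: ae_mu (prim_ae_derive (sV t)) => x dx xD.
  have {}dx := dx xD; rewrite (clampE (itv_oo_cc tI)) in dx.
  have qV : q n (t, x) @[n --> \oo] --> V t x.
    have d := @ex_derive _ _ _ _ _ _ _ dx.
    have dE := @derive_val _ _ _ _ _ _ _ dx.
    have /cvgr_dnbhsP/(_ (fun n => n.+1%:R^-1)) : h^-1 *: ((F t \o shift x) (h *: (1 : R)) - F t x) @[h --> (0 : R)^'] --> V t x.
      by rewrite -dE /F (clampE (itv_oo_cc tI)); exact: d.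
    have k : (forall n : nat, n.+1%:R^-1 != 0 :> R) /\ n.+1%:R^-1 @[n --> \oo] --> (0 : R).
      by split; [move=> n; rewrite invr_eq0 pnatr_eq0|exact: cvg_harmonic].
    move=> /(_ k); apply: cvg_trans; apply: near_eq_cvg; apply: nearW => n /=.
    by rewrite /q /= invrK [n.+1%:R^-1 *: 1]mulr1 [x + _]addrC.
  have qV' : (q n (t, x))%:E @[n --> \oo] --> (V t x)%:E.
    by apply: cvg_EFin; [exact: nearW|exact: qV].
  by rewrite /w (cvg_limn_einf_sup qV').2.
exists w; split => //; have [M M0 HM] := L2c_bounded T0 cV.
have mwQ : measurable_fun Q w by exact: measurable_funTS.
apply: (sqi_of_sections _ M0) => //; apply: aeW => t tI.
have mwt := meas_section mwQ tI.
have st := L2c_sqi cV (itv_oo_cc tI).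
have e : {ae mu, forall x, x \in `]0, L[ -> V t x = w (t, x)}.
  by apply: ae_mu (wV t tI) => x h xD; rewrite h.
split; first exact: (sqi_ae (meas_oo 0 L) mwt e st).
rewrite -(nsq_ae (meas_oo 0 L) _ mwt e); last by have [] := st.
by apply: HM; exact: itv_oo_cc.
Qed.

Lemma tensor_sqi a p : continuous a -> sqi mu D p ->
  sqi mu2 Q (fun z => a z.1 * p z.2).
Proof.
move=> ca sp; have [B B0 HB] := cont_bounded_ball T ca.
apply: (@sqi_of_sections _ _ _ _ (B ^+ 2 * nsq mu D p)).
- apply: measurable_funM.
    apply: (@measurable_funTS _ _ _ _ _ (a \o fst)).
    by apply: measurableT_comp => //; exact: cont_meas.
  have [mp _] := sp; apply/(measurable_restrictT _ (meas_QT T L)).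
  have -> : (fun z : R * R => p z.2) \_ Q =
      (fun z => (((fun=> 1 : R) \_ I) z.1 * (p \_ D) z.2)).
    apply/funext => -[t x]; rewrite /patch /QT in_setX /=.
    by case: (t \in _); case: (x \in _); rewrite /= ?(mul1r, mul0r, mulr0).
  apply: measurable_funM.
    apply: (measurableT_comp (f := (fun=> 1 : R) \_ I)) => //.
    by apply: (measurable_restrictT _ (meas_oo 0 T)).1; exact: measurable_cst.
  apply: (measurableT_comp (f := p \_ D)) => //.
  exact: (measurable_restrictT _ (meas_oo 0 L)).1.
- by rewrite mulr_ge0 ?sqr_ge0// nsq_ge0.
- apply: aeW => t; rewrite in_itv/= => /andP[t0 tT]; split; first exact: sqiZ.
  rewrite nsqZ// ler_wpM2r ?nsq_ge0// -(real_normK (num_real (a t))).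
  by rewrite lerXn2r ?nnegrE// HB// ger0_norm ltW.
Qed.

(** Fubini's theorem, the inner integral being the pairing of the curve. *)
Lemma pairing_tensor v V a p : sqi mu2 Q v -> curve_of T L v V ->
  L2_continuous T L V -> continuous a -> sqi mu D p ->
  \int[mu2]_(z in Q) (v z * (a z.1 * p z.2)) =
  \int[mu]_(t in I) (a t * \int[mu]_(x in D) (V t x * p x)).
Proof.
move=> sv vV cV ca sp; have st := tensor_sqi ca sp.
have [h1 h2 ->] := fubini_tx (sqi_mul (meas_QT T L) sv st).
apply: (ae_Rint (meas_oo 0 T)).
- exact: itg_meas h2.
- apply: measurable_funM; first exact: cont_meas.
  by apply: scont_meas; exact: pairing_scont.
- apply: ae_mu2 vV (sqi_section sv) => t tV svt tI.
  have {}svt := svt tI; have sVt := L2c_sqi cV (itv_oo_cc tI).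
  rewrite /= -(RintegralZl _ (meas_oo 0 L) (sqi_mul (meas_oo 0 L) sVt sp)).
  transitivity (\int[mu]_(x in D) (V t x * (a t * p x))); last by apply: Rint_ext => x _; rewrite mulrCA.
  apply: ae_Rint_mul => //; last exact: tV.
  exact: sqiZ.
Qed.

(** For each p the function t |-> int h(t, x) p(x) dx vanishes a.e.; countably many p
    suffice to conclude that h(t, .) vanishes a.e., outside one null set of t. *)
Lemma Q_zero h : sqi mu2 Q h ->
  (forall a p, tst 0 T a -> tst 0 L p ->
     \int[mu2]_(z in Q) (h z * (a z.1 * p z.2)) = 0) ->
  ae_on T (fun t => ae_on L (fun x => h (t, x) = 0)).
Proof.
move=> sh H.
have E0 p : tst 0 L p ->
    {ae mu, forall t, t \in `]0, T[ -> \int[mu]_(x in D) (h (t, x) * p x) = 0}.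
  move=> tp; have sp := tst_sqi tp.
  have c1 : continuous (fun _ : R => 1 : R) by exact: cst_continuous.
  have [_ i1 _] := fubini_tx (sqi_mul (meas_QT T L) sh (tensor_sqi c1 sp)).
  have i1' : itg mu I (fun t => \int[mu]_(x in D) (h (t, x) * p x)).
    apply: (itg_ext (meas_oo 0 T) _ i1) => t _.
    by apply: Rint_ext => x _; rewrite mul1r.
  have [_ i2 _] := fubini_tx sh.2.
  have sE : sqi mu I (fun t => \int[mu]_(x in D) (h (t, x) * p x)).
    split; first exact: itg_meas i1'.
    apply: (itg_le_ae (meas_oo 0 T) _ (itgZ (meas_oo 0 T) (nsq mu D p) i2)).
      by apply: measurable_funX; exact: itg_meas i1'.
    apply: ae_mu (sqi_section sh) => t st tI; have {}st := st tI.
    rewrite ger0_norm ?sqr_ge0// mulrC.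
    exact: (cauchy_schwarz (meas_oo 0 L)).
  apply: (fundamental sE) => a ta; have ca := tst_cont ta.
  rewrite -[RHS](H a p ta tp).
  have [h1 h2 ->] := fubini_tx (sqi_mul (meas_QT T L) sh (tensor_sqi ca sp)).
  apply: (ae_Rint (meas_oo 0 T)).
  - by apply: measurable_funM; [exact: itg_meas i1'|exact: cont_meas].
  - exact: itg_meas h2.
  - apply: ae_mu (sqi_section sh) => t st tI; have {}st := st tI.
    rewrite /= mulrC -(RintegralZl _ (meas_oo 0 L) (sqi_mul (meas_oo 0 L) st sp)).
    by apply: Rint_ext => x _; ring.
(* The countable family of tests, enumerated by pickle. *)
pose P n t := forall (p q : rat) m, unpickle n = Some (p, q, m) ->
   0 < (ratr p : R) -> (ratr q : R) < L -> t \in `]0, T[ ->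
   \int[mu]_(x in D) (h (t, x) * flatbump m.+1%:R^-1 (ratr p) (ratr q) x) = 0.
have aeP n : {ae mu, forall t, P n t}.
  rewrite /P; case: (unpickle n) => [[[p q] m]|]; last by apply: aeW.
  have [p0|p0] := boolP (0 < (ratr p : R)); last first.
    by apply: aeW => t p' q' m' [<- _ _] h0; rewrite h0 in p0.
  have [qL|qL] := boolP ((ratr q : R) < L); last first.
    by apply: aeW => t p' q' m' [_ <- _] _ h0; rewrite h0 in qL.
  have := E0 _ (@flatbump_tst _ 0 L m.+1%:R^-1 (ratr p) (ratr q) _ p0 qL).
  by rewrite invr_gt0 ltr0n => /(_ isT); apply: ae_mu => t Ht p' q' m' [<- <- <-] _ _.
apply: ae_mu2 (ae_foralln aeP) (sqi_section sh) => t Pt st tI.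
apply: (fundamental_rat (st tI)) => p q m p0 qL.
by apply: (Pt (pickle (p, q, m))) => //; rewrite pickleK.
Qed.

Lemma curve_of_ae v w V : {ae mu, forall t, t \in `]0, T[ -> {ae mu, forall x, x \in `]0, L[ -> v (t, x) = w (t, x)}} ->
  curve_of T L w V -> curve_of T L v V.
Proof.
move=> vw wV; apply: ae_mu2 vw wV => t h1 h2 tI.
by apply: ae_mu2 (h1 tI) (h2 tI) => x e1 e2 xD; rewrite e1// e2.
Qed.

End cylinder_curves.

(** * Product test functions *)

Section tensor_tests.

Lemma Rintegral_zero (d : measure_display) (X : measurableType d) (R : realType)
  (m : {measure set X -> \bar R}) (A : set X) : \int[m]_(x in A) (0 : R) = 0.
Proof. by rewrite /Rintegral integral0. Qed.

Context {R : realType}.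
Local Notation mu := (@lebesgue_measure R).
Local Notation mu2 := (mu \x mu)%E.
Local Notation cyl := (R * R)%type.
Implicit Types (g a p phi : R -> R) (x y s t : R) (V Z : R -> R -> R) (h v w chi : R * R -> R).

(** Restriction to a line turns directional derivatives on the plane into
    derivatives of functions of one variable. *)
Lemma is_derive_lineP h (z e : cyl) (l : R) :
  is_derive (0 : R) (1 : R) (fun s => h (s *: e + z)) l <-> is_derive z e h l.
Proof.
have E : (fun s : R => s^-1 *: ((fun s => h (s *: e + z)) (s *: (1 : R) + 0) - h (0 *: e + z))) =
    (fun s => s^-1 *: ((h \o shift z) (s *: e) - h z)).
  by apply/funext => s /=; rewrite addr0 [s *: 1]mulr1 scale0r add0r.
split=> d; have dE := @derive_val _ _ _ _ _ _ _ d; have {}d := @ex_derive _ _ _ _ _ _ _ d.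
- apply: DeriveDef; first by rewrite /derivable -E; exact: d.
  by rewrite -dE /derive /= -E.
- apply: DeriveDef; first by rewrite /derivable /= E; exact: d.
  by rewrite -dE /derive /= E.
Qed.

Lemma is_derive_tensor a p (z e : cyl) : smooth1 a -> smooth1 p ->
  is_derive z e (fun z => a z.1 * p z.2)
    (e.1 * (derive1 a z.1 * p z.2) + e.2 * (a z.1 * derive1 p z.2)).
Proof.
move=> sa sp; apply/is_derive_lineP.
have lin (b : R -> R) (c d : R) : smooth1 b ->
    is_derive (0 : R) (1 : R) (fun s => b (s * c + d)) (derive1 b d * c).
  move=> sb; apply: (@isd_comp _ b (fun s => s * c + d)).
    by rewrite mul0r add0r; exact: smooth1_is_derive.
  have := isdD (isdM (isd_id (0 : R)) (isd_cst c 0)) (isd_cst d (0 : R)).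
  by rewrite mulr0 add0r mulr1 addr0.
have := isdM (lin a e.1 z.1 sa) (lin p e.2 z.2 sp).
rewrite !mul0r !add0r => d; apply: (isd_eq d); ring.
Qed.

(** Sums of products are stable under directional derivatives; the scalar c
    receives the components of the direction. *)
Inductive tensor_class : (cyl -> R) -> Prop :=
| tensor_nil : tensor_class (fun=> 0)
| tensor_add (c : R) a p h of smooth1 a & smooth1 p & tensor_class h :
    tensor_class (fun z => c * (a z.1 * p z.2) + h z).

Lemma tensor_classP h : tensor_class h ->
  [/\ continuous h, forall z e, derivable h z e & forall e, tensor_class ('D_e h)].
Proof.
elim => {h} [|c a p h sa sp _ [ch dh th]].
  split; [exact: cst_continuous|by move=> z e; exact: derivable_cst|].
  move=> e; rewrite (_ : 'D_e _ = fun=> 0); first exact: tensor_nil.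
  by apply/funext => z; exact: derive_cst.
have d (z e : cyl) : is_derive z e (fun z => c * (a z.1 * p z.2) + h z)
    (c * (e.1 * (derive1 a z.1 * p z.2) + e.2 * (a z.1 * derive1 p z.2)) + 'D_e h z).
  apply/is_derive_lineP; apply: isdD.
    apply: isdZ; apply/(is_derive_lineP (fun z => a z.1 * p z.2)).
    exact: is_derive_tensor.
  by apply/is_derive_lineP; apply: DeriveDef => //; exact: dh.
split.
- move=> z; apply: cvgD; last exact: ch.
  apply: cvgMr; apply: cvgM.
    by apply: (@cvg_comp _ _ _ fst a _ (nbhs z.1)); [exact: cvg_fst|exact: smooth1_cont].
  by apply: (@cvg_comp _ _ _ snd p _ (nbhs z.2)); [exact: cvg_snd|exact: smooth1_cont].
- by move=> z e; exact: ex_derive.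
- move=> e; rewrite (_ : 'D_e _ = (fun z => (c * e.1) * (derive1 a z.1 * p z.2) +
      ((c * e.2) * (a z.1 * derive1 p z.2) + 'D_e h z))).
    exact: (tensor_add (c * e.1) (smooth1_deriv sa) sp
      (tensor_add (c * e.2) sa (smooth1_deriv sp) (th e))).
  by apply/funext => z; rewrite (@derive_val _ _ _ _ _ _ _ (d z e)); ring.
Qed.

Lemma tensor_smooth a p : smooth1 a -> smooth1 p ->
  smooth (fun z : cyl => a z.1 * p z.2).
Proof.
move=> sa sp; apply: (smooth_class tensor_classP).
rewrite (_ : (fun z : cyl => _) = fun z => 1 * (a z.1 * p z.2) + (fun=> 0) z).
  by apply: tensor_add => //; exact: tensor_nil.
by apply/funext => z; rewrite mul1r addr0.
Qed.

Lemma d_t_tensor a p : smooth1 a -> smooth1 p ->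
  d_t (fun z : cyl => a z.1 * p z.2) = (fun z => derive1 a z.1 * p z.2).
Proof.
move=> sa sp; apply/funext => z; rewrite /d_t.
rewrite (@derive_val _ _ _ _ _ _ _ (is_derive_tensor z (1, 0) sa sp)) /=; ring.
Qed.

Lemma iter_d_t_tensor m a p : smooth1 a -> smooth1 p ->
  iter m d_t (fun z : cyl => a z.1 * p z.2) = (fun z => derive1n m a z.1 * p z.2).
Proof.
move=> sa sp; elim: m => //= m ->.
by rewrite (d_t_tensor (smooth1_derivn sa) sp).
Qed.

Variables T L : R.
Hypothesis (T0 : 0 < T) (L0 : 0 < L).
Local Notation I := (`]0, T[%classic : set (measurableTypeR R)).
Local Notation D := (`]0, L[%classic : set (measurableTypeR R)).
Local Notation Q := (QT T L : set (measurableTypeR R * measurableTypeR R)).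

Lemma tensor_test a p : tst 0 T a -> tst 0 L p ->
  test_function (QT T L) (fun z : cyl => a z.1 * p z.2).
Proof.
move=> [sa [c [d [c0 dT a0]]]] [sp [c' [d' [c0' dL p0]]]].
split; first exact: tensor_smooth.
exists (`[c, d]%classic `*` `[c', d']%classic); split.
- by apply: compact_setX; exact: segment_compact.
- move=> [t x] [/= ]; rewrite !in_itv/= => /andP[t1 t2] /andP[x1 x2]; split => /=.
    by rewrite in_itv/= (lt_le_trans c0 t1) (le_lt_trans t2 dT).
  by rewrite in_itv/= (lt_le_trans c0' x1) (le_lt_trans x2 dL).
- move=> [t x] /= ntx.
  have [tc|ct] := ltP t c; first by rewrite a0 ?mul0r//; left.
  have [dt|td] := ltP d t; first by rewrite a0 ?mul0r//; right.
  have [xc|cx] := ltP x c'; first by rewrite p0 ?mulr0//; left.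
  have [dx|xd] := ltP d' x; first by rewrite p0 ?mulr0//; right.
  by exfalso; apply: ntx; split; rewrite /= in_itv/= ?ct ?cx.
Qed.

Lemma cont_slice_x h t : continuous h -> continuous (fun x => h (t, x)).
Proof.
move=> ch x; apply: (@cvg_comp _ _ _ (fun x => (t, x)) h (nbhs x) (nbhs (t, x))); last exact: ch.
by apply: (@cvg_pair _ _ _ _ (nbhs t) (nbhs x) _ _ _ (fun=> t) (fun x => x)); [exact: cvg_cst|exact: cvg_id].
Qed.

Lemma cont_slice_t h x : continuous h -> continuous (fun t => h (t, x)).
Proof.
move=> ch t; apply: (@cvg_comp _ _ _ (fun t => (t, x)) h (nbhs t) (nbhs (t, x))); last exact: ch.
by apply: (@cvg_pair _ _ _ _ (nbhs t) (nbhs x) _ _ _ (fun t => t) (fun=> x)); [exact: cvg_id|exact: cvg_cst].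
Qed.

Lemma cont_sqi_Q h : continuous h -> sqi mu2 Q h.
Proof.
move=> ch; have cK : compact (`[0, T]%classic `*` `[0, L]%classic : set cyl).
  by apply: compact_setX; exact: segment_compact.
have K0 : (`[0, T]%classic `*` `[0, L]%classic : set cyl) !=set0.
  by exists (0, 0); split => /=; rewrite in_itv/= lexx ltW.
have cn : {within (`[0, T]%classic `*` `[0, L]%classic : set cyl), continuous (fun z => `|h z|)}.
  by apply: continuous_subspaceT => z; apply: cvg_norm; exact: ch.
have [c _ Hc] := compact_EVT_max K0 cK cn.
have c1 := cont_slice_x ch; have c2 := cont_slice_t ch.
have mh : measurable_fun [set: measurableTypeR R * measurableTypeR R] h.
  rewrite (_ : h = (fun z => (fun t x => h (t, x)) z.1 z.2)); last first.
    by apply/funext => -[].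
  by apply: (@caratheodory_meas _ (fun t x => h (t, x))) => // t; exact: cont_meas.
have B t x : t \in `]0, T[ -> x \in `]0, L[ -> `|h (t, x)| <= `|h c|.
  move=> tI xD; apply: Hc; apply/mem_set; split => /=; exact: itv_oo_cc.
have s1 t : t \in `]0, T[ -> sqi mu D (fun x => h (t, x)).
  move=> tI; apply: (@sqi_bounded _ _ _ _ `|h c|); first exact: cont_meas.
  by move=> x xD; exact: B.
apply: (@sqi_of_sections _ _ _ _ (nsq mu D (fun=> `|h c|))).
- exact: measurable_funTS.
- exact: nsq_ge0.
- apply: aeW => t tI; split; first exact: s1.
  apply: nsq_le; [exact: meas_oo|exact: s1|exact: sqi_cst|].
  by move=> x xD; rewrite normr_id; exact: B.
Qed.

Lemma tst_out (a b : R) phi x : tst a b phi -> x \notin `]a, b[ -> phi x = 0.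
Proof.
move=> [_ [c [d [ac db phi0]]]]; rewrite in_itv/= negb_and -!leNgt => /orP xab.
by apply: phi0; case: xab => [xa|bx]; [left; exact: le_lt_trans xa ac|right; exact: lt_le_trans db bx].
Qed.

Lemma tst_weak j p : tst 0 L p -> weak_dx L j p (derive1n j p).
Proof.
move=> tp; elim: j => [|j IH]; first by apply: weak_dx0; exact: tst_sqi tp.
rewrite -addn1; apply: (weak_dx_comp IH).
have tj := tst_derivn j tp; have tj1 := tst_derivn j.+1 tp.
rewrite addn1; apply/weak1P; split; [exact: tst_sqi tj|exact: tst_sqi tj1|].
move=> phi tphi; apply/eqP; rewrite -subr_eq0 opprK; apply/eqP.
rewrite -(RintegralD (meas_oo 0 L) (sqi_mul (meas_oo 0 L) (tst_sqi tj) (tst_sqi (tst_deriv tphi)))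
  (sqi_mul (meas_oo 0 L) (tst_sqi tj1) (tst_sqi tphi))).
have dj x : x \in `]0, L[ -> is_derive x (1 : R) (derive1n j p) (derive1n j.+1 p x).
  by move=> _; rewrite derive1nS; apply: smooth1_is_derive; have [] := tj.
have cj x : x \in `]0, L[ -> {for x, continuous (derive1n j.+1 p)}.
  by move=> _; exact: (tst_cont tj1).
rewrite -[RHS](ibp_tst tphi dj cj).
by apply: Rint_ext => x _; congr (_ + _); rewrite mulrC.
Qed.

(** For fixed x this is integration by parts in t against a. *)
Lemma tensor_weak_dt a p : tst 0 T a -> sqi mu D p ->
  weak_dt T L 1 (fun z => a z.1 * p z.2) (fun z => derive1 a z.1 * p z.2).
Proof.
move=> ta sp; have ca := tst_cont ta; have ca' := tst_cont (tst_deriv ta).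
have s1 := tensor_sqi T ca sp; have s2 := tensor_sqi T ca' sp.
split; [exact/L2QP|exact/L2QP|].
move=> chi [schi _] /=.
have [cchi dchi] : continuous chi /\ forall z e, derivable chi z e := schi [::].
have cdchi : continuous (d_t chi) := (schi [:: (1, 0)]).1.
have q1 := cont_sqi_Q cchi; have q2 := cont_sqi_Q cdchi.
have i1 := sqi_mul (meas_QT T L) s1 q2; have i2 := sqi_mul (meas_QT T L) s2 q1.
apply/eqP; rewrite expr1 mulN1r -subr_eq0 opprK; apply/eqP.
rewrite -(RintegralD (meas_QT T L) i1 i2).
have i12 := itgD (meas_QT T L) i1 i2.
have [_ _ ->] := fubini_xt i12.
rewrite -[RHS](_ : \int[mu]_(x in D) 0 = 0); last exact: Rintegral_zero.
apply: Rint_ext => x xD.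
have dt (t : R) : is_derive t (1 : R) (fun t => chi (t, x)) (d_t chi (t, x)).
  have := (is_derive_lineP chi (t, x) (1, 0) (d_t chi (t, x))).2 (DeriveDef (dchi (t, x) (1, 0)) erefl).
  move=> d; have dd : is_derive t (1 : R) ((fun s => chi (s *: (1, 0) + (t, x))) \o (fun s => s - t)) (d_t chi (t, x) * 1).
    apply: (@isd_comp _ (fun s => chi (s *: (1, 0) + (t, x))) (fun s => s - t)).
      by rewrite subrr.
    by have := isdD (isd_id t) (isd_cst (- t) t); rewrite addr0.
  rewrite mulr1 in dd.
  rewrite (_ : (fun t => chi (t, x)) = ((fun s => chi (s *: (1, 0) + (t, x))) \o (fun s => s - t)))//.
  apply/funext => s /=; congr chi.
  apply: injective_projections => /=.
    by rewrite [_ *: _]mulr1 subrK.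
  by rewrite [_ *: _]mulr0 add0r.
have -> : \int[mu]_(t in I) (a t * p x * d_t chi (t, x) + derive1 a t * p x * chi (t, x)) =
    \int[mu]_(t in I) (p x * (chi (t, x) * derive1 a t + a t * d_t chi (t, x))).
  by apply: Rint_ext => t _; ring.
have cx : continuous (fun t : R => chi (t, x)) by move=> t; exact: derivable_cont (@ex_derive _ _ _ _ _ _ _ (dt t)).
have cdx : continuous (fun t : R => d_t chi (t, x)).
  exact: (@cont_slice_t (d_t chi) x cdchi).
have i3 : itg mu I (fun t => chi (t, x) * derive1 a t + a t * d_t chi (t, x)).
  apply: (itgD (meas_oo 0 T)).
    exact: (sqi_mul (meas_oo 0 T) (sqi_cont _ _ cx) (sqi_cont _ _ ca')).
  exact: (sqi_mul (meas_oo 0 T) (sqi_cont _ _ ca) (sqi_cont _ _ cdx)).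
rewrite (RintegralZl _ (meas_oo 0 T) i3).
rewrite (ibp_tst (F := fun t => chi (t, x)) (f := fun t => d_t chi (t, x)) ta) ?mulr0//.
by move=> t _; exact: cdx.
Qed.

Lemma tensor_L2c a p : continuous a -> sqi mu D p -> L2_continuous T L (fun t x => a t * p x).
Proof.
move=> ca sp; apply/L2cP => t tT; split; first exact: sqiZ.
have h : (a s - a t) ^+ 2 * nsq mu D p @[s --> t] --> 0.
  have h1 : a s - a t @[s --> t] --> 0 by apply/subr_cvg0; exact: ca.
  have : (a s - a t) * (a s - a t) * nsq mu D p @[s --> t] --> 0 * 0 * nsq mu D p.
    by apply: cvgMl; exact: cvgM.
  rewrite !mul0r.
  by under eq_fun do rewrite -expr2.
apply: cvg_trans (cvg_within_filter _ h); apply: near_eq_cvg; apply: nearW => s.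
by rewrite -nsqZ//; apply: nsq_ext => x _; rewrite mulrBl.
Qed.

Lemma tensor_time_trace a p t : tst 0 T a -> sqi mu D p -> t \in `[0, T] ->
  a t = 0 -> time_trace T L (fun z => a z.1 * p z.2) t (cst 0).
Proof.
move=> ta sp tT at0; split; first by apply/L2IP; exact: sqi_cst.
exists (fun t x => a t * p x); split.
- by apply: aeW => s _; apply: aeW.
- by apply: tensor_L2c => //; exact: tst_cont ta.
- by apply: aeW => x _; rewrite at0 mul0r.
Qed.

Lemma tensor_dx_trace j a p x0 : tst 0 T a -> tst 0 L p -> x0 \notin `]0, L[ ->
  dx_trace T L j (fun z => a z.1 * p z.2) x0 (cst 0).
Proof.
move=> ta tp xL; have tj := tst_derivn j tp; split; first by apply/L2IP; exact: sqi_cst.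
apply: aeW => t _; exists (fun x => a t * derive1n j p x); split.
- by apply: continuous_subspaceT => x; apply: cvgMr; exact: (tst_cont tj).
- exact: (weak_dxZ (a t) (tst_weak j tp)).
- by rewrite (tst_out tj xL) mulr0.
Qed.

Lemma tensor_admissible a p : tst 0 T a -> tst 0 L p ->
  admissible T L (fun z => a z.1 * p z.2) (fun z => derive1 a z.1 * p z.2)
    (fun j z => a z.1 * derive1n j p z.2).
Proof.
move=> ta tp; have ca := tst_cont ta.
have n0 : 0 \notin `]0, T[ by rewrite in_itv/= ltxx.
have nT : T \notin `]0, T[ by rewrite in_itv/= ltxx andbF.
have m0 : 0 \notin `]0, L[ by rewrite in_itv/= ltxx.
have mL : L \notin `]0, L[ by rewrite in_itv/= ltxx andbF.
split.
- move=> j _; split.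
  + by apply/L2QP/tensor_sqi => //; exact: tst_sqi tp.
  + by apply/L2QP/tensor_sqi => //; exact: tst_sqi (tst_derivn j tp).
  + by apply: aeW => t _; exact: (weak_dxZ (a t) (tst_weak j tp)).
- by apply: tensor_weak_dt => //; exact: tst_sqi tp.
- apply: tensor_time_trace => //; first exact: tst_sqi tp.
    by rewrite in_itv/= lexx ltW.
  exact: tst_out ta nT.
- by split; exact: tensor_dx_trace.
Qed.

(** As a and p have compact support, all the traces in the integral identity
    vanish. *)
Lemma weak_solution_tensor b g f u0 mu0 nu0 nu1 u a p :
  weak_solution T L b g f u0 mu0 nu0 nu1 u -> tst 0 T a -> tst 0 L p ->
  \int[mu2]_(z in Q)
    (u z * (derive1 a z.1 * p z.2 + b * (a z.1 * derive1 p z.2) + a z.1 * derive1n 3 p z.2)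
     + g (u z) * (a z.1 * derive1 p z.2) + f z * (a z.1 * p z.2)) = 0.
Proof.
move=> sol ta tp; have m0 : 0 \notin `]0, L[ by rewrite in_itv/= ltxx.
have mL : L \notin `]0, L[ by rewrite in_itv/= ltxx andbF.
have tt : time_trace T L (fun z => a z.1 * p z.2) 0 (cst 0).
  apply: tensor_time_trace => //; first exact: tst_sqi tp.
    by rewrite in_itv/= lexx ltW.
  by apply: (tst_out ta); rewrite in_itv/= ltxx.
have := sol _ _ _ _ _ _ _ (tensor_admissible ta tp) tt (tensor_dx_trace 2 ta tp m0)
  (tensor_dx_trace 2 ta tp mL) (tensor_dx_trace 1 ta tp mL).
have -> : \int[mu]_(x in D) (u0 x * cst 0 x) = 0.
  by rewrite -[RHS](Rintegral_zero mu D); apply: Rint_ext => x _; rewrite mulr0.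
have -> : \int[mu]_(t in I) (mu0 t * cst 0 t - nu0 t * cst 0 t + nu1 t * cst 0 t) = 0.
  by rewrite -[RHS](Rintegral_zero mu I); apply: Rint_ext => t _; rewrite !mulr0 subrr addr0.
by rewrite !addr0.
Qed.

End tensor_tests.

(** * Curves differentiable in time *)

Section time_regularity.
Context {R : realType}.
Local Notation mu := (@lebesgue_measure R).
Local Notation mu2 := (mu \x mu)%E.
Implicit Types (f g a p phi e : R -> R) (x y s t : R) (V Z : R -> R -> R) (h v w d : R * R -> R).
Variables T L : R.
Hypothesis (T0 : 0 < T) (L0 : 0 < L).
Local Notation I := (`]0, T[%classic : set (measurableTypeR R)).
Local Notation D := (`]0, L[%classic : set (measurableTypeR R)).
Local Notation Q := (QT T L : set (measurableTypeR R * measurableTypeR R)).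

Lemma cont_scont e : continuous e -> scont T e.
Proof. by move=> ce t _; apply: cvg_within_filter; exact: ce. Qed.

Lemma scontD e e' : scont T e -> scont T e' -> scont T (fun t => e t + e' t).
Proof. by move=> h h' t tT; apply: cvgD; [exact: h|exact: h']. Qed.

Lemma scontN e : scont T e -> scont T (fun t => - e t).
Proof. by move=> h t tT; apply: cvgN; exact: h. Qed.

Lemma scont_in e t : scont T e -> t \in `]0, T[ -> {for t, continuous e}.
Proof.
move=> he tI; have cc := scont_clamp T0 he; have := cc t; rewrite /prop_for /continuous_at /= clampE; last exact: itv_oo_cc.
apply: cvg_trans; apply: near_eq_cvg; near=> s.
have sI : s \in `]0, T[ by near: s; exact: near_in_itvoo.
by rewrite /= clampE//; exact: itv_oo_cc.
Unshelve. all: by end_near. Qed.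

Lemma cont_ae0 (a b : R) e : a < b -> continuous e ->
  {ae mu, forall x, x \in `]a, b[ -> e x = 0} ->
  forall x, x \in `[a, b] -> e x = 0.
Proof.
move=> ab ce e0 x; rewrite in_itv/= => /andP[ax xb]; apply/eqP/negPn/negP => ex.
have n0 : 0 < `|e x| by rewrite normr_gt0.
move/cvgrPdist_lt : (ce x) => /(_ _ n0)[r /= r0 Hr].
have H : Num.max a (x - r) < Num.min b (x + r).
  rewrite lt_min !gt_max ab; apply/andP; split; [apply/andP; split => //|apply/andP; split]; lra.
apply: (ae_itv_false H); apply: ae_mu e0 => y ey.
rewrite in_itv/= lt_min gt_max => /andP[/andP[ay xry] /andP[yb yxr]].
have /Hr : `|x - y| < r by rewrite ltr_norml; apply/andP; split; lra.
by rewrite /= ey ?subr0 ?ltxx// in_itv/= ay.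
Qed.

(** Extended by clamp, a continuous function that vanishes a.e. vanishes. *)
Lemma scont_ae_eq e e' : scont T e -> scont T e' ->
  {ae mu, forall t, t \in `]0, T[ -> e t = e' t} -> forall t, t \in `[0, T] -> e t = e' t.
Proof.
move=> he he' ee t tT.
have c : continuous (fun s => (e \o clamp T) s - (e' \o clamp T) s).
  by move=> s; apply: cvgB; exact: scont_clamp.
have := cont_ae0 T0 c _ tT; rewrite /= (clampE tT) => h; apply/eqP; rewrite -subr_eq0; apply/eqP.
apply: h; apply: ae_mu ee => s es sI; rewrite (clampE (itv_oo_cc sI)) es ?subrr//.
Qed.

Definition pairing V p t := \int[mu]_(x in D) (V t x * p x).

(** The equations d/dt W_m = W_(m+1), in the sense of distributions on the
    cylinder and tested with products only. *)
Definition time_chain (K : nat) (W : nat -> R -> R -> R) :=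
  (forall m, (m <= K)%N -> L2_continuous T L (W m)) /\
  forall m p a, (m < K)%N -> tst 0 L p -> tst 0 T a ->
    \int[mu]_(t in I) (derive1 a t * pairing (W m) p t) =
    - \int[mu]_(t in I) (a t * pairing (W m.+1) p t).

Lemma weak_dt_pair m v w V a p : weak_dt T L m v w -> curve_of T L w V ->
  L2_continuous T L V -> tst 0 T a -> tst 0 L p ->
  \int[mu2]_(z in Q) (v z * (derive1n m a z.1 * p z.2)) =
  (-1) ^+ m * \int[mu]_(t in I) (a t * pairing V p t).
Proof.
move=> [/L2QP sv /L2QP sw H] wV cV ta tp.
have := H _ (tensor_test ta tp); rewrite (iter_d_t_tensor _ (proj1 ta) (proj1 tp)) => ->.
by rewrite (pairing_tensor T0 sw wV cV (tst_cont ta) (tst_sqi tp)).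
Qed.

(** The test function a^(m+1) p can be read as the m-th time derivative of a' p or
    as the (m+1)-st of a p. *)
Lemma time_chainP K v (W : nat -> R -> R -> R) :
  (forall m, (m <= K)%N -> exists w, [/\ weak_dt T L m v w, curve_of T L w (W m) &
     L2_continuous T L (W m)]) -> time_chain K W.
Proof.
move=> H; split=> [m /H[w []]//|m p a mK tp ta].
have [w [dw cw lw]] := H m (ltnW mK); have [w' [dw' cw' lw']] := H m.+1 mK.
have e1 := weak_dt_pair dw cw lw (tst_deriv ta) tp.
have e2 := weak_dt_pair dw' cw' lw' ta tp.
have E : derive1n m (derive1 a) = derive1n m.+1 a.
  by rewrite -addn1 derive1nD.
rewrite E in e1; rewrite e1 in e2.
apply: (@mulfI _ ((-1) ^+ m)); first by rewrite signr_eq0.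
by rewrite e2 exprS mulN1r mulrN mulNr.
Qed.

Section chain.
Variables (K : nat) (W : nat -> R -> R -> R).
Hypothesis hW : time_chain K W.

Lemma chain_scont m p : (m <= K)%N -> sqi mu D p -> scont T (pairing (W m) p).
Proof. by move=> mK sp; apply: pairing_scont => //; exact: hW.1. Qed.

Lemma pair_prim m p : (m < K)%N -> tst 0 L p ->
  exists c, forall t, t \in `[0, T] -> pairing (W m) p t = c + prim 0 T (pairing (W m.+1) p) t.
Proof.
move=> mK tp; have sp := tst_sqi tp.
have c1 := chain_scont (ltnW mK) sp; have c2 := chain_scont mK sp.
have s1 := scont_sqi T0 c1; have s2 := scont_sqi T0 c2.
have [c Hc] : exists c, {ae mu, forall x, x \in `]0, T[ -> pairing (W m) p x = c + prim 0 T (pairing (W m.+1) p) x}.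
  apply: (weak_char T0 s1 s2) => a ta.
  rewrite (Rint_ext mu (g := fun t => derive1 a t * pairing (W m) p t)); last by move=> t _; rewrite mulrC.
  rewrite (hW.2 _ _ _ mK tp ta); congr (- _).
  by apply: Rint_ext => t _; rewrite mulrC.
exists c; apply: scont_ae_eq => //; apply: cont_scont; exact: contv.
Qed.

Lemma chain_derive m p t : (m < K)%N -> tst 0 L p -> t \in `]0, T[ ->
  is_derive t (1 : R) (pairing (W m) p) (pairing (W m.+1) p t).
Proof.
move=> mK tp tI; have [c Hc] := pair_prim mK tp.
have c2 := chain_scont mK (tst_sqi tp).
have d : is_derive t (1 : R) (fun t => c + prim 0 T (pairing (W m.+1) p) t) (0 + pairing (W m.+1) p t).
  apply: (isdD (isd_cst c t)).
  apply: prim_cont_derive => //; first exact: scont_sqi.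
  exact: scont_in.
apply: near_eq_is_derive (isd_eq d (add0r _)).
near=> s; rewrite -Hc//; apply: itv_oo_cc.
by near: s; exact: near_in_itvoo.
Unshelve. all: by end_near. Qed.

End chain.

Lemma itg_of_sqi h : sqi mu2 Q h -> itg mu2 Q h.
Proof.
move=> sh; have c1 : continuous (fun _ : R => 1 : R) by exact: cst_continuous.
have s1 := tensor_sqi T c1 (@sqi_cst R 0 L 1).
by apply: (itg_ext (meas_QT T L) _ (sqi_mul (meas_QT T L) sh s1)) => z _; rewrite !mulr1.
Qed.

Lemma time_step_sqi d t : sqi mu2 Q d -> sqi mu2 Q (fun z => d z * (z.1 <= t)%R%:R).
Proof.
move=> sd; have [md _] := sd; apply: (sqi_le (meas_QT T L) _ sd).
  apply: measurable_funM => //.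
  apply: (@measurable_funTS _ _ _ _ _ ((fun s : R => (s <= t)%R%:R : R) \o fst)).
  apply: measurableT_comp => //.
  rewrite (_ : (fun s : R => _) = \1_(`]-oo, t]%classic)).
    by apply: measurable_indic; exact: measurable_itv.
  by apply/funext => s; rewrite indicE mem_setE in_itv.
by move=> z _; rewrite normrM ler_piMr//; case: (z.1 <= t); rewrite ?normr1 ?normr0.
Qed.

Section time_primitive.
Variable d : R * R -> R.
Hypothesis sd : sqi mu2 Q d.
Local Notation P t := (fun x : R => prim 0 T (fun s => d (s, x)) t).

Lemma tprim_sqi t : sqi mu D (P t).
Proof.
have [_ i1 _] := fubini_xt (itg_of_sqi (time_step_sqi t sd)).
have [_ i2 _] := fubini_xt sd.2.
have mP : measurable_fun D (P t) := itg_meas i1.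
split => //; apply: (itg_le_ae (meas_oo 0 L) _ (itgZ (meas_oo 0 L) T i2)).
  exact: measurable_funX.
apply: ae_mu (sqi_section_x sd) => x sx xD.
rewrite ger0_norm ?sqr_ge0// (le_trans (prim_sqr_le t (ltW T0) (sx xD)))//.
by rewrite subr0.
Qed.

(** Cauchy-Schwarz in time gives Hoelder continuity of exponent 1/2 in L_2. *)
Lemma tprim_L2c : L2_continuous T L (fun t => P t).
Proof.
apply/L2cP => t tT; split; first exact: tprim_sqi.
have [_ i2 _] := fubini_xt sd.2.
set M := \int[mu]_(x in D) \int[mu]_(s in I) d (s, x) ^+ 2.
have h : M * `|s - t| @[s --> t] --> 0.
  apply: cvg0Z; rewrite -[X in _ --> X](normr0 R); apply: cvg_norm.
  rewrite -[X in _ --> X](subrr t); apply: cvgB; [exact: cvg_id|exact: cvg_cst].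
apply: (@squeeze_cvgr _ _ _ _ (fun=> 0) _ _ _ _ (cvg_cst _) (cvg_within_filter _ h)).
apply: nearW => s; rewrite nsq_ge0/= mulrC /M -(RintegralZl _ (meas_oo 0 L) i2).
have sB := sqiB (meas_oo 0 L) (tprim_sqi s) (tprim_sqi t).
apply: (Rint_le_ae (meas_oo 0 L) sB.2 (itgZ (meas_oo 0 L) _ i2)); first by move=> x; exact: sqr_ge0.
apply: ae_mu (sqi_section_x sd) => x sx xD.
by rewrite mulrC; exact: prim_holder (sx xD).
Qed.

Lemma tprim_pair t p : sqi mu D p ->
  pairing (fun t => P t) p t = prim 0 T (fun s => \int[mu]_(x in D) (d (s, x) * p x)) t.
Proof.
move=> sp; have c1 : continuous (fun _ : R => 1 : R) by exact: cst_continuous.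
have i := sqi_mul (meas_QT T L) (time_step_sqi t sd) (tensor_sqi T c1 sp).
have [_ j1 E1] := fubini_tx i; have [_ j2 E2] := fubini_xt i.
rewrite /pairing /prim.
transitivity (\int[mu]_(x in D) \int[mu]_(s in I) (d (s, x) * (s <= t)%R%:R * (1 * p x))).
  apply: (ae_Rint (meas_oo 0 L)).
  - by have [m1 _] := tprim_sqi t; have [m2 _] := sp; exact: measurable_funM.
  - exact: itg_meas j2.
  - apply: ae_mu (sqi_section_x sd) => x sx xD; have {}sx := sx xD.
    rewrite mulrC -(RintegralZl _ (meas_oo 0 T) (step_itg t (sqi_itg sx))).
    by apply: Rint_ext => s _; rewrite mul1r mulrC.
rewrite -E2 E1; apply: Rint_ext => s _ /=.
have [st|st] := boolP (s <= t); last first.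
  rewrite mulr0 -[RHS](Rintegral_zero mu D); apply: Rint_ext => x _.
  by rewrite mulr0 mul0r.
by rewrite mulr1; apply: Rint_ext => x _; rewrite mulr1 mul1r.
Qed.

End time_primitive.

(** At some time t0 the weak x-derivative exists.  Adding to it the time
    integral of the x-derivative d' of W_(m+1) gives a continuous curve, and it
    is the x-derivative of W_m at all times because the pairings with test
    functions agree at t0 and have the same time derivative. *)
Lemma chain_CH1 K W m d d' : time_chain K W -> (m < K)%N ->
  sqi mu2 Q d -> sqi mu2 Q d' ->
  {ae mu, forall t, t \in `]0, T[ -> weak_dx L 1 (W m t) (fun x => d (t, x))} ->
  {ae mu, forall t, t \in `]0, T[ -> weak_dx L 1 (W m.+1 t) (fun x => d' (t, x))} ->
  exists2 V, L2_continuous T L V & forall t, t \in `[0, T] -> weak_dx L 1 (W m t) (V t).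
Proof.
move=> hW mK sd sd' Hd Hd'.
have [t0 t0I wt0] : exists2 t, t \in `]0, T[ & weak_dx L 1 (W m t) (fun x => d (t, x)).
  apply: contrapT => H; apply: (ae_itv_false T0); apply: ae_mu Hd => t h tI.
  by apply: H; exists t => //; exact: h.
pose P t x := prim 0 T (fun s => d' (s, x)) t.
have cP : L2_continuous T L P := tprim_L2c sd'.
have sdt0 : sqi mu D (fun x => d (t0, x)) by have [] := (weak1P _ _ _).1 wt0.
have sP t : sqi mu D (P t) := tprim_sqi sd' t.
pose V t x := d (t0, x) - P t0 x + P t x.
have s0 := sqiB (meas_oo 0 L) sdt0 (sP t0).
have cV : L2_continuous T L V.
  apply: L2cD => //; have := tensor_L2c (T := T) (@cst_continuous R R 1) s0.
  by congr L2_continuous; apply/funext => t; apply/funext => x; rewrite mul1r.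
exists V => // t tT; apply/weak1P; split; [exact: L2c_sqi (hW.1 _ (ltnW mK)) tT|exact: L2c_sqi cV tT|].
move=> phi tphi; have tphi' := tst_deriv tphi; have sphi := tst_sqi tphi.
have e1 : \int[mu]_(x in D) (V t x * phi x) =
   \int[mu]_(x in D) (d (t0, x) * phi x) - pairing P phi t0 + pairing P phi t.
  rewrite /pairing -(RintegralB (meas_oo 0 L) (sqi_mul (meas_oo 0 L) sdt0 sphi) (sqi_mul (meas_oo 0 L) (sP t0) sphi)).
  rewrite -(RintegralD (meas_oo 0 L) _ (sqi_mul (meas_oo 0 L) (sP t) sphi)); last first.
    exact: (itgB (meas_oo 0 L) (sqi_mul (meas_oo 0 L) sdt0 sphi) (sqi_mul (meas_oo 0 L) (sP t0) sphi)).
  by apply: Rint_ext => x _; rewrite /V; ring.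
have eP s : pairing P phi s = - prim 0 T (pairing (W m.+1) (derive1 phi)) s.
  rewrite tprim_pair// /prim -(mulN1r (Rintegral _ _ _)).
  have cW := chain_scont hW mK (tst_sqi tphi').
  rewrite -(RintegralZl _ (meas_oo 0 T) (step_itg s (sqi_itg (scont_sqi T0 cW)))).
  have c1 : continuous (fun _ : R => 1 : R) by exact: cst_continuous.
  have [_ j1 _] := fubini_tx (sqi_mul (meas_QT T L) sd' (tensor_sqi T c1 sphi)).
  have j2 : itg mu I (fun s => \int[mu]_(x in D) (d' (s, x) * phi x)).
    by apply: (itg_ext (meas_oo 0 T) _ j1) => r _; apply: Rint_ext => x _; rewrite mul1r.
  apply: (ae_Rint (meas_oo 0 T)).
  - exact: itg_meas (step_itg s j2).
  - exact: itg_meas (itgZ (meas_oo 0 T) _ (step_itg s (sqi_itg (scont_sqi T0 cW)))).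
  - apply: ae_mu Hd' => r h rI; have /weak1P[_ _ /(_ _ tphi) E] := h rI.
    by rewrite /pairing E mulrA mulN1r opprK.
rewrite e1 !eP; have [_ _ /(_ _ tphi)] := (weak1P _ _ _).1 wt0.
have [c Hc] := pair_prim hW mK tphi'.
rewrite -/(pairing (W m) (derive1 phi) t0) -/(pairing (W m) (derive1 phi) t) !Hc//; last exact: itv_oo_cc.
have key (A B C X : R) : C + B = - X -> C + A = - (X - - B + - A) by move=> /(congr1 -%R); rewrite opprK => <-; ring.
exact: key.
Qed.

Lemma nsq0_ae f : sqi mu D f -> nsq mu D f = 0 -> {ae mu, forall x, x \in `]0, L[ -> f x = 0}.
Proof.
move=> sf f0; apply: (fundamental sf) => phi tphi.
have := cauchy_schwarz (meas_oo 0 L) sf (tst_sqi tphi); rewrite f0 mul0r => h.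
by apply/eqP; rewrite -sqrf_eq0 eq_le h sqr_ge0.
Qed.

(** If |H x| > C, the same holds near x with a constant sign, and a bump
    concentrated there contradicts the bound. *)
Lemma sup_by_pairing (H : R -> R) (C : R) x : continuous H ->
  (forall p, tst 0 L p -> (forall y, 0 <= p y) ->
     `|\int[mu]_(y in D) (H y * p y)| <= C * \int[mu]_(y in D) p y) ->
  x \in `]0, L[ -> `|H x| <= C.
Proof.
move=> cH HH xD; rewrite leNgt; apply/negP => Cx.
wlog H0 : H cH HH Cx / 0 <= H x.
  move=> W; have [h|h] := leP 0 (H x); first exact: (W H).
  apply: (W (fun y => - H y)).
  - by move=> y; apply: cvgN; exact: cH.
  - move=> p tp p0; have i : itg mu D (fun y => H y * p y).
      exact: (sqi_mul (meas_oo 0 L) (sqi_cont _ _ cH) (tst_sqi tp)).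
    rewrite (Rint_ext mu (g := fun y => (-1) * (H y * p y))); last by move=> y _; rewrite mulN1r mulNr.
    by rewrite (RintegralZl _ (meas_oo 0 L) i) mulN1r normrN; exact: HH.
  - by rewrite normrN.
  - by rewrite oppr_ge0 ltW.
rewrite (ger0_norm H0) in Cx.
pose e := (H x - C) / 2.
have e0 : 0 < e by rewrite divr_gt0// subr_gt0.
move/cvgrPdist_lt : (cH x) => /(_ _ e0)[r /= r0 Hr].
have := xD; rewrite in_itv/= => /andP[x0 xL].
pose A := Num.max (x / 2) (x - r); pose B := Num.min ((x + L) / 2) (x + r).
have A0 : 0 < A by rewrite lt_max divr_gt0.
have BL : B < L by rewrite gt_min; apply/orP; left; lra.
have AB : A < B.
  by rewrite lt_min !gt_max; apply/andP; split; apply/andP; split; lra.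
pose q := flatbump 1 A B; have tq : tst 0 L q by exact: flatbump_tst.
(* The square of a bump, whose integral is positive by nsq0_ae. *)
pose p y := q y * q y.
have tp : tst 0 L p.
  have [sq [c [d [c0 dL q0]]]] := tq; split; first exact: smooth1M.
  by exists c, d; split => // y /q0; rewrite /p => ->; rewrite mul0r.
have p0 y : 0 <= p y by rewrite /p -expr2 sqr_ge0.
have sp := tst_sqi tp; have sq := tst_sqi tq.
have ip : itg mu D p := sqi_itg sp.
have iHp : itg mu D (fun y => H y * p y).
  exact: (sqi_mul (meas_oo 0 L) (sqi_cont _ _ cH) sp).
have pos : 0 < \int[mu]_(y in D) p y.
  rewrite (Rint_ext mu (g := fun y => q y ^+ 2)); last by move=> y _; rewrite expr2.
  rewrite lt_def -/(nsq mu D q) nsq_ge0 andbT; apply/eqP => E.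
  apply: (ae_itv_false AB); apply: ae_mu (nsq0_ae sq E) => y hy yAB.
  have : q y != 0.
    by rewrite /q flatbumpE; move: yAB; rewrite in_itv/= => ->; rewrite gt_eqF// expR_gt0.
  rewrite hy ?eqxx//; move: yAB; rewrite !in_itv/= => /andP[h1 h2].
  by rewrite (lt_trans A0 h1) (lt_trans h2 BL).
have := HH p tp p0; apply/negP; rewrite -ltNge.
apply: (@lt_le_trans _ _ (\int[mu]_(y in D) ((C + e) * p y))).
  by rewrite (RintegralZl _ (meas_oo 0 L) ip) ltr_pM2r// ltrDl.
apply: le_trans (ler_norm _); apply: (le_Rintegral (meas_oo 0 L) (itgZ (meas_oo 0 L) _ ip) iHp).
move=> y _; have [qy|qy] := eqVneq (q y) 0; first by rewrite /p qy !mulr0.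
have /andP[h1 h2] : A < y < B.
  by move: qy; rewrite /q flatbumpE; case: ifP => //; rewrite eqxx.
apply: ler_wpM2r => //.
have : `|x - y| < r.
  by move: h1 h2; rewrite gt_max lt_min ltr_norml => /andP[_ ?] /andP[_ ?]; apply/andP; split; lra.
by move/Hr; rewrite /= ltr_norml /e => /andP[h3 h4]; lra.
Qed.

Lemma is_derive_small (k : R -> R) (t l : R) :
  (forall e : R, 0 < e -> \forall s \near t, `|k s - k t - (s - t) * l| <= e * `|s - t|) ->
  is_derive t (1 : R) k l.
Proof.
move=> H.
have lim : (fun h : R => h^-1 *: (k (h *: (1 : R) + t) - k t)) @ (0 : R)^' --> l.
  apply/cvgrPdist_le => e e0; have [r /= r0 Hr] := H _ e0.
  rewrite near_withinE; exists r => //= h; rewrite /ball_ /= sub0r normrN => hr h0.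
  rewrite [h *: 1]mulr1 /GRing.scale/=.
  have /Hr : `|t - (h + t)| < r by rewrite opprD addrCA subrr addr0 normrN.
  rewrite /= addrK => Hh.
  have -> : l - h^-1 * (k (h + t) - k t) = - (h^-1 * (k (h + t) - k t - h * l)).
    by rewrite [in RHS]mulrBr opprB mulKf.
  by rewrite normrN normrM normfV mulrC ler_pdivrMr ?normr_gt0.
by apply: DeriveDef; [apply/cvg_ex; exists l|exact: cvg_lim lim].
Qed.

Lemma MVT_ball (k dk : R -> R) (t r s : R) :
  (forall q, `|q - t| < r -> is_derive q (1 : R) k (dk q)) -> `|s - t| < r ->
  exists2 c, `|c - t| < r & k s - k t = dk c * (s - t).
Proof.
move=> H st; have ck q : `|q - t| < r -> {for q, continuous k}.
  by move=> /H d; apply: derivable_cont; exact: ex_derive.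
have [ts|ts] := leP t s.
  have tsr : s - t < r by move: st; rewrite ger0_norm// subr_ge0.
  have Hq q : q \in `[t, s] -> `|q - t| < r.
    by rewrite in_itv/= => /andP[tq qs]; rewrite ger0_norm ?subr_ge0//; lra.
  have [||c cI E] := @MVT_segment _ k dk t s ts.
  - by move=> q qI; apply/H/Hq; apply: subset_itvW qI.
  - by apply/continuous_in_subspaceT => q /set_mem qI; exact/ck/Hq.
  by exists c => //; exact: Hq.
have tsr : t - s < r by move: st; rewrite distrC ger0_norm// subr_ge0 ltW.
have Hq q : q \in `[s, t] -> `|q - t| < r.
  by rewrite in_itv/= => /andP[tq qs]; rewrite distrC ger0_norm ?subr_ge0//; lra.
have [||c cI E] := @MVT_segment _ k dk s t (ltW ts).
- by move=> q qI; apply/H/Hq; apply: subset_itvW qI.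
- by apply/continuous_in_subspaceT => q /set_mem qI; exact/ck/Hq.
by exists c; [exact: Hq|rewrite -opprB E -mulrN opprB].
Qed.

(** Only pairings are known to be differentiable.  By the mean value theorem the
    pairing of U s - U t - (s - t) U' t with p >= 0 is at most e |s - t| int p, with
    e independent of p, and sup_by_pairing makes this bound pointwise. *)
Lemma Ccurve_time_derive U U' : Ccurve T U -> Ccurve T U' ->
  (forall p t, tst 0 L p -> t \in `]0, T[ -> is_derive t (1 : R) (pairing U p) (pairing U' p t)) ->
  forall t x, t \in `]0, T[ -> x \in `]0, L[ ->
    is_derive t (1 : R) (fun s => U s x) (U' t x).
Proof.
move=> hU hU' dU t x tI xD; apply: is_derive_small => e e0.
have [_ cU _] := hU; have [_ cU' uU'] := hU'.
have tT := itv_oo_cc tI.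
have : \forall s \near t, (s \in `]0, T[) /\ forall x, `|U' s x - U' t x| <= e.
  have := uU' t e tT e0; rewrite near_withinE => h; near=> s.
  have sI : s \in `]0, T[ by near: s; exact: near_in_itvoo.
  by split => //; apply: (near h s) => //; exact: itv_oo_cc.
move=> [r /= r0 Hr]; exists r => //= s ts.
have Hr' q : `|q - t| < r -> (q \in `]0, T[) /\ forall x, `|U' q x - U' t x| <= e.
  by rewrite distrC => /Hr.
have str : `|s - t| < r by rewrite distrC.
have [sI _] := Hr' s str; have sT := itv_oo_cc sI.
pose H y := U s y - U t y - (s - t) * U' t y.
have cH : continuous H.
  by move=> y; apply: cvgB; [apply: cvgB; exact: cU|apply: cvgMr; exact: cU'].
apply: (@sup_by_pairing H _ x cH) => // p tp p0; have sp := tst_sqi tp.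
have i1 := sqi_mul (meas_oo 0 L) (Ccurve_sqi L hU sT) sp.
have i2 := sqi_mul (meas_oo 0 L) (Ccurve_sqi L hU tT) sp.
have i3 := sqi_mul (meas_oo 0 L) (Ccurve_sqi L hU' tT) sp.
have -> : \int[mu]_(y in D) (H y * p y) = pairing U p s - pairing U p t - (s - t) * pairing U' p t.
  rewrite /pairing -(RintegralB (meas_oo 0 L) i1 i2) -(RintegralZl _ (meas_oo 0 L) i3).
  rewrite -(RintegralB (meas_oo 0 L) (itgB (meas_oo 0 L) i1 i2) (itgZ (meas_oo 0 L) _ i3)).
  by apply: Rint_ext => y _; rewrite /H; ring.
have dk q : `|q - t| < r -> is_derive q (1 : R) (fun q => pairing U p q + - (q * pairing U' p t))
    (pairing U' p q - pairing U' p t).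
  move=> /Hr'[qI _]; have d := dU p q tp qI.
  have d2 := isdN (isdM (isd_id q) (isd_cst (pairing U' p t) q)).
  by apply: (isd_eq (isdD d d2)); rewrite mulr0 add0r mulr1.
have [c ct E] := MVT_ball dk str.
have -> : pairing U p s - pairing U p t - (s - t) * pairing U' p t =
    (pairing U' p c - pairing U' p t) * (s - t) by rewrite -E; ring.
have [cI Hc] := Hr' c ct; have i4 := sqi_mul (meas_oo 0 L) (Ccurve_sqi L hU' (itv_oo_cc cI)) sp.
rewrite normrM mulrAC ler_wpM2r//.
rewrite /pairing -(RintegralB (meas_oo 0 L) i4 i3) -(RintegralZl _ (meas_oo 0 L) (sqi_itg sp)).
apply: le_trans (le_normr_Rintegral (meas_oo 0 L) (itgB (meas_oo 0 L) i4 i3)) _.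
have iB := itgB (meas_oo 0 L) i4 i3.
apply: (le_Rintegral (meas_oo 0 L) (itg_norm iB) (itgZ (meas_oo 0 L) _ (sqi_itg sp))) => y _.
by rewrite -mulrBl normrM (ger0_norm (p0 y)) ler_wpM2r.
Unshelve. all: by end_near. Qed.

Lemma Ccurve_pair_derive Z Z' p t : Ccurve T Z -> Ccurve T Z' -> sqi mu D p ->
  (forall t x, t \in `]0, T[ -> x \in `]0, L[ -> is_derive t (1 : R) (fun s => Z s x) (Z' t x)) ->
  t \in `]0, T[ -> is_derive t (1 : R) (pairing Z p) (pairing Z' p t).
Proof.
move=> hZ hZ' sp dZ tI; have [M M0 HM] := Ccurve_pos T0 hZ'.
have d s x : s \in `]0, T[ -> x \in `]0, L[ ->
    is_derive s (1 : R) (fun s => Z s x * p x) (Z' s x * p x).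
  move=> sI xD; apply: (isd_eq (isdM (dZ s x sI xD) (isd_cst (p x) s))).
  by rewrite mulr0 add0r mulrC.
have pE s x : s \in `]0, T[ -> x \in `]0, L[ ->
    partial1of2 (fun s x => Z s x * p x) s x = Z' s x * p x.
  by move=> sI xD; rewrite /partial1of2; apply: is_derive_derive1; exact: d.
have ip s : s \in `]0, T[ -> mu.-integrable D (EFin \o (fun x => Z s x * p x)).
  by move=> sI; exact: (sqi_mul (meas_oo 0 L) (Ccurve_sqi L hZ (itv_oo_cc sI)) sp).
have dd s x : s \in `]0, T[ -> x \in `]0, L[ -> derivable (fun s => Z s x * p x) s 1.
  by move=> sI xD; have := d s x sI xD => ?; exact: ex_derive.
have G0 x : 0 <= M * `|p x| by rewrite mulr_ge0.
have iG : mu.-integrable D (EFin \o (fun x => M * `|p x|)).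
  exact: (itgZ (meas_oo 0 L) M (itg_norm (sqi_itg sp))).
have Gb s x : s \in `]0, T[ -> x \in `]0, L[ ->
    `|partial1of2 (fun s x => Z s x * p x) s x| <= M * `|p x|.
  by move=> sI xD; rewrite pE// normrM ler_wpM2r// HM//; exact: itv_oo_cc.
apply: DeriveDef.
  exact: (derivable_under_integral (meas_oo 0 L) tI ip dd G0 iG Gb).
rewrite -derive1E.
rewrite (differentiation_under_integral (meas_oo 0 L) tI ip dd G0 iG Gb).
by apply: Rint_ext => x xD; rewrite pE.
Qed.

Lemma Ccurve_chain K (Z : nat -> R -> R -> R) :
  (forall m, (m <= K)%N -> Ccurve T (Z m)) ->
  (forall m t x, (m < K)%N -> t \in `]0, T[ -> x \in `]0, L[ ->
    is_derive t (1 : R) (fun s => Z m s x) (Z m.+1 t x)) ->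
  time_chain K Z.
Proof.
move=> cZ dZ; split; first by move=> m /cZ; exact: Ccurve_L2c.
move=> m p a mK tp ta; have sp := tst_sqi tp.
have cc m' : (m' <= K)%N -> scont T (pairing (Z m') p).
  by move=> mK'; apply: pairing_scont => //; apply: Ccurve_L2c => //; exact: cZ.
have s1 := scont_sqi T0 (cc _ (ltnW mK)); have s2 := scont_sqi T0 (cc _ mK).
have d t : t \in `]0, T[ -> is_derive t (1 : R) (pairing (Z m) p) (pairing (Z m.+1) p t).
  by apply: Ccurve_pair_derive => // [||s x]; [exact: cZ (ltnW mK)|exact: cZ|exact: dZ].
have c t : t \in `]0, T[ -> {for t, continuous (pairing (Z m.+1) p)}.
  by move=> tI; apply: scont_in => //; exact: cc.
have := ibp_tst ta d c.
have i1 := sqi_mul (meas_oo 0 T) s1 (tst_sqi (tst_deriv ta)).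
have i2 := sqi_mul (meas_oo 0 T) (tst_sqi ta) s2.
rewrite (RintegralD (meas_oo 0 T) i1 i2) => /eqP; rewrite addr_eq0 => /eqP <-.
by apply: Rint_ext => t _; rewrite mulrC.
Qed.

End time_regularity.

(** * Gain of spatial derivatives *)

Section spatial_regularity.
Context {R : realType}.
Local Notation mu := (@lebesgue_measure R).
Local Notation mu2 := (mu \x mu)%E.
Implicit Types (f g a p phi e : R -> R) (x y t : R) (V Z S N : R -> R -> R) (v w : R * R -> R).
Variables T L : R.
Hypothesis (T0 : 0 < T) (L0 : 0 < L).
Local Notation I := (`]0, T[%classic : set (measurableTypeR R)).
Local Notation D := (`]0, L[%classic : set (measurableTypeR R)).
Local Notation Q := (QT T L : set (measurableTypeR R * measurableTypeR R)).

(** Test the derivative of order j with phi' in place of phi. *)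
Lemma weak_dx_step j f h h' : weak_dx L j f h -> weak_dx L j.+1 f h' -> weak_dx L 1 h h'.
Proof.
move=> /weak_dxP[sf sh H] /weak_dxP[_ sh' H']; apply/weak1P; split => // phi tphi.
have := H _ (tst_deriv tphi).
have -> : derive1n j (derive1 phi) = derive1n j.+1 phi by rewrite -addn1 derive1nD.
rewrite H'// exprS -mulrA mulN1r => E; apply/eqP; rewrite eq_sym; apply/eqP.
by apply: (@mulfI _ ((-1) ^+ j)); rewrite ?signr_eq0// mulrN.
Qed.

Lemma C_H_CH s v : C_H T L s v -> exists2 V, curve_of T L v V & CH T L s V.
Proof.
move=> [W [vW cW wW]]; exists (W 0%N) => //.
suff H i : (i <= s)%N -> CH T L i (W (s - i)%N) by have := H s (leqnn s); rewrite subnn.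
elim: i => [|i IH] iS; first by rewrite subn0; split => //; exact: cW.
have e : (s - i)%N = (s - i.+1).+1 by rewrite -subSn.
split; first by apply: cW; exact: leq_subr.
exists (W (s - i)%N); split; last by apply: IH; exact: ltnW.
move=> t tT; apply: (weak_dx_step (wW _ _ _ tT)); first exact: leq_subr.
by rewrite e; apply: wW => //; rewrite -e leq_subr.
Qed.

Lemma CH_chain s V : CH T L s V -> exists W : nat -> R -> R -> R,
  [/\ W 0%N = V, forall j, (j <= s)%N -> L2_continuous T L (W j) &
      forall j t, (j <= s)%N -> t \in `[0, T] -> weak_dx L j (V t) (W j t)].
Proof.
elim: s V => [|s IH] V [cV].
  move=> _; exists (fun=> V); split => // j t; rewrite leqn0 => /eqP -> tT.
  by apply: weak_dx0; exact: L2c_sqi cV tT.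
move=> [V' [wV /IH[W [W0 cW wW]]]].
exists (fun j => if j is j'.+1 then W j' else V); split => // -[|j]//.
- by move=> js; exact: cW.
- by move=> t _ tT; apply: weak_dx0; exact: L2c_sqi cV tT.
- move=> t js tT; rewrite -add1n; apply: (weak_dx_comp (wV t tT)).
  exact: wW.
Qed.

Lemma CH_C_H s v V : curve_of T L v V -> CH T L s V -> C_H T L s v.
Proof.
by move=> vV /CH_chain[W [W0 cW wW]]; exists W; rewrite W0.
Qed.

Lemma CH_weak_Q s j v V : (j <= s)%N -> L2Q T L v -> curve_of T L v V -> CH T L s V ->
  exists w, weak_dx_Q T L j v w.
Proof.
move=> js sv vV /CH_chain[W [_ cW wW]].
have [w [sw wE]] := measurable_version T0 (cW _ js).
exists w; split => //; first exact/L2QP.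
have sv' := (L2QP _ _ _).1 sv.
have sect : {ae mu, forall t, t \in `]0, T[ ->
    sqi mu D (fun x => v (t, x)) /\ sqi mu D (fun x => w (t, x))}.
  by apply: ae_mu2 (sqi_section sv') (sqi_section sw) => t h1 h2 tI; split; [exact: h1|exact: h2].
apply: ae_mu2 vV sect => t h sq tI; have [s1 s2] := sq tI.
apply: (weak_dx_ext s1 s2 _ _ (wW _ _ js (itv_oo_cc tI))).
- by apply: ae_mu (h tI) => x h' xD; rewrite h'.
- by apply: ae_mu (wE t tI) => x h' xD; rewrite h'.
Qed.

Lemma prim_weak1 h : sqi mu D h -> weak_dx L 1 (prim 0 L h) h.
Proof.
move=> sh; apply/weak1P; split => //; first exact: prim0_sqi.
move=> phi tphi; rewrite -(prim_weak 0 sh tphi).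
by apply: Rint_ext => x _; rewrite add0r.
Qed.

Lemma L2c_prim V : L2_continuous T L V -> L2_continuous T L (fun t => prim 0 L (V t)).
Proof.
move=> cV; apply/L2cP => t tT; have [sV V0] := (L2cP T L V).1 cV t tT.
split; first exact: prim0_sqi.
have h : L * L * nsq mu D (fun x => V s x - V t x) @[s --> within `[0, T] (nbhs t)] --> 0.
  exact: cvg0Z.
apply: (@squeeze_cvgr _ _ _ _ (fun=> 0) _ _ _ _ (cvg_cst _) h).
apply: near_within_cc => s sT; rewrite nsq_ge0/=; have sVs := L2c_sqi cV sT.
have sB := sqiB (meas_oo 0 L) sVs sV.
apply: (@le_trans _ _ (\int[mu]_(x in D) (L * nsq mu D (fun x => V s x - V t x)))).
  apply: (le_Rintegral (meas_oo 0 L)).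
  - have [] := sqiB (meas_oo 0 L) (prim0_sqi sVs) (prim0_sqi sV); done.
  - exact: itg_cst.
  - move=> x _; rewrite -primB; [|exact: sqi_itg|exact: sqi_itg].
    by rewrite -[X in X * _]subr0; apply: prim_sqr_le => //; exact: ltW.
by rewrite Rintegral_cst// mu_itvE ?(ltW L0)// subr0 mulrAC.
Qed.

Lemma CH_prim s V : CH T L s V -> CH T L s.+1 (fun t => prim 0 L (V t)).
Proof.
move=> hV; have cV := CH_L2c hV; split; first exact: L2c_prim.
exists V; split => // t tT; apply: prim_weak1; exact: L2c_sqi cV tT.
Qed.

Section elliptic.
Variables (V N S : R -> R -> R).
(** The equation V''' + N' = S at time t, in the sense of distributions. *)
Definition third_order t := forall p, tst 0 L p ->
  \int[mu]_(x in D) (V t x * derive1n 3 p x) + \int[mu]_(x in D) (N t x * derive1 p x)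
  + \int[mu]_(x in D) (S t x * p x) = 0.

Hypothesis eqV : forall t, t \in `[0, T] -> third_order t.

(** Integrating the equation once, V'' + N - prim S does not depend on x.  Its
    value beta t is found by testing with a function psi of mass one, which shows
    that it is continuous in t. *)
Lemma elliptic_gain s r : CH T L 1 V -> CH T L s N -> CH T L r S -> (s <= r.+1)%N ->
  CH T L s.+2 V.
Proof.
move=> [cV [D1 [wV [cD1 _]]]] hN hS sr; split => //; exists D1; split => //; split => //.
have [psi tpsi psi1] := unit_tst L0.
have cN := CH_L2c hN; have cS := CH_L2c hS.
pose M t x := prim 0 L (S t) x - N t x.
have hM : CH T L s M.
  have h1 : CH T L s (fun t => prim 0 L (S t)) by apply: CH_le sr _; exact: CH_prim.
  have := CHD h1 (CHZ (-1) hN); congr CH.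
  by apply/funext => t; apply/funext => x; rewrite mulN1r.
have cM := CH_L2c hM.
have tpsi' := tst_deriv tpsi.
pose beta t := - (pairing L D1 (derive1 psi) t + pairing L M psi t).
have cbeta : scont T beta.
  apply: scontN; apply: scontD; apply: pairing_scont => //; exact: tst_sqi.
exists (fun t x => M t x + beta t); split; last first.
  by apply: CHD => //; exact: CH_cst.
move=> t tT; have sD1 := L2c_sqi cD1 tT; have sM := L2c_sqi cM tT.
have sN := L2c_sqi cN tT; have sS := L2c_sqi cS tT.
have sb : sqi mu D (fun=> beta t) := sqi_cst 0 L (beta t).
apply/weak1P; split => //; first exact: sqiD.
have key p : tst 0 L p -> \int[mu]_(x in D) (D1 t x * derive1n 2 p x) =
    - \int[mu]_(x in D) (M t x * derive1 p x).
  move=> tp; have tp' := tst_deriv tp; have tp2 := tst_derivn 2 tp.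
  have /weak1P[_ _ /(_ _ tp2) e1] := wV t tT.
  have /weak1P[sP _ /(_ _ tp) e2] := prim_weak1 sS.
  have e3 := eqV tT tp.
  rewrite -derive1nS in e1; rewrite e1 in e3.
  have -> : \int[mu]_(x in D) (M t x * derive1 p x) =
      \int[mu]_(x in D) (prim 0 L (S t) x * derive1 p x) - \int[mu]_(x in D) (N t x * derive1 p x).
    rewrite -(RintegralB (meas_oo 0 L) (sqi_mul (meas_oo 0 L) sP (tst_sqi tp')) (sqi_mul (meas_oo 0 L) sN (tst_sqi tp'))).
    by apply: Rint_ext => x _; rewrite /M mulrBl.
  move: e2 e3; set A := Rintegral _ _ _; set B := Rintegral _ _ _; set C := Rintegral _ _ _ => -> e3.
  by move/eqP: e3; rewrite -addrA addrC addr_eq0 opprK => /eqP <-; rewrite opprB opprK addrC.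
move=> phi tphi; pose c := \int[mu]_(x in D) phi x.
(* A test function of mean zero, hence the derivative of the test function
   prim 0 L q, to which key applies. *)
pose q x := phi x + (- c) * psi x.
have tq : tst 0 L q by apply: tstD => //; exact: tstZ.
have iphi := sqi_itg (tst_sqi tphi); have ipsi := sqi_itg (tst_sqi tpsi).
have q0 : \int[mu]_(x in D) q x = 0.
  rewrite (RintegralD (meas_oo 0 L) iphi (itgZ (meas_oo 0 L) _ ipsi)) (RintegralZl _ (meas_oo 0 L) ipsi).
  by rewrite psi1 mulr1 subrr.
have [tp dp] := zero_mean_prim tq q0.
have := key _ tp.
have -> : derive1n 2 (prim 0 L q) = derive1 q by rewrite derive1nS /= dp.
rewrite dp.
have dq x : derive1 q x = derive1 phi x + (- c) * derive1 psi x.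
  apply: is_derive_derive1; apply: isdD.
    by apply: smooth1_is_derive; have [] := tphi.
  by apply: isdZ; apply: smooth1_is_derive; have [] := tpsi.
have sphi := tst_sqi tphi; have sphi' := tst_sqi (tst_deriv tphi).
have spsi := tst_sqi tpsi; have spsi' := tst_sqi tpsi'.
have -> : \int[mu]_(x in D) (D1 t x * derive1 q x) =
    \int[mu]_(x in D) (D1 t x * derive1 phi x) + (- c) * pairing L D1 (derive1 psi) t.
  rewrite /pairing -(RintegralZl _ (meas_oo 0 L) (sqi_mul (meas_oo 0 L) sD1 spsi')).
  rewrite -(RintegralD (meas_oo 0 L) (sqi_mul (meas_oo 0 L) sD1 sphi') (itgZ (meas_oo 0 L) _ (sqi_mul (meas_oo 0 L) sD1 spsi'))).
  by apply: Rint_ext => x _; rewrite dq; ring.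
have -> : \int[mu]_(x in D) (M t x * q x) =
    \int[mu]_(x in D) (M t x * phi x) + (- c) * pairing L M psi t.
  rewrite /pairing -(RintegralZl _ (meas_oo 0 L) (sqi_mul (meas_oo 0 L) sM spsi)).
  rewrite -(RintegralD (meas_oo 0 L) (sqi_mul (meas_oo 0 L) sM sphi) (itgZ (meas_oo 0 L) _ (sqi_mul (meas_oo 0 L) sM spsi))).
  by apply: Rint_ext => x _; rewrite /q; ring.
have -> : \int[mu]_(x in D) ((M t x + beta t) * phi x) =
    \int[mu]_(x in D) (M t x * phi x) + beta t * c.
  rewrite /c -(RintegralZl _ (meas_oo 0 L) iphi).
  rewrite -(RintegralD (meas_oo 0 L) (sqi_mul (meas_oo 0 L) sM sphi) (itgZ (meas_oo 0 L) _ iphi)).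
  by apply: Rint_ext => x _; rewrite mulrDl.
rewrite /beta; move=> /eqP; rewrite -subr_eq0 => /eqP h; apply/eqP; rewrite -subr_eq0; apply/eqP.
have lin (A B al ga d : R) : A + - d * al - - (B + - d * ga) = 0 ->
    A - - (B + - (al + ga) * d) = 0 by move=> <-; ring.
exact: lin h.
Qed.

(** Test with the derivative of order i: the i derivatives are then moved onto
    N and S. *)
Lemma top_derivative i t z n : third_order t -> L2I L (V t) ->
  weak_dx L i.+1 (N t) n -> weak_dx L i (S t) z ->
  weak_dx L (i + 3) (V t) (fun x => z x - n x).
Proof.
move=> eqt /L2IP sV /weak_dxP[sN sn HN] /weak_dxP[sS sz HS].
apply/weak_dxP; split => //; first exact: sqiB.
move=> phi tphi; have ti := tst_derivn i tphi.
have := eqt _ ti; rewrite -derive1nD addnC.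
have -> : derive1 (derive1n i phi) = derive1n i.+1 phi by rewrite derive1nS.
rewrite (HN _ tphi) (HS _ tphi) => h.
have -> : \int[mu]_(x in D) ((z x - n x) * phi x) =
    \int[mu]_(x in D) (z x * phi x) - \int[mu]_(x in D) (n x * phi x).
  rewrite -(RintegralB (meas_oo 0 L) (sqi_mul (meas_oo 0 L) sz (tst_sqi tphi)) (sqi_mul (meas_oo 0 L) sn (tst_sqi tphi))).
  by apply: Rint_ext => x _; rewrite mulrBl.
move: h; rewrite exprS exprD; set A := Rintegral _ _ _; set B := Rintegral _ _ _; set C := Rintegral _ _ _.
move=> /eqP; rewrite -addrA addr_eq0 => /eqP ->; ring.
Qed.

End elliptic.

End spatial_regularity.

(** * The differentiated equation *)

Section equation.
Context {R : realType}.
Local Notation mu := (@lebesgue_measure R).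
Local Notation mu2 := (mu \x mu)%E.
Implicit Types (a p phi e : R -> R) (x y t : R) (V Z S N : R -> R -> R) (v w : R * R -> R).
Variables (T L b : R) (k : nat) (g u0 mu0 nu0 nu1 : R -> R) (f u : R * R -> R).
Variables (W F U : nat -> R -> R -> R).
Hypothesis (T0 : 0 < T) (L0 : 0 < L) (k1 : (1 <= k)%N) (hg : C_n (3 * k - 1) g).
Local Notation I := (`]0, T[%classic : set (measurableTypeR R)).
Local Notation D := (`]0, L[%classic : set (measurableTypeR R)).
Local Notation Q := (QT T L : set (measurableTypeR R * measurableTypeR R)).
Local Notation G := (Gsum g U).

Hypothesis hW : time_chain T L k W.
Hypothesis hF : time_chain T L k.-1 F.
Hypothesis cU : forall m, (m < k)%N -> Ccurve T (U m).
Hypothesis WU : forall m, (m < k)%N -> ae_curve T L (W m) (U m).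

Lemma pair_UW m p t : (m < k)%N -> sqi mu D p -> t \in `[0, T] ->
  pairing L (U m) p t = pairing L (W m) p t.
Proof.
move=> mk sp tT; apply: ae_Rint_mul => //.
- exact: Ccurve_sqi (cU mk) tT.
- exact: L2c_sqi (hW.1 _ (ltnW mk)) tT.
- by apply: ae_mu (WU mk tT) => x h xD; rewrite h.
Qed.

Lemma U_time m t x : (m.+1 < k)%N -> t \in `]0, T[ -> x \in `]0, L[ ->
  is_derive t (1 : R) (fun s => U m s x) (U m.+1 t x).
Proof.
move=> mk tI0 xD; have mk' := ltnW mk.
apply: (Ccurve_time_derive (L := L) (cU mk') (cU mk) _ tI0 xD) => p {tI0}t tp tI.
have sp := tst_sqi tp.
rewrite (pair_UW mk sp (itv_oo_cc tI)).
apply: near_eq_is_derive (chain_derive T0 hW mk' tp tI).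
near=> s; rewrite pair_UW//; apply: itv_oo_cc.
by near: s; exact: near_in_itvoo.
Unshelve. all: by end_near. Qed.

Lemma ltn_pred_k m : (m <= k.-1)%N -> (m < k)%N.
Proof. by move=> h; rewrite -(prednK k1) ltnS. Qed.

Lemma pred_k_le : (k.-1 < 3 * k - 1)%N.
Proof. by move: k1; clear; lia. Qed.

Lemma G_chain : time_chain T L k.-1 G.
Proof.
apply: Ccurve_chain => //.
- move=> m mk; apply: (Ccurve_Gsum T0 hg); first exact: leq_trans mk (ltnW pred_k_le).
  by move=> n nm; apply/cU/ltn_pred_k; exact: leq_trans mk.
- move=> m t x mk tI xD; apply: (is_derive_Gsum hg); first exact: ltn_trans mk pred_k_le.
  move=> n nm; apply: U_time => //; apply: ltn_pred_k.
  exact: leq_trans mk.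
Qed.

Definition third p x := b * derive1 p x + derive1n 3 p x.

Lemma third_tst p : tst 0 L p -> tst 0 L (third p).
Proof. by move=> tp; apply: tstD; [apply: tstZ; exact: tst_deriv|exact: tst_derivn]. Qed.

(** The equation differentiated m times in t, tested with p at time t. *)
Definition residual m p t :=
  pairing L (W m) (third p) t + pairing L (G m) (derive1 p) t + pairing L (F m) p t
  - pairing L (W m.+1) p t.

Lemma residual_scont m p : (m < k)%N -> tst 0 L p ->
  [/\ scont T (pairing L (W m) (third p)), scont T (pairing L (G m) (derive1 p)),
      scont T (pairing L (F m) p) & scont T (pairing L (W m.+1) p)].
Proof.
move=> mk tp; have mk' : (m <= k.-1)%N by rewrite -ltnS prednK.
split; apply: pairing_scont.
- exact: hW.1 (ltnW mk).
- exact: tst_sqi (third_tst tp).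
- exact: G_chain.1.
- exact: tst_sqi (tst_deriv tp).
- exact: hF.1.
- exact: tst_sqi tp.
- exact: hW.1.
- exact: tst_sqi tp.
Qed.

Lemma int_residual m a p : (m < k)%N -> tst 0 T a -> tst 0 L p ->
  \int[mu]_(t in I) (a t * residual m p t) =
  \int[mu]_(t in I) (a t * pairing L (W m) (third p) t) +
  \int[mu]_(t in I) (a t * pairing L (G m) (derive1 p) t) +
  \int[mu]_(t in I) (a t * pairing L (F m) p t) -
  \int[mu]_(t in I) (a t * pairing L (W m.+1) p t).
Proof.
move=> mk ta tp; have [c1 c2 c3 c4] := residual_scont mk tp; have sa := tst_sqi ta.
have i1 := sqi_mul (meas_oo 0 T) sa (scont_sqi T0 c1).
have i2 := sqi_mul (meas_oo 0 T) sa (scont_sqi T0 c2).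
have i3 := sqi_mul (meas_oo 0 T) sa (scont_sqi T0 c3).
have i4 := sqi_mul (meas_oo 0 T) sa (scont_sqi T0 c4).
rewrite -(RintegralD (meas_oo 0 T) i1 i2) -(RintegralD (meas_oo 0 T) (itgD (meas_oo 0 T) i1 i2) i3).
rewrite -(RintegralB (meas_oo 0 T) (itgD (meas_oo 0 T) (itgD (meas_oo 0 T) i1 i2) i3) i4).
by apply: Rint_ext => t _; rewrite /residual; ring.
Qed.

Hypothesis (su : sqi mu2 Q u) (uW : curve_of T L u (W 0)).
Hypothesis (sf : sqi mu2 Q f) (fF : curve_of T L f (F 0)).
Hypothesis sol : weak_solution T L b g f u0 mu0 nu0 nu1 u.

Lemma Gsum0 t x : G 0%N t x = g (U 0%N t x).
Proof. by rewrite /Gsum /= big_seq1 /mono /= big_nil mulr1. Qed.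

(** The representative U_0 is bounded, hence so is g(u) up to a null set. *)
Lemma gu_curve : sqi mu2 Q (fun z => g (u z)) /\ curve_of T L (fun z => g (u z)) (G 0%N).
Proof.
have cg : continuous g by exact: (Cn_cont (j := 0) hg).
have gG : curve_of T L (fun z => g (u z)) (G 0%N).
  apply: ae_mu uW => t h tI; apply: ae_mu2 (h tI) (WU k1 (itv_oo_cc tI)) => x h1 h2 xD.
  by rewrite Gsum0 h1// h2.
split => //; have cG : Ccurve T (G 0%N) by apply: (Ccurve_Gsum T0 hg) => // n; rewrite leqn0 => /eqP ->; exact: cU.
have [M M0 HM] := L2c_bounded T0 (Ccurve_L2c T0 L0 cG).
have mg : measurable_fun Q (fun z => g (u z)).
  have [mu' _] := su; apply: (measurableT_comp (f := g)) => //.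
  by apply: cont_meas.
apply: (sqi_of_sections mg M0); apply: ae_mu gG => t h tI; have {}h := h tI.
have sG := Ccurve_sqi L cG (itv_oo_cc tI).
have mgt := meas_section mg tI.
have h' : {ae mu, forall x, x \in `]0, L[ -> G 0%N t x = g (u (t, x))}.
  by apply: ae_mu h => x hx xD; rewrite hx.
split; first exact: (sqi_ae (meas_oo 0 L) mgt h' sG).
rewrite -(nsq_ae (meas_oo 0 L) _ mgt h'); last by have [] := sG.
by apply: HM; exact: itv_oo_cc.
Qed.

(** The equation itself tested with a p is the case m = 0.  Each of the four
    pairings is a chain, so the case m+1 for a is the case m for a'. *)
Lemma test_residual m a p : (m < k)%N -> tst 0 T a -> tst 0 L p ->
  \int[mu]_(t in I) (a t * residual m p t) = 0.
Proof.
elim: m a p => [|m IH] a p mk ta tp.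
  have [sgu guG] := gu_curve; have := weak_solution_tensor T0 L0 sol ta tp.
  have ca := tst_cont ta; have ca' := tst_cont (tst_deriv ta).
  have sp := tst_sqi tp; have sp' := tst_sqi (tst_deriv tp); have s3 := tst_sqi (third_tst tp).
  have t1 := sqi_mul (meas_QT T L) su (tensor_sqi T ca' sp).
  have t2 := sqi_mul (meas_QT T L) su (tensor_sqi T ca s3).
  have t3 := sqi_mul (meas_QT T L) sgu (tensor_sqi T ca sp').
  have t4 := sqi_mul (meas_QT T L) sf (tensor_sqi T ca sp).
  rewrite (Rint_ext mu2 (D := Q) (g := fun z => u z * (derive1 a z.1 * p z.2) + u z * (a z.1 * third p z.2)
     + g (u z) * (a z.1 * derive1 p z.2) + f z * (a z.1 * p z.2))); last first.
    by move=> z _; rewrite /third; ring.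
  rewrite (RintegralD (meas_QT T L) (itgD (meas_QT T L) (itgD (meas_QT T L) t1 t2) t3) t4).
  rewrite (RintegralD (meas_QT T L) (itgD (meas_QT T L) t1 t2) t3).
  rewrite (RintegralD (meas_QT T L) t1 t2).
  have cW := hW.1 0%N (leq0n _); have cG := G_chain.1 0%N (leq0n _); have cF := hF.1 0%N (leq0n _).
  rewrite (pairing_tensor T0 su uW cW ca' sp) (pairing_tensor T0 su uW cW ca s3).
  rewrite (pairing_tensor T0 sgu guG cG ca sp') (pairing_tensor T0 sf fF cF ca sp).
  rewrite -/(pairing L (W 0) p) => h.
  have lin (A' A B C X : R) : A' + A + B + C = 0 -> A' = - X -> A + B + C - X = 0.
    by move=> e1 e2; rewrite -e1 e2; ring.
  by rewrite int_residual//; exact: lin h (hW.2 _ _ _ mk tp ta).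
have mk' := ltnW mk; have mkp : (m < k.-1)%N by rewrite -ltnS prednK.
have := IH _ _ mk' (tst_deriv ta) tp.
rewrite (int_residual mk' (tst_deriv ta) tp) (int_residual mk ta tp).
rewrite (hW.2 _ _ _ mk' (third_tst tp) ta) (hW.2 _ _ _ mk tp ta).
rewrite (G_chain.2 _ _ _ mkp (tst_deriv tp) ta) (hF.2 _ _ _ mkp tp ta).
have lin (A B C X : R) : - A + - B + - C - - X = 0 -> A + B + C - X = 0.
  by move=> e; apply/eqP; rewrite -oppr_eq0 -e; apply/eqP; ring.
exact: lin.
Qed.

Lemma residual0 m p t : (m < k)%N -> tst 0 L p -> t \in `[0, T] -> residual m p t = 0.
Proof.
move=> mk tp; have [c1 c2 c3 c4] := residual_scont mk tp.
have cr : scont T (residual m p).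
  by apply: scontD; [apply: scontD => //; exact: scontD|exact: scontN].
apply: (scont_ae_eq T0 cr (e' := fun=> 0)); first by apply: cont_scont; exact: cst_continuous.
apply: (fundamental (scont_sqi T0 cr)) => a ta.
rewrite -[RHS](test_residual mk ta tp); apply: Rint_ext => t' _; exact: mulrC.
Qed.

(** Lower order terms and right-hand side of W_m''' + (b W_m + G_m)' = F_m - W_(m+1). *)
Definition lower m t x := b * W m t x + G m t x.
Definition source m t x := F m t x - W m.+1 t x.

Lemma third_order_eq m t : (m < k)%N -> t \in `[0, T] ->
  third_order L (W m) (lower m) (source m) t.
Proof.
move=> mk tT p tp; rewrite -[RHS](residual0 mk tp tT) /residual /pairing.
have mk' : (m <= k.-1)%N by rewrite -ltnS prednK.
have sW := L2c_sqi (hW.1 _ (ltnW mk)) tT; have sG := L2c_sqi (G_chain.1 _ mk') tT.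
have sF := L2c_sqi (hF.1 _ mk') tT; have sW1 := L2c_sqi (hW.1 _ mk) tT.
have sp := tst_sqi tp; have sp1 := tst_sqi (tst_deriv tp); have sp3 := tst_sqi (tst_derivn 3 tp).
have j1 := sqi_mul (meas_oo 0 L) sW sp1; have j2 := sqi_mul (meas_oo 0 L) sW sp3.
have j3 := sqi_mul (meas_oo 0 L) sG sp1; have j4 := sqi_mul (meas_oo 0 L) sF sp.
have j5 := sqi_mul (meas_oo 0 L) sW1 sp.
rewrite (Rint_ext mu (D := D) (f := fun x => lower m t x * derive1 p x)
  (g := fun x => b * (W m t x * derive1 p x) + G m t x * derive1 p x)); last first.
  by move=> x _; rewrite /lower mulrDl mulrA.
rewrite (RintegralD (meas_oo 0 L) (itgZ (meas_oo 0 L) b j1) j3) (RintegralZl _ (meas_oo 0 L) j1).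
rewrite (Rint_ext mu (D := D) (f := fun x => source m t x * p x)
  (g := fun x => F m t x * p x - W m.+1 t x * p x)); last first.
  by move=> x _; rewrite /source mulrBl.
rewrite (RintegralB (meas_oo 0 L) j4 j5).
rewrite (Rint_ext mu (D := D) (f := fun x => W m t x * third p x)
  (g := fun x => b * (W m t x * derive1 p x) + W m t x * derive1n 3 p x)); last first.
  by move=> x _; rewrite /third mulrDr mulrCA.
rewrite (RintegralD (meas_oo 0 L) (itgZ (meas_oo 0 L) b j1) j2) (RintegralZl _ (meas_oo 0 L) j1).
have lin (A B C X Y : R) : A + (B + C) + (X - Y) = B + A + C + X - Y by ring.
exact: lin.
Qed.

Hypothesis hF3 : forall m, (m < k)%N -> CH T L (3 * (k - m - 1)) (F m).
Hypothesis hW1 : forall m, (m < k)%N -> CH T L 1 (W m).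

Lemma U_CH s m : (m < k)%N -> CH T L s (W m) -> CH T L s (U m).
Proof.
move=> mk; apply: CH_ae; last exact: WU.
by move=> t tT; exact: Ccurve_sqi (cU mk) tT.
Qed.

Lemma lower_CH s m : (m < k)%N -> (m + s.+1 <= 3 * k - 1)%N ->
  (forall n, (n <= m)%N -> CH T L s.+1 (W n)) -> CH T L s.+1 (lower m).
Proof.
move=> mk ms hs; apply: CHD; first by apply: CHZ; exact: hs.
apply: (CH_Gsum T0 L0 hg ms) => n nm; have nk := leq_ltn_trans nm mk.
by split; [exact: cU|exact: U_CH (hs _ nm)].
Qed.

Lemma source_CH s m : (m < k)%N -> (s <= 3 * (k - m - 1))%N -> CH T L s (W m.+1) ->
  CH T L s (source m).
Proof.
move=> mk ms hs; have := CHD (CH_le ms (hF3 mk)) (CHZ (-1) hs); congr CH.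
by apply/funext => t; apply/funext => x; rewrite mulN1r.
Qed.

(** A step takes H^(s+1) to H^(s+3) for s <= 3j, the source term being in H^(3j) by
    the induction hypothesis.  From H^(3j), or from H^1 if j = 0, a first step
    leads at least to H^(3j+1), and the step with s = 3j then leads to H^(3j+3). *)
Lemma bootstrap j m : (j <= k)%N -> (m <= k - j)%N -> CH T L (3 * j) (W m).
Proof.
elim: j m => [|j IH] m jk mj.
  by split => //; apply: hW.1; move: mj; rewrite subn0.
have gain s n : (n <= k - j.+1)%N -> (s.+1 <= 3 * j + 1)%N ->
    (forall n, (n <= k - j.+1)%N -> CH T L s.+1 (W n)) -> CH T L s.+3 (W n).
  move=> nj sj hs; have nk : (n < k)%N by move: nj jk; clear; lia.
  have eqn t (tT : t \in `[0, T]) := third_order_eq nk tT.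
  apply: (@elliptic_gain _ T L L0 _ _ _ eqn s.+1 (3 * j)%N).
  - exact: hW1.
  - apply: lower_CH => //; first by move: nj sj jk; clear; lia.
    by move=> i iN; apply: hs; exact: leq_trans iN nj.
  - apply: source_CH => //; first by move: nj jk; clear; lia.
    by apply: IH; move: nj jk; clear; lia.
  - by move: sj; clear; lia.
(* The first step starts from H^1 for j = 0 and from H^(3j) otherwise. *)
have h1 n : (n <= k - j.+1)%N -> CH T L (maxn 1 (3 * j)).+2 (W n).
  move=> nj; have := @gain (maxn 1 (3 * j)).-1 n nj.
  rewrite prednK ?leq_max//; apply; first by clear; lia.
  move=> i ij; rewrite /maxn; case: ifP => _.
    by apply: IH; move: ij jk; clear; lia.
  by apply: hW1; move: ij jk; clear; lia.
have := @gain (3 * j)%N m mj; rewrite (_ : (3 * j).+3 = 3 * j.+1)%N; last by clear; lia.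
apply; first by clear; lia.
by move=> i ij; apply: CH_le (h1 i ij); clear; lia.
Qed.

Lemma W_CH m : (m < k)%N -> CH T L (3 * (k - m)) (W m).
Proof. by move=> mk; apply: bootstrap; move: mk; clear; lia. Qed.

Hypothesis F_top : forall m, (m < k)%N -> exists2 z, sqi mu2 Q z &
  {ae mu, forall t, t \in `]0, T[ -> weak_dx L (3 * (k - m) - 2) (F m t) (fun x => z (t, x))}.
Hypothesis W_top : exists2 z, sqi mu2 Q z &
  {ae mu, forall t, t \in `]0, T[ -> weak_dx L 1 (W k t) (fun x => z (t, x))}.

(** Descending induction on m = k - i, from W_k in L_2(0, T; H^1). *)
Lemma top_space_derivative i : (i <= k)%N -> exists2 z, sqi mu2 Q z &
  {ae mu, forall t, t \in `]0, T[ -> weak_dx L (3 * i + 1) (W (k - i)%N t) (fun x => z (t, x))}.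
Proof.
elim: i => [|i IH] ik; first by rewrite subn0; exact: W_top.
have [zw szw Hw] := IH (ltnW ik).
pose m := (k - i.+1)%N; have mk : (m < k)%N by move: ik; rewrite /m; clear; lia.
(* With m = k - (i+1), the order 3(k-m)-2 is the order 3i+1 already known for
   W_(m+1), and one derivative more is available for the lower order terms. *)
have e1 : (k - i)%N = m.+1 by move: ik; rewrite /m; clear; lia.
have e2 : (3 * (k - m) - 2 = 3 * i + 1)%N by move: ik; rewrite /m; clear; lia.
have [zf szf Hf] := F_top mk; rewrite e2 in Hf; rewrite e1 in Hw.
have hN : CH T L (3 * i + 1).+1 (lower m).
  apply: lower_CH => //; first by move: ik; rewrite /m; clear; lia.
  move=> n nm; apply: CH_le (W_CH (leq_ltn_trans nm mk)).
  by move: nm ik; rewrite /m; clear; lia.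
have [Ns [_ cN wN]] := CH_chain hN.
have [n [sn nE]] := measurable_version T0 (cN _ (leqnn _)).
exists (fun z => (zf z - zw z) - n z).
  by apply: (sqiB (meas_QT T L)) => //; exact: (sqiB (meas_QT T L)).
apply: ae_mu2 (ae_mu2 (fun t h1 h2 => conj h1 h2) Hf Hw) (sqi_section sn) => t [h1 h2] h3 tI.
have {}h1 := h1 tI; have {}h2 := h2 tI; have {}h3 := h3 tI; have tT := itv_oo_cc tI.
have -> : (3 * i.+1 + 1 = 3 * i + 1 + 3)%N by clear; lia.
apply: (top_derivative (third_order_eq mk tT)).
- by apply/L2IP; exact: L2c_sqi (hW.1 _ (ltnW mk)) tT.
- have := wN _ _ (leqnn _) tT; apply: weak_dx_ext => //.
  + exact: L2c_sqi (CH_L2c hN) tT.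
  + exact: aeW.
  + by apply: ae_mu (nE t tI) => x h xD; rewrite h.
- have := weak_dxD h1 (weak_dxZ (-1) h2).
  have -> : (fun x => F m t x + -1 * W m.+1 t x) = source m t.
    by apply/funext => x; rewrite mulN1r.
  by congr weak_dx; apply/funext => x; rewrite mulN1r.
Qed.

End equation.

Lemma bounded_choice (A : Type) (x0 : A) (k : nat) (P : nat -> A -> Prop) :
  (forall m, (m < k)%N -> exists x, P m x) ->
  exists X : nat -> A, forall m, (m < k)%N -> P m (X m).
Proof.
move=> H; have /choice[X HX] : forall m, exists x, (m < k)%N -> P m x.
  by move=> m; have [/H[x px]|_] := boolP (m < k)%N; [exists x|exists x0].
by exists X.
Qed.

Section initial_identification.
Context {R : realType}.
Local Notation mu := (@lebesgue_measure R).
Local Notation mu2 := (mu \x mu)%E.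
Variables (T L : R).
Hypothesis (T0 : 0 < T) (L0 : 0 < L).

Lemma weak_dt0_ae (v w : R * R -> R) : weak_dt T L 0 v w ->
  {ae mu, forall t, t \in `]0, T[ -> {ae mu, forall x, x \in `]0, L[ -> v (t, x) = w (t, x)}}.
Proof.
move=> [/L2QP sv /L2QP sw H].
have sB := sqiB (meas_QT T L) sv sw.
have h := Q_zero sB.
have {}h : ae_on T (fun t => ae_on L (fun x => v (t, x) - w (t, x) = 0)).
  apply: h => a p ta tp.
  have := H _ (tensor_test ta tp); rewrite expr0 mul1r /= => E.
  have st := tensor_sqi T (tst_cont ta) (tst_sqi tp).
  have i1 := sqi_mul (meas_QT T L) sv st; have i2 := sqi_mul (meas_QT T L) sw st.
  rewrite (Rint_ext mu2 (g := fun z => v z * (a z.1 * p z.2) - w z * (a z.1 * p z.2))); last first.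
    by move=> z _; rewrite mulrBl.
  by rewrite (RintegralB (meas_QT T L) i1 i2); apply/eqP; rewrite subr_eq0; apply/eqP.
apply: ae_mu h => t h tI; apply: ae_mu (h tI) => x hx xD.
by apply/eqP; rewrite -subr_eq0; apply/eqP; exact: hx.
Qed.

Lemma L2_H_curve s j w V : L2_H T L s w -> (j <= s)%N -> curve_of T L w V ->
  L2_continuous T L V -> exists2 z, sqi mu2 (QT T L) z &
  {ae mu, forall t, t \in `]0, T[ -> weak_dx L j (V t) (fun x => z (t, x))}.
Proof.
move=> H js wV cV; have [z [_ /L2QP sz Hz]] := H j js; exists z => //.
apply: ae_mu2 (ae_mu2 (fun t h1 h2 => conj h1 h2) Hz wV) (sqi_section sz) => t [h1 h2] h3 tI.
apply: (weak_dx_ext _ (h3 tI) _ _ (h1 tI)).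
- exact: L2c_sqi cV (itv_oo_cc tI).
- exact: h2.
- exact: aeW.
Qed.

End initial_identification.

Theorem corollary1p1 (R : realType) (L T b : R) (k : nat) (g : R -> R)
    (u0 mu0 nu0 nu1 : R -> R) (f u : R * R -> R) (Phi : nat -> R -> R)
    (L_gt0 : 0 < L) (T_gt0 : 0 < T) (k_ge1 : (1 <= k)%N)
    (g_smooth : C_n (3 * k - 1) g) (g_0 : g 0 = 0) (dg_0 : derive1 g 0 = 0)
    (u0_H : Hspace L (3 * k) u0)
    (mu0_H : Hfrac T (k%:R + 3^-1) mu0)
    (nu0_H : Hfrac T (k%:R + 3^-1) nu0)
    (nu1_H : Hfrac T k%:R nu1)
    (f_M : Mspace T L k f)
    (Phi_def : is_Phi T L b k g u0 f Phi)
    (compat : compatibility T L k Phi mu0 nu0 nu1)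
    (f_reg : forall m, (m < k)%N -> exists w,
      [/\ weak_dt T L m f w, C_H T L (3 * (k - m - 1)) w &
          L2_H T L (3 * (k - m) - 2) w])
    (u_X : Xspace T L k u)
    (u_sol : weak_solution T L b g f u0 mu0 nu0 nu1 u) :
  forall m, (m < k)%N -> exists w,
    [/\ weak_dt T L m u w, C_H T L (3 * (k - m)) w &
        L2_H T L (3 * (k - m) + 1) w].
Proof.
have [wW Hw] : exists wW : nat -> (R * R -> R) * (R -> R -> R), forall m, (m < k.+1)%N ->
    [/\ weak_dt T L m u (wW m).1, curve_of T L (wW m).1 (wW m).2,
        L2_continuous T L (wW m).2 & L2_H T L 1 (wW m).1].
  have := @bounded_choice ((R * R -> R) * (R -> R -> R))%type (fun=> 0, fun _ _ => 0) k.+1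
    (fun m X => [/\ weak_dt T L m u X.1, curve_of T L X.1 X.2, L2_continuous T L X.2 & L2_H T L 1 X.1]).
  apply => m; rewrite ltnS => mk.
  have [w [h1 [V [h2 h3 _]] h4]] := u_X.1 m mk.
  by exists (w, V 0%N); split => //; exact: h3.
have [fF Hf] : exists fF : nat -> (R * R -> R) * (R -> R -> R), forall m, (m < k)%N ->
    [/\ weak_dt T L m f (fF m).1, curve_of T L (fF m).1 (fF m).2,
        CH T L (3 * (k - m - 1)) (fF m).2 & L2_H T L (3 * (k - m) - 2) (fF m).1].
  have := @bounded_choice ((R * R -> R) * (R -> R -> R))%type (fun=> 0, fun _ _ => 0) k
    (fun m X => [/\ weak_dt T L m f X.1, curve_of T L X.1 X.2,
       CH T L (3 * (k - m - 1)) X.2 & L2_H T L (3 * (k - m) - 2) X.1]).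
  apply => m mk.
  have [w [h1 /C_H_CH[V h2 h3] h4]] := f_reg m mk.
  by exists (w, V).
pose w m := (wW m).1; pose W m := (wW m).2; pose F m := (fF m).2.
have hW : time_chain T L k W.
  apply: (time_chainP T_gt0 (v := u)) => m mk; exists (w m).
  by have [] := Hw m mk.
have hF : time_chain T L k.-1 F.
  apply: (time_chainP T_gt0 (v := f)) => m mk; exists (fF m).1.
  have mk' : (m < k)%N by rewrite -(prednK k_ge1) ltnS.
  by have [h1 h2 h3 _] := Hf m mk'; split => //; exact: CH_L2c h3.
have dW m : (m <= k)%N -> exists2 z, sqi (lebesgue_measure \x lebesgue_measure)%E (QT T L) z &
    {ae lebesgue_measure, forall t, t \in `]0, T[ -> weak_dx L 1 (W m t) (fun x => z (t, x))}.
  by move=> mk; have [_ h2 h3 h4] := Hw m mk; exact: (L2_H_curve h4).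
have [V HV] : exists V : nat -> R -> R -> R, forall m, (m < k)%N ->
    L2_continuous T L (V m) /\ forall t, t \in `[0, T] -> weak_dx L 1 (W m t) (V m t).
  have := @bounded_choice (R -> R -> R) (fun _ _ => 0) k
    (fun m V => L2_continuous T L V /\ forall t, t \in `[0, T] -> weak_dx L 1 (W m t) (V t)).
  apply => m mk.
  have [d sd Hd] := dW m (ltnW mk); have [d' sd' Hd'] := dW m.+1 mk.
  by have [V cV wV] := chain_CH1 T_gt0 hW mk sd sd' Hd Hd'; exists V.
have hW1 m : (m < k)%N -> CH T L 1 (W m).
  move=> mk; have [cV wV] := HV m mk; split; first exact: hW.1 (ltnW mk).
  by exists (V m).
pose U m t := acrep L (W m t) (V m t).
have cU m : (m < k)%N -> Ccurve T (U m).
  by move=> mk; apply: Ccurve_acrep => //; [exact: hW.1 (ltnW mk)|exact: (HV m mk).1].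
have WU m : (m < k)%N -> ae_curve T L (W m) (U m).
  by move=> mk; apply: CH_rep => // t tT; exact: (HV m mk).2.
have [u_w wW0 _ _] := Hw 0%N (ltn0Sn _).
have [f_w fF0 _ _] := Hf 0%N k_ge1.
have su : sqi (lebesgue_measure \x lebesgue_measure)%E (QT T L) u.
  by have [/L2QP] := u_w.
have sf : sqi (lebesgue_measure \x lebesgue_measure)%E (QT T L) f.
  by have [/L2QP] := f_w.
have uW := curve_of_ae (weak_dt0_ae u_w) wW0.
have fFc := curve_of_ae (weak_dt0_ae f_w) fF0.
have hF3 m : (m < k)%N -> CH T L (3 * (k - m - 1)) (F m) by move=> /Hf[].
have W_reg := W_CH T_gt0 L_gt0 k_ge1 g_smooth hW hF cU WU su uW sf fFc u_sol hF3 hW1.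
have F_top m : (m < k)%N -> exists2 z, sqi (lebesgue_measure \x lebesgue_measure)%E (QT T L) z &
    {ae lebesgue_measure, forall t, t \in `]0, T[ ->
      weak_dx L (3 * (k - m) - 2) (F m t) (fun x => z (t, x))}.
  by move=> mk; have [_ h2 h3 h4] := Hf m mk; exact: (L2_H_curve h4 (leqnn _) h2 (CH_L2c h3)).
have top := top_space_derivative T_gt0 L_gt0 k_ge1 g_smooth hW hF cU WU su uW sf fFc u_sol
  hF3 hW1 F_top (dW k (leqnn _)).
move=> m mk; have [h1 h2 h3 _] := Hw m (ltnW mk).
exists (w m); split => //; first exact: CH_C_H h2 (W_reg m mk).
have Lw : L2Q T L (w m) by have [] := h1.
move=> j; rewrite addn1 leq_eqVlt ltnS => /predU1P[->|jk]; last first.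
  exact: (CH_weak_Q T_gt0 jk Lw h2 (W_reg m mk)).
have [z sz Hz] := top (k - m)%N (leq_subr _ _); rewrite subKn ?(ltnW mk)// addn1 in Hz.
exists z; split => //; first exact/L2QP.
have sw := (L2QP _ _ _).1 Lw.
apply: ae_mu2 (ae_mu2 (fun t h1 h2 => conj h1 h2) (sqi_section sw) (sqi_section sz))
  (ae_mu2 (fun t h1 h2 => conj h1 h2) Hz h2) => t [s1 s2] [h4 h5] tI.
apply: (weak_dx_ext (s1 tI) (s2 tI) _ _ (h4 tI)); last exact: aeW.
by apply: ae_mu (h5 tI) => x h xD; exact/esym/h.
Qed.
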